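(* Let $(D,X)$ be a Dyer system with Dyer graph $\Gamma$, and let $G$ be the associated conjugacy graph on the subsets of $X$ (defined in the context). Let $Y,Y'\subseteq X$. Then the following statements are equivalent: 1. There exists $\alpha\in D$ such that $\alpha Y\alpha^{-1}=Y'$. 2. There exists $\beta\in D$ such that $\beta D_Y\beta^{-1}=D_{Y'}$. 3. $Y$ and $Y'$ are in the same connected component of $G$.
   Context: A Dyer graph is a finite simplicial graph $\Gamma$ with vertex set $V(\Gamma)$ and edge set $E(\Gamma)$, together with a vertex labelling $f\colon V(\Gamma)\to\mathbb{N}_{\geq 2}\cup\{\infty\}$ and an edge labelling $m\colon E(\Gamma)\to\mathbb{N}_{>2}\cup\{\infty\}$ such that for every edge $\{u,v\}\in E(\Gamma)$, if $f(v)\geq 3$ (including $f(v)=\infty$), then $m(u,v)=\infty$. The labelling $m$ is extended to all pairs of distinct vertices by $m(u,v)=2$ if $\{u,v\}\notin E(\Gamma)$. The associated Dyer group is $$D(\Gamma)=\langle V(\Gamma)\mid v^{f(v)}=1 \text{ for all } v \text{ with } f(v)<\infty,\ \underbrace{uvu\cdots}_{m(u,v)\text{ terms}}=\underbrace{vuv\cdots}_{m(u,v)\text{ terms}}\text{ for all } \{u,v\}\text{ with } m(u,v)\neq\infty\rangle.$$ A Dyer system is a pair $(D,X)$ where $D$ is a group and $X\subseteq D$ is a generating set such that there exist a Dyer graph $\Gamma$ and a group isomorphism $D(\Gamma)\to D$ mapping $V(\Gamma)$ bijectively onto $X$; elements of $X$ are identified with the vertices of $\Gamma$. For $Y\subseteq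 X$, $D_Y$ denotes the subgroup of $D$ generated by $Y$, $\Gamma_Y$ the full subgraph of $\Gamma$ spanned by $Y$, and $Y_2$ the set of elements of $Y$ of order $2$. The graph $G$: its vertices are the subsets of $X$. Its edges are the triples $(Y,t,t')$ satisfying: (a) $Y\subseteq X$; (b) $t$ and $t'$ both have order $2$ and belong to the same connected component $\Gamma_0$ of $\Gamma_Y$ and to the same connected component $\Gamma_0'$ of $\Gamma_{Y_2}$, and moreover $\Gamma_0=\Gamma_0'$; (c) $\Gamma_0$ is, as an edge-labelled graph, one of the Coxeter graphs of type $A_l$ ($l\geq 2$), $D_l$ ($l\geq 5$ odd), $E_6$, or $I_2(p)$ ($p\geq 5$ odd), in the usual convention that non-adjacent vertices correspond to $m=2$; (d) $t'=w_0tw_0$ and $t\neq t'$, where $w_0$ is the element of maximal length in the finite Coxeter group generated by the vertices of $\Gamma_0$. The edge $(Y,t,t')$ joins the vertex $Y\setminus\{t\}$ with the vertex $Y\setminus\{t'\}$. *)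

(* Defs.v *)
From HB Require Import structures.
From mathcomp Require Import all_boot finmap.
From mathcomp Require Import boolp classical_sets.
From mathcomp Require Import generic_quotient.

Set Implicit Arguments.
Unset Strict Implicit.
Unset Printing Implicit Defensive.

Local Open Scope group_scope.
Local Open Scope quotient_scope.

(* The letter (v, false) stands for v and (v, true) for v^-1. *)
Definition word (V : choiceType) := seq (V * bool).

Definition pos_word (V : choiceType) (s : seq V) : word V :=
  [seq (v, false) | v <- s].

Definition inv_letter (V : choiceType) (a : V * bool) := (a.1, ~~ a.2).

Definition inv_word (V : choiceType) (s : word V) : word V :=
  rev (map (@inv_letter V) s).

Inductive pres_eq (V : choiceType) (R : word V -> word V -> Prop) :
    word V -> word V -> Prop :=
  | PresRel s t : R s t -> pres_eq R s t
  | PresCancel a : pres_eq R [:: a; inv_letter a] [::]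
  | PresRefl s : pres_eq R s s
  | PresSym s t : pres_eq R s t -> pres_eq R t s
  | PresTrans s t u : pres_eq R s t -> pres_eq R t u -> pres_eq R s u
  | PresCat s s' t t' :
      pres_eq R s s' -> pres_eq R t t' -> pres_eq R (s ++ t) (s' ++ t').

Definition pres_eqb (V : choiceType) (R : word V -> word V -> Prop) : rel (word V) :=
  fun s t => `[< pres_eq R s t >].

Lemma pres_eqb_refl (V : choiceType) R : reflexive (@pres_eqb V R).
Proof. by move=> s; apply/asboolP/PresRefl. Qed.

Lemma pres_eqb_sym (V : choiceType) R : symmetric (@pres_eqb V R).
Proof. by move=> s t; apply/asboolP/asboolP => /PresSym. Qed.

Lemma pres_eqb_trans (V : choiceType) R : transitive (@pres_eqb V R).
Proof.
by move=> t s u /asboolP st /asboolP tu; apply/asboolP/(PresTrans st tu).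
Qed.

Canonical pres_equiv (V : choiceType) (R : word V -> word V -> Prop) :=
  EquivRel (pres_eqb R) (@pres_eqb_refl V R) (@pres_eqb_sym V R)
    (@pres_eqb_trans V R).

Definition presented (V : choiceType) (R : word V -> word V -> Prop) : Type :=
  {eq_quot pres_equiv R}.

HB.instance Definition _ (V : choiceType) (R : word V -> word V -> Prop) :=
  Choice.on (presented R).

Definition pres_class (V : choiceType) (R : word V -> word V -> Prop)
  (s : word V) : presented R := \pi_({eq_quot pres_equiv R}) s.

Definition pres_repr (V : choiceType) (R : word V -> word V -> Prop)
  (x : presented R) : word V := repr (x : {eq_quot pres_equiv R}).

Lemma pres_reprK (V : choiceType) R : cancel (@pres_repr V R) (@pres_class V R).
Proof. exact: reprK. Qed.

Lemma pres_classP (V : choiceType) R (s t : word V) :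
  pres_class R s = pres_class R t <-> pres_eq R s t.
Proof.
split=> [/eqP | st]; first by rewrite /pres_class eqquotE => /asboolP.
by apply/eqP; rewrite /pres_class eqquotE; apply/asboolP.
Qed.

Lemma pres_repr_class (V : choiceType) R (s : word V) :
  pres_eq R (pres_repr (pres_class R s)) s.
Proof. by apply/pres_classP; rewrite pres_reprK. Qed.

Definition pres_mul (V : choiceType) (R : word V -> word V -> Prop)
  (x y : presented R) := pres_class R (pres_repr x ++ pres_repr y).

Definition pres_one (V : choiceType) (R : word V -> word V -> Prop) :=
  pres_class R [::].

Definition pres_inv (V : choiceType) (R : word V -> word V -> Prop)
  (x : presented R) := pres_class R (inv_word (pres_repr x)).

Lemma pres_mulE (V : choiceType) R (s t : word V) :
  pres_mul (pres_class R s) (pres_class R t) = pres_class R (s ++ t).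
Proof. by apply/pres_classP/PresCat; exact: pres_repr_class. Qed.

Lemma pres_mulA (V : choiceType) R : associative (@pres_mul V R).
Proof.
move=> x y z; rewrite -(pres_reprK x) -(pres_reprK y) -(pres_reprK z).
by rewrite !pres_mulE catA.
Qed.

Lemma pres_mul1x (V : choiceType) R : left_id (pres_one R) (@pres_mul V R).
Proof. by move=> x; rewrite -(pres_reprK x) pres_mulE. Qed.

Lemma pres_mulx1 (V : choiceType) R : right_id (pres_one R) (@pres_mul V R).
Proof. by move=> x; rewrite -(pres_reprK x) pres_mulE cats0. Qed.

Lemma inv_letterK (V : choiceType) : involutive (@inv_letter V).
Proof. by case=> v b; rewrite /inv_letter negbK. Qed.

Lemma inv_wordK (V : choiceType) : involutive (@inv_word V).
Proof.
move=> s; rewrite /inv_word map_rev revK -map_comp -[RHS]map_id.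
by apply: eq_map => a /=; rewrite inv_letterK.
Qed.

Lemma pres_eq_catV (V : choiceType) R (s : word V) :
  pres_eq R (s ++ inv_word s) [::].
Proof.
elim: s => [|a s IHs]; first exact: PresRefl.
rewrite /inv_word map_cons rev_cons -/(inv_word s) -cats1 -cat1s -catA.
apply: PresTrans (PresCancel R a); rewrite -[X in pres_eq _ _ X]cat1s.
apply: PresCat (PresRefl _ _) _; rewrite catA -[X in pres_eq _ _ X]cat0s.
exact: PresCat IHs (PresRefl _ _).
Qed.

Lemma pres_mulxV (V : choiceType) R :
  right_inverse (pres_one R) (@pres_inv V R) (@pres_mul V R).
Proof.
move=> x; rewrite -{1}(pres_reprK x) pres_mulE.
exact/pres_classP/pres_eq_catV.
Qed.

Lemma pres_mulVx (V : choiceType) R :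
  left_inverse (pres_one R) (@pres_inv V R) (@pres_mul V R).
Proof.
move=> x; rewrite -{2}(pres_reprK x) pres_mulE; apply/pres_classP.
by rewrite -{2}[pres_repr x]inv_wordK; exact: pres_eq_catV.
Qed.

HB.instance Definition _ (V : choiceType) (R : word V -> word V -> Prop) :=
  isGroup.Build (presented R) (@pres_mulA V R) (@pres_mul1x V R) (@pres_mulx1 V R)
    (@pres_mulVx V R) (@pres_mulxV V R).

Definition pres_gen (V : choiceType) (R : word V -> word V -> Prop) (v : V) :
  presented R := pres_class R (pos_word [:: v]).

(* An element of N \cup {oo}, with None for oo. *)
Definition label := option nat.

Definition label_geq (n : nat) (k : label) : bool :=
  if k is Some k' then n <= k' else true.

(* elabel is meaningful on adjacent pairs only. *)
Record dyer_graph (V : finType) := DyerGraph {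
  adj : rel V;
  vlabel : V -> label;
  elabel : V -> V -> label;
  adj_sym : symmetric adj;
  adj_irr : irreflexive adj;
  vlabel_geq2 : forall v, label_geq 2 (vlabel v);
  elabel_sym : forall u v, adj u v -> elabel u v = elabel v u;
  elabel_gt2 : forall u v, adj u v -> label_geq 3 (elabel u v);
  elabel_infty :
    forall u v, adj u v -> label_geq 3 (vlabel v) -> elabel u v = None
}.

(* Only meaningful on pairs of distinct vertices. *)
Definition mlabel (V : finType) (Gamma : dyer_graph V) (u v : V) : label :=
  if adj Gamma u v then elabel Gamma u v else Some 2.

Fixpoint alternating (V : Type) (u v : V) (n : nat) : seq V :=
  if n is n'.+1 then u :: alternating v u n' else [::].

Inductive dyer_rel (V : finType) (Gamma : dyer_graph V) :
    word V -> word V -> Prop :=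
  | DyerOrder v n : vlabel Gamma v = Some n ->
      dyer_rel Gamma (pos_word (nseq n v)) [::]
  | DyerBraid u v n : u != v -> mlabel Gamma u v = Some n ->
      dyer_rel Gamma (pos_word (alternating u v n))
                     (pos_word (alternating v u n)).

Definition dyer_group (V : finType) (Gamma : dyer_graph V) : groupType :=
  presented (dyer_rel Gamma).

Definition dyer_gen (V : finType) (Gamma : dyer_graph V) (v : V) :
  dyer_group Gamma := pres_gen (dyer_rel Gamma) v.

(* The vertices of the Dyer graph are identified with the elements of X, so
   that the bijection induced by the isomorphism phi from the vertices to X is
   the identity; X generates D because phi is onto. *)
Definition dyer_system (D : groupType) (X : {fset D}) (Gamma : dyer_graph X) :
    Prop :=
  exists phi : {multiplicative dyer_group Gamma -> D},
    bijective phi /\ forall x : X, phi (dyer_gen Gamma x) = val x.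

Definition elements (D : groupType) (X : {fset D}) (Y : {set X}) : set D :=
  [set val y | y in [set` Y]]%classic.

Definition generated (D : groupType) (A : set D) : set D :=
  smallest (fun H : set D => group_closed (mem H)) A.

Definition parabolic (D : groupType) (X : {fset D}) (Y : {set X}) : set D :=
  generated (elements Y).

Definition conjugate_by (D : groupType) (a : D) (A : set D) : set D :=
  [set a * x * a^-1 | x in A]%classic.

Definition order_two (D : groupType) (x : D) : bool :=
  (x != 1) && (x ^+ 2 == 1).

Definition involutions (D : groupType) (X : {fset D}) (Y : {set X}) : {set X} :=
  [set y in Y | order_two (val y)]%SET.

Definition induced_adj (V : finType) (Gamma : dyer_graph V) (Y : {set V}) :
    rel V :=
  [rel u v | [&& u \in Y, v \in Y & adj Gamma u v]].

(* A component is a full subgraph, so it is represented by its vertex set. *)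
Definition components (V : finType) (Gamma : dyer_graph V) (Y : {set V}) :
    {set {set V}} :=
  equivalence_partition (connect (induced_adj Gamma Y)) Y.

(* Edge labels of graphs on initial segments of nat, label 2 meaning no edge;
   the values on the diagonal are irrelevant. *)
Definition simply_laced (e : rel nat) : nat -> nat -> label :=
  fun i j => if e i j || e j i then Some 3 else Some 2.

Definition coxeter_A : nat -> nat -> label :=
  simply_laced [rel i j | j == i.+1].

(* The path 0 - 1 - ... - (l - 2), with l - 1 attached to l - 3. *)
Definition coxeter_D (l : nat) : nat -> nat -> label :=
  simply_laced
    [rel i j | (j == i.+1) && (j < l.-1) || (i == l - 3) && (j == l.-1)].

(* The path 0 - 1 - 2 - 3 - 4, with 5 attached to 2. *)
Definition coxeter_E6 : nat -> nat -> label :=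
  simply_laced [rel i j | (j == i.+1) && (j < 5) || (i == 2) && (j == 5)].

Definition coxeter_I2 (p : nat) : nat -> nat -> label := fun _ _ => Some p.

(* The edges of Gamma have labels > 2, so that equality of the extended labels
   is an isomorphism of edge-labelled graphs. *)
Definition has_type (V : finType) (Gamma : dyer_graph V) (C : {set V})
    (n : nat) (M : nat -> nat -> label) : Prop :=
  exists h : 'I_n -> V,
    [/\ injective h, [set h i | i : 'I_n]%SET = C &
        forall i j : 'I_n, i != j -> mlabel Gamma (h i) (h j) = M i j].

Definition admissible (V : finType) (Gamma : dyer_graph V) (C : {set V}) :
    Prop :=
  [\/ exists2 l, 2 <= l & has_type Gamma C l coxeter_A,
      exists2 l, (5 <= l) && odd l & has_type Gamma C l (coxeter_D l),
      has_type Gamma C 6 coxeter_E6 |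
      exists2 p, (5 <= p) && odd p & has_type Gamma C 2 (coxeter_I2 p)].

(* Inverses of generators are not needed: this is only used for sets C of
   elements of order two. *)
Definition expression (D : groupType) (X : {fset D}) (C : {set X}) (g : D)
    (s : seq X) : Prop :=
  {subset s <= C} /\ g = \prod_(x <- s) val x.

Definition has_length (D : groupType) (X : {fset D}) (C : {set X}) (g : D)
    (n : nat) : Prop :=
  (exists2 s, expression C g s & size s = n) /\
  (forall s, expression C g s -> n <= size s).

Definition longest (D : groupType) (X : {fset D}) (C : {set X}) (w : D) :
    Prop :=
  parabolic C w /\
  exists2 n, has_length C w n &
    forall g k, parabolic C g -> has_length C g k -> k <= n.

Definition conj_edge (D : groupType) (X : {fset D}) (Gamma : dyer_graph X)
    (Y : {set X}) (t t' : X) : Prop :=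
  [/\ order_two (val t) && order_two (val t'), t != t' &
    exists C : {set X},
      [/\ (C \in components Gamma Y) && (C \in components Gamma (involutions Y)),
          (t \in C) && (t' \in C),
          admissible Gamma C &
          exists2 w0 : D, longest C w0 & val t' = w0 * val t * w0]].

Definition conj_adj (D : groupType) (X : {fset D}) (Gamma : dyer_graph X)
    (A B : {set X}) : Prop :=
  exists (Y : {set X}) (t t' : X),
    conj_edge Gamma Y t t' /\
    ((A = Y :\ t /\ B = Y :\ t') \/ (A = Y :\ t' /\ B = Y :\ t))%SET.

Definition same_component (D : groupType) (X : {fset D}) (Gamma : dyer_graph X)
    (A B : {set X}) : bool :=
  connect [rel A' B' | `[< conj_adj Gamma A' B' >]] A B.

(* Main.v *)
From HB Require Import structures.
From mathcomp Require Import boolp classical_sets reals Rstruct.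
From mathcomp Require Import all_boot all_order all_algebra perm finmap.
From mathcomp Require Import trigo ring lra zify.
Require Import Defs.

(** Adjoining to D one involution per vertex v of order greater than 2, inverting
    v and commuting with the other generators, yields a Coxeter group W
    acting on its geometric representation.  Let b in W conjugate (the image of)
    D_Y onto that of D_Y' and be of minimal length; then b and its inverse send
    the simple roots involved to positive vectors, so b sends the simple roots of
    Y bijectively to those of Y'.  By the argument of Deodhar and Howlett, b is a
    product of elementary steps A -> (A + x) - t, where the component K of x in
    A + x generates a finite group and t is the image of x under the opposition
    involution of K.  Conjugacy invariants of W show that in a step with x <> t
    both x and t are vertices of order 2, and positivity of the form on K excludes
    infinite labels, so that K consists of vertices of order 2.  The opposition
    involution being nontrivial, K has type A_l, D_l (l odd), E_6 or I_2(p) (p odd):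
    this only needs the part of the classification of positive Coxeter graphs in
    which there is a nontrivial graph automorphism.  Conversely, an edge of the
    conjugacy graph is realized by conjugation with a longest element. *)

Set Implicit Arguments.
Unset Strict Implicit.
Unset Printing Implicit Defensive.

Import Order.TTheory GRing.Theory Num.Theory.
Local Open Scope ring_scope.

(** * Cosines of the labels *)

(** A vertex of order above 2 is not a reflection; splitting it into a product of two reflections
    makes roots and lengths available. The elements of W carrying the image of D_Y to that of D_Y'
    form a set stable under the generators attached to Y on one side and to Y' on the other, because
    the added involutions normalize these images; this yields the positivity for a shortest such
    element. Finiteness of K is nowhere given: it is deduced from the step, whose element has only
    finitely many inversions. Having finitely many roots makes the form positive on nonnegative
    vectors, and each excluded graph carries an explicit nonnegative vector of norm at most 0,
    usually the null vector of an affine diagram. The types D_l with l even, F_4 and I_2(p) with p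
    even have symmetric diagrams but a trivial opposition: D_l is removed by counting sign changes,
    the others by the parity of letters in a word. To return from W to D, lengths and signs of roots
    are studied for any group mapping to W whose chosen generators satisfy the Coxeter relations. *)

Section Chebyshev.
Variable R : realType.
Implicit Types (c t : R) (n k : nat) (l : label).

(** The Chebyshev polynomial U_(n-1) of the second kind: at c = cos t it is sin(n t) / sin t. Its
    values are the coordinates of the roots of a dihedral group. *)
Fixpoint cheb c n : R :=
  if n is n1.+1 then
    if n1 is n2.+1 then 2 * c * cheb c n1 - cheb c n2 else 1
  else 0.

Lemma chebSS c n : cheb c n.+2 = 2 * c * cheb c n.+1 - cheb c n.
Proof. by []. Qed.

Lemma cheb_sin t n : cheb (cos t) n * sin t = sin (n%:R * t).
Proof.
suff [] : cheb (cos t) n * sin t = sin (n%:R * t) /\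
          cheb (cos t) n.+1 * sin t = sin (n.+1%:R * t) by [].
elim: n => [|n [IH0 IH1]]; first by rewrite /= !mul0r mul1r mul1r sin0.
split=> //; rewrite chebSS.
have -> : (n.+2%:R : R) * t = n.+1%:R * t + t by rewrite -natr1; ring.
rewrite mulrBl -(mulrA (2 * cos t)) IH0 IH1.
have -> : (n%:R : R) * t = n.+1%:R * t - t by rewrite -natr1; ring.
by rewrite sinB sinD; ring.
Qed.

Lemma cheb1 n : cheb 1 n = n%:R.
Proof.
suff [] : cheb 1 n = n%:R /\ cheb 1 n.+1 = n.+1%:R :> R by [].
elim: n => [|n [IH0 IH1]] //; split=> //.
by rewrite chebSS IH0 IH1 -!natr1; ring.
Qed.

(** The value 1 at the infinite label is the limit of cos(pi / n); there [cheb] takes the value n,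
    by [cheb1]. *)
Definition cosl l : R := if l is Some n then cos (pi / n%:R) else 1.

Lemma pidiv_bounds n : (2 <= n)%N -> (0 : R) < pi / n%:R <= (pi : R) / 2.
Proof.
move=> n2; have n0 : (0 : R) < n%:R by rewrite ltr0n; case: n n2.
rewrite divr_gt0 ?pi_gt0 //= ler_pM2l ?pi_gt0 // lef_pV2 ?posrE //.
by rewrite ler_nat.
Qed.

Lemma sin_pidiv_gt0 n : (2 <= n)%N -> 0 < sin (pi / n%:R) :> R.
Proof.
move=> n2; apply: sin_gt0_pi; have /andP[-> h] /= := pidiv_bounds n2.
by apply: le_lt_trans h _; have := pi_gt0 R; lra.
Qed.

Lemma cheb_ge0 l k :
  label_geq 2 l -> (if l is Some n then (k <= n)%N else true) ->
  0 <= cheb (cosl l) k.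
Proof.
case: l => [n|_ _] /=; last by rewrite cheb1 ler0n.
move=> n2 kn; have s0 := sin_pidiv_gt0 n2.
rewrite -(pmulr_lge0 _ s0) cheb_sin; apply: sin_ge0_pi.
have /andP[t0 _] := pidiv_bounds n2.
have n0 : (0 : R) < n%:R by rewrite ltr0n; case: n n2 {kn s0 t0}.
apply/andP; split; first by rewrite mulr_ge0 ?ler0n ?ltW.
rewrite mulrCA ger_pMr ?pi_gt0 //.
by rewrite ler_pdivrMr // mul1r ler_nat.
Qed.

Lemma cheb_label n : (2 <= n)%N -> cheb (cosl (Some n)) n = 0.
Proof.
move=> n2; have s0 := sin_pidiv_gt0 n2.
apply: (mulIf (lt0r_neq0 s0)); rewrite cheb_sin mul0r mulrC divfK ?sinpi //.
by rewrite pnatr_eq0; case: n n2 {s0}.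
Qed.

Lemma cheb_labelS n : (2 <= n)%N -> cheb (cosl (Some n)) n.+1 = -1.
Proof.
move=> n2; have s0 := sin_pidiv_gt0 n2.
apply: (mulIf (lt0r_neq0 s0)); rewrite cheb_sin -natr1 mulrDl mul1r.
rewrite [_ * (_ / _)]mulrC divfK; last by rewrite pnatr_eq0; case: n n2 {s0}.
by rewrite addrC sinDpi mulN1r.
Qed.

Lemma cosl_ge0 l : label_geq 2 l -> 0 <= cosl l.
Proof.
case: l => [n|] //= n2; apply: cos_ge0_pihalf.
have /andP[t0 ->] := pidiv_bounds n2; rewrite andbT.
by have := pi_gt0 R; lra.
Qed.

Lemma cosl_sqr_lt1 n : (2 <= n)%N -> cosl (Some n) ^+ 2 < 1.
Proof.
move=> n2; have s0 := sin_pidiv_gt0 n2.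
by rewrite cos2sin2 ltrBlDr ltrDl exprn_gt0.
Qed.

Lemma cosl_le n l : (2 <= n)%N -> label_geq n l -> cosl (Some n) <= cosl l.
Proof.
case: l => [k|] /= n2 nk; last exact: cos_le1.
have k2 := leq_trans n2 nk.
have /andP[a0 a1] := pidiv_bounds n2; have /andP[b0 b1] := pidiv_bounds k2.
have p0 := pi_gt0 R.
rewrite leNgt ltr_cos ?in_itv /=; try by apply/andP; split; lra.
rewrite -leNgt ler_pM2l // lef_pV2 ?posrE ?ltr0n ?ler_nat //.
  by case: k k2 {nk b0 b1}.
by case: n n2 {nk a0 a1}.
Qed.

Lemma cosl_inj n k : (2 <= n)%N -> (2 <= k)%N ->
  cosl (Some n) = cosl (Some k) -> n = k.
Proof.
move=> n2 k2 /cos_inj.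
have /andP[a0 a1] := pidiv_bounds n2; have /andP[b0 b1] := pidiv_bounds k2.
have p0 := pi_gt0 R; rewrite !in_itv /=.
have -> : (0 : R) <= pi / n%:R <= (pi : R) by apply/andP; split; lra.
have -> : (0 : R) <= pi / k%:R <= (pi : R) by apply/andP; split; lra.
move=> /(_ isT isT) /(mulfI (lt0r_neq0 p0)) /invr_inj /eqP.
by rewrite eqr_nat => /eqP.
Qed.

Lemma label_inj l l' : label_geq 2 l -> label_geq 2 l' ->
  cosl l = cosl l' -> l = l'.
Proof.
case: l l' => [n|] [k|] //= n2 k2.
- by move=> /(cosl_inj n2 k2) ->.
- by move=> h; have := cosl_sqr_lt1 n2; rewrite /= h expr1n ltxx.
- by move=> h; have := cosl_sqr_lt1 k2; rewrite /= -h expr1n ltxx.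
Qed.

Lemma cosl2 : cosl (Some 2) = 0.
Proof. exact: cos_pihalf. Qed.

Lemma cosl3 : cosl (Some 3) = 2^-1.
Proof.
have := cheb_label (isT : (2 <= 3)%N); rewrite !chebSS /=.
have := @cosl_ge0 (Some 3) isT; rewrite /=; set c := cos _ => c0 h.
have {}h : (2 * c - 1) * (2 * c + 1) = 0 by rewrite -h; ring.
by move/eqP: h; rewrite mulf_eq0 => /orP[] /eqP h; lra.
Qed.

Lemma cosl4_sqr : cosl (Some 4) ^+ 2 = 2^-1.
Proof.
have := cheb_label (isT : (2 <= 4)%N); rewrite !chebSS /=.
have h3 := cosl3; have := @cosl_le 3 (Some 4) isT isT; rewrite h3 /=.
set c := cos _ => c0 h.
have {}h : (4 * c) * (2 * c ^+ 2 - 1) = 0 by rewrite -h; ring.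
by move/eqP: h; rewrite mulf_eq0 => /orP[] /eqP h; lra.
Qed.

Lemma cosl5 : 3 / 4 <= cosl (Some 5).
Proof.
have := cheb_label (isT : (2 <= 5)%N); rewrite !chebSS /=.
have h3 := cosl3; have := @cosl_le 3 (Some 5) isT isT; rewrite h3 /=.
set c := cos _ => c0 h; rewrite leNgt; apply/negP => c1.
have : (c ^+ 2 - 1 / 4) * (c ^+ 2 - 9 / 16) <= 0.
  by rewrite mulr_ge0_le0 //; nra.
have : 16 * (c ^+ 2) ^+ 2 - 12 * c ^+ 2 + 1 = 0 by rewrite -h; ring.
by move=> *; nra.
Qed.

Lemma cosl_gt0 l : label_geq 3 l -> 2^-1 <= cosl l.
Proof. by move=> h; rewrite -cosl3; exact: cosl_le. Qed.

End Chebyshev.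

(** * The geometric representation *)

Record coxeter_matrix (I : finType) := CoxeterMatrix {
  cox_label :> I -> I -> label;
  cox_label_sym : forall i j, cox_label i j = cox_label j i;
  cox_label_ge2 : forall i j, label_geq 2 (cox_label i j)
}.

Inductive cox_rel (I : finType) (m : coxeter_matrix I) :
    word I -> word I -> Prop :=
  | CoxSquare i : cox_rel m (pos_word [:: i; i]) [::]
  | CoxBraid i j n : i != j -> m i j = Some n ->
      cox_rel m (pos_word (alternating i j n)) (pos_word (alternating j i n)).

Definition cox_group (I : finType) (m : coxeter_matrix I) : groupType :=
  presented (cox_rel m).

Definition cox_gen (I : finType) (m : coxeter_matrix I) (i : I) :
  cox_group m := pres_gen (cox_rel m) i.

Lemma alternatingSr (T : Type) (i j : T) n :
  alternating i j n.+1 = rcons (alternating i j n) (if odd n then j else i).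
Proof.
elim: n i j => [|n IHn] i j //.
by rewrite [LHS]/= -/(alternating j i n.+1) IHn /=; case: (odd n).
Qed.

Section GeometricRepresentation.
Variables (R : realType) (I : finType) (m : coxeter_matrix I).
Local Notation vec := {ffun I -> R}.
Implicit Types (i j k : I) (u v w : vec) (p q : R) (s t : seq I).

Definition sroot i : vec := [ffun j => (j == i)%:R].

Definition gram i j : R := if i == j then 1 else - cosl R (m i j).

Definition coroot i v : R := \sum_j gram i j * v j.

Definition cform u v : R := \sum_i u i * coroot i v.

Definition refl i v : vec := [ffun j => v j - (j == i)%:R * (2 * coroot i v)].

(** The one linear operation used throughout: scaling by p is [lin p u 0 u], so a single lemma per
    operator expresses its linearity. *)
Definition lin p u q v : vec := [ffun j => p * u j + q * v j].

Lemma gram_sym i j : gram i j = gram j i.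
Proof. by rewrite /gram eq_sym cox_label_sym. Qed.

Lemma gramii i : gram i i = 1.
Proof. by rewrite /gram eqxx. Qed.

Lemma gram_le0 i j : i != j -> gram i j <= 0.
Proof.
by move=> /negPf ij; rewrite /gram ij oppr_le0 cosl_ge0 ?cox_label_ge2.
Qed.

Lemma sum_delta (f : I -> R) i : \sum_j (j == i)%:R * f j = f i.
Proof.
rewrite (bigD1 i) //= eqxx mul1r big1 ?addr0 // => j /negPf ->.
by rewrite mul0r.
Qed.

Lemma coroot_lin i p u q v :
  coroot i (lin p u q v) = p * coroot i u + q * coroot i v.
Proof.
rewrite /coroot !mulr_sumr -big_split /=; apply: eq_bigr => j _.
by rewrite ffunE; ring.
Qed.

Lemma coroot_root i j : coroot i (sroot j) = gram i j.
Proof.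
rewrite /coroot -[RHS](sum_delta (gram i)); apply: eq_bigr => k _.
by rewrite ffunE mulrC.
Qed.

Lemma form_sym u v : cform u v = cform v u.
Proof.
rewrite /cform /coroot.
under eq_bigr => i _ do rewrite mulr_sumr.
rewrite exchange_big; apply: eq_bigr => j _; rewrite mulr_sumr.
by apply: eq_bigr => i _; rewrite gram_sym; ring.
Qed.

Lemma form_lin w p u q v : cform w (lin p u q v) = p * cform w u + q * cform w
  v.
Proof.
rewrite /cform !mulr_sumr -big_split /=; apply: eq_bigr => j _.
by rewrite coroot_lin; ring.
Qed.

Lemma form_linl w p u q v : cform (lin p u q v) w = p * cform u w + q * cform v
  w.
Proof. by rewrite form_sym form_lin !(form_sym w). Qed.

Lemma form_root i v : cform (sroot i) v = coroot i v.
Proof.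
rewrite /cform -[RHS](sum_delta (coroot^~ v)).
by apply: eq_bigr => j _; rewrite ffunE.
Qed.

Lemma form_rootr i v : cform v (sroot i) = coroot i v.
Proof. by rewrite form_sym form_root. Qed.

Lemma form_root1 i : cform (sroot i) (sroot i) = 1.
Proof. by rewrite form_root coroot_root gramii. Qed.

Lemma reflE i v : refl i v = lin 1 v (- (2 * coroot i v)) (sroot i).
Proof. by apply/ffunP => j; rewrite !ffunE; ring. Qed.

Lemma refl_lin i p u q v : refl i (lin p u q v) = lin p (refl i u) q (refl i v).
Proof. by apply/ffunP => j; rewrite !ffunE coroot_lin; ring. Qed.

Lemma coroot_refl i v : coroot i (refl i v) = - coroot i v.
Proof. by rewrite reflE coroot_lin coroot_root gramii; ring. Qed.

Lemma reflK i : involutive (refl i).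
Proof. by move=> v; apply/ffunP => j; rewrite !ffunE coroot_refl; ring. Qed.

Lemma form_refl i u v : cform (refl i u) (refl i v) = cform u v.
Proof.
rewrite !reflE form_lin !form_linl !form_rootr form_root.
by rewrite coroot_root gramii; ring.
Qed.

Lemma refl_root i : refl i (sroot i) = lin (-1) (sroot i) 0 (sroot i).
Proof. by rewrite reflE coroot_root gramii; apply/ffunP => j; rewrite !ffunE;
  ring. Qed.

Lemma refl_root_neq i j :
  i != j -> refl i (sroot j) = lin (2 * cosl R (m i j)) (sroot i) 1 (sroot j).
Proof.
move=> /negPf ij; rewrite reflE coroot_root /gram ij.
by apply/ffunP => k; rewrite !ffunE; ring.
Qed.

Definition act s v := foldr refl v s.

Lemma act_cat s t v : act (s ++ t) v = act s (act t v).
Proof. by rewrite /act foldr_cat. Qed.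

Lemma act_lin s p u q v : act s (lin p u q v) = lin p (act s u) q (act s v).
Proof. by elim: s => //= i s ->; rewrite refl_lin. Qed.

Lemma form_act s u v : cform (act s u) (act s v) = cform u v.
Proof. by elim: s => //= i s IHs; rewrite form_refl. Qed.

Lemma actK s v : act (rev s) (act s v) = v.
Proof. by elim: s v => //= i s IHs v; rewrite rev_cons -cats1 act_cat /= reflK.
  Qed.

Lemma act_matrix s v k : act s v k = \sum_i v i * act s (sroot i) k.
Proof.
elim: s k => [|a s IHs] k /=.
  rewrite -[LHS](sum_delta v); apply: eq_bigr => i _.
  by rewrite ffunE eq_sym mulrC.
rewrite ffunE {1}IHs /coroot.
have -> : \sum_j gram a j * act s v j =
          \sum_i v i * coroot a (act s (sroot i)).
  under eq_bigr => j _ do rewrite IHs mulr_sumr.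
  rewrite exchange_big; apply: eq_bigr => i _; rewrite mulr_sumr.
  by apply: eq_bigr => j _; ring.
rewrite !mulr_sumr -sumrN -big_split /=; apply: eq_bigr => i _.
by rewrite ffunE; ring.
Qed.

(** The root is that of the letter which would extend the alternating word; prefixing a letter to
    the word is one step of the Chebyshev recursion. *)
Lemma act_alternating i j n : i != j ->
  act (alternating i j n) (sroot (if odd n then j else i)) =
  lin (cheb (cosl R (m i j)) n.+1) (sroot i) (cheb (cosl R (m i j)) n) (sroot
    j).
Proof.
move=> ij; elim: n i j ij => [|n IHn] i j ij.
  by apply/ffunP => k; rewrite !ffunE /=; ring.
have -> : (if odd n.+1 then j else i) = if odd n then i else j.
  by rewrite /=; case: (odd n).
rewrite [alternating _ _ _]/= [LHS]/= IHn 1?eq_sym // refl_lin cox_label_sym.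
rewrite refl_root refl_root_neq // chebSS.
by apply/ffunP => k; rewrite !ffunE; ring.
Qed.

(** At length n = m(i, j) the word is the longest element of the dihedral group and negates the two
    simple roots, exchanging them when n is odd. *)
Lemma act_alternating_label i j n : i != j -> m i j = Some n ->
  act (alternating i j n) (sroot (if odd n then j else i)) =
    lin (-1) (sroot i) 0 (sroot i) /\
  act (alternating i j n) (sroot (if odd n then i else j)) =
    lin (-1) (sroot j) 0 (sroot j).
Proof.
move=> ij mij; have := cox_label_ge2 m i j; rewrite mij /= => n2; split.
  rewrite act_alternating // mij cheb_label // cheb_labelS //.
  by apply/ffunP => k; rewrite !ffunE; ring.
case: n n2 mij => // n n2 mij; rewrite alternatingSr.
have -> : (if odd n.+1 then i else j) = if odd n then j else i.
  by rewrite /=; case: (odd n).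
rewrite -cats1 act_cat [act [:: _] _]/= refl_root act_lin act_alternating //
  mij.
rewrite cheb_label //; have := cheb_labelS R n2.
rewrite chebSS cheb_label // => h.
have -> : cheb (cosl R (Some n.+1)) n = 1 by lra.
by apply/ffunP => k; rewrite !ffunE; ring.
Qed.

(* The two sides agree on the plane spanned by the two roots, and both are the
   identity on its orthogonal complement. *)
Lemma act_braid i j n v : i != j -> m i j = Some n ->
  act (alternating i j n) v = act (alternating j i n) v.
Proof.
move=> ij mij.
have n2 : (2 <= n)%N by have := cox_label_ge2 m i j; rewrite mij.
have [ei ei'] := act_alternating_label ij mij.
have ji : j != i by rewrite eq_sym.
have mji : m j i = Some n by rewrite cox_label_sym.
have [ej ej'] := act_alternating_label ji mji.
set c := cosl R (m i j); have c1 : 1 - c ^+ 2 != 0.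
  by have := cosl_sqr_lt1 R n2; rewrite -mij -/c => h; apply/lt0r_neq0; lra.
pose a := coroot i v; pose b := coroot j v.
pose p := (a + b * c) / (1 - c ^+ 2); pose q := (b + a * c) / (1 - c ^+ 2).
pose u := lin 1 v (-1) (lin p (sroot i) q (sroot j)).
have gij : gram i j = - c by rewrite /gram (negPf ij).
have ui : coroot i u = 0.
  rewrite /u !coroot_lin !coroot_root gramii gij -/a /p /q.
  by field.
have uj : coroot j u = 0.
  rewrite /u !coroot_lin !coroot_root gramii gram_sym gij -/b /p /q.
  by field.
have fix_u s : {subset s <= [:: i; j]} -> act s u = u.
  elim: s => //= k s IHs sub; rewrite IHs; last first.
    by move=> l ls; apply: sub; rewrite inE ls orbT.
  have := sub k (mem_head _ _); rewrite !inE => /orP[] /eqP ->;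
  by apply/ffunP => l; rewrite ffunE ?ui ?uj; ring.
have alt_sub k l r : {subset alternating k l r <= [:: k; l]}.
  elim: r k l => //= r IHr k l x; rewrite inE => /orP[/eqP ->|/IHr].
    by rewrite mem_head.
  by rewrite !inE orbC.
have -> : v = lin 1 u 1 (lin p (sroot i) q (sroot j)).
  by apply/ffunP => k; rewrite !ffunE; ring.
clearbody u; rewrite !act_lin !fix_u //; last first.
  by move=> x /alt_sub; rewrite !inE orbC.
by case: (odd n) ei ei' ej ej' => -> -> -> ->.
Qed.

Definition word_act (s : word I) v := act (map fst s) v.

Lemma map_fst_pos_word s : map fst (pos_word s) = s.
Proof. by rewrite /pos_word -map_comp map_id. Qed.

Lemma pres_eq_act (s t : word I) v :
  pres_eq (cox_rel m) s t -> word_act s v = word_act t v.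
Proof.
move=> st; elim: st v => {s t} [s t [i|i j n ij mij]|[i b]|s|s t _ IH|
    s t u _ IH1 _ IH2|s s' t t' _ IH1 _ IH2] v; rewrite ?IH //.
- by rewrite /word_act /= reflK.
- by rewrite /word_act !map_fst_pos_word; exact: act_braid.
- by rewrite /word_act /= reflK.
- by rewrite IH1.
- by rewrite /word_act !map_cat !act_cat -!/(word_act _ _) IH2 IH1.
Qed.

Local Notation W := (cox_group m).

Definition cox_act (x : W) v := word_act (pres_repr x) v.

Lemma cox_act_class (s : word I) v : cox_act (pres_class (cox_rel m) s) v =
  word_act s v.
Proof. exact/pres_eq_act/pres_repr_class. Qed.

Lemma cox_act_gen i v : cox_act (cox_gen m i) v = refl i v.
Proof. by rewrite cox_act_class. Qed.

Lemma cox_act1 v : cox_act 1%g v = v.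
Proof. exact: (cox_act_class [::]). Qed.

Lemma cox_actM (x y : W) v : cox_act (x * y)%g v = cox_act x (cox_act y v).
Proof.
have -> : cox_act (x * y)%g v = word_act (pres_repr x ++ pres_repr y) v.
  exact: cox_act_class.
by rewrite /word_act map_cat act_cat.
Qed.

Lemma cox_actK (x : W) v : cox_act x^-1%g (cox_act x v) = v.
Proof. by rewrite -cox_actM mulVg cox_act1. Qed.

Lemma cox_actKV (x : W) v : cox_act x (cox_act x^-1%g v) = v.
Proof. by rewrite -cox_actM mulgV cox_act1. Qed.

Lemma cox_act_lin (x : W) p u q v :
  cox_act x (lin p u q v) = lin p (cox_act x u) q (cox_act x v).
Proof. exact: act_lin. Qed.

Lemma form_cox_act (x : W) u v : cform (cox_act x u) (cox_act x v) = cform u v.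
Proof. exact: form_act. Qed.

Lemma cox_act_matrix (x : W) v k :
  cox_act x v k = \sum_i v i * cox_act x (sroot i) k.
Proof. exact: act_matrix. Qed.

End GeometricRepresentation.

(** * Length and positivity of roots *)

Definition nneg (R : realType) (I : finType) (v : {ffun I -> R}) :=
  forall j, 0 <= v j.

Definition npos (R : realType) (I : finType) (v : {ffun I -> R}) :=
  forall j, v j <= 0.

(** This covers two cases at once: W itself with the identity map, and the subgroup of D generated
    by a set of vertices of order 2. In the second case lengths are measured in D while roots live
    in the representation of W. *)
Record realizes (I : finType) (m : coxeter_matrix I) (G : groupType)
    (F : G -> cox_group m) (g : I -> G) (K : {set I}) : Prop := Realizes {
  realizes_morph : {morph F : x y / (x * y)%g};
  realizes_gen : forall i, i \in K -> F (g i) = cox_gen m i;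
  realizes_sqr : forall i, i \in K -> (g i * g i = 1)%g;
  realizes_braid : forall i j n, i \in K -> j \in K -> i != j ->
    m i j = Some n ->
    (\prod_(k <- alternating i j n) g k)%g =
    (\prod_(k <- alternating j i n) g k)%g
}.

Section Length.
Variables (R : realType) (I : finType) (m : coxeter_matrix I).
Variables (G : groupType) (F : G -> cox_group m) (g : I -> G) (K : {set I}).
Hypothesis real : realizes F g K.
Implicit Types (x y z : G) (i j : I) (s t : seq I) (v : {ffun I -> R}).

Let eval s : G := (\prod_(k <- s) g k)%g.

Definition has_word x n :=
  exists s, [/\ {subset s <= K}, x = (\prod_(k <- s) g k)%g & size s = n].

Definition over x := exists n, has_word x n.

(* Junk value 0 outside the subgroup generated by K. *)
Definition len x : nat :=
  if pselect (exists n, `[< has_word x n >]) is left h then ex_minn h else 0.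

Definition rho x v := cox_act (F x) v.

Lemma len_word x : over x -> has_word x (len x).
Proof.
move=> [n xn]; rewrite /len; case: pselect => [h|[]]; last first.
  by exists n; apply/asboolP.
by case: ex_minnP => n1 /asboolP.
Qed.

Lemma len_le x n : has_word x n -> (len x <= n)%N.
Proof.
move=> xn; rewrite /len; case: pselect => // h.
by case: ex_minnP => n1 _; apply; apply/asboolP.
Qed.

Lemma has_wordM x y n1 n2 :
  has_word x n1 -> has_word y n2 -> has_word (x * y)%g (n1 + n2).
Proof.
move=> [s [sK -> <-]] [t [tK -> <-]]; exists (s ++ t).
split; rewrite ?big_cat ?size_cat // => a; rewrite mem_cat.
by move=> /orP[/sK|/tK].
Qed.

Lemma has_word_gen i : i \in K -> has_word (g i) 1.
Proof.
move=> iK; exists [:: i]; split; rewrite ?big_seq1 // => j.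
by rewrite inE => /eqP ->.
Qed.

Lemma invg_gen i : i \in K -> (g i)^-1%g = g i.
Proof. by move=> iK; apply: mulg1_eq; apply: realizes_sqr real _ iK. Qed.

Lemma has_wordV x n : has_word x n -> has_word x^-1%g n.
Proof.
move=> [s [sK -> <-]]; elim: s sK => [|i s IHs] sK.
  by rewrite big_nil invg1; exists [::]; split; rewrite ?big_nil.
rewrite big_cons invgM; have iK := sK i (mem_head _ _).
rewrite invg_gen // -[size _]addn1; apply: has_wordM (has_word_gen iK).
by apply: IHs => j js; apply: sK; rewrite inE js orbT.
Qed.

Lemma has_word1 : has_word 1%g 0.
Proof. by exists [::]; split; rewrite ?big_nil. Qed.

Lemma over1 : over 1%g.
Proof. by exists 0; exact: has_word1. Qed.

Lemma overM x y : over x -> over y -> over (x * y)%g.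
Proof. by move=> [n1 xn] [n2 yn]; exists (n1 + n2)%N; exact: has_wordM. Qed.

Lemma overV x : over x -> over x^-1%g.
Proof. by move=> [n /has_wordV xn]; exists n. Qed.

Lemma over_gen i : i \in K -> over (g i).
Proof. by move=> iK; exists 1; exact: has_word_gen. Qed.

Lemma over_word s : {subset s <= K} -> over (\prod_(k <- s) g k)%g.
Proof. by exists (size s), s. Qed.

Lemma lenM x y : over x -> over y -> (len (x * y)%g <= len x + len y)%N.
Proof. by move=> ox oy; apply/len_le/has_wordM; exact: len_word. Qed.

Lemma len_gen i : i \in K -> (len (g i) <= 1)%N.
Proof. by move=> iK; apply/len_le/has_word_gen. Qed.

Lemma mulg_genK x i : i \in K -> (x * g i * g i)%g = x.
Proof. by move=> iK; rewrite -mulgA (realizes_sqr real iK) mulg1. Qed.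

Lemma len_mulg_gen x i : over x -> i \in K -> (len (x * g i)%g <= (len x).+1)%N.
Proof.
move=> ox iK; apply: leq_trans (lenM ox (over_gen iK)) _.
by rewrite -[(len x).+1]addn1 leq_add2l len_gen.
Qed.

Lemma len_mulg_genV x i : over x -> i \in K ->
  (len x <= (len (x * g i)%g).+1)%N.
Proof.
move=> ox iK; rewrite -{1}(mulg_genK x iK).
by apply: len_mulg_gen => //; apply: overM => //; exact: over_gen.
Qed.

Lemma lenV x : over x -> len x^-1%g = len x.
Proof.
move=> ox; apply/eqP; rewrite eqn_leq; apply/andP; split.
  by apply/len_le/has_wordV/len_word.
by apply/len_le; rewrite -{1}[x]invgK; apply/has_wordV/len_word/overV.
Qed.

Lemma len_eq0 x : over x -> len x = 0 -> x = 1%g.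
Proof.
by move=> /len_word[s [_ -> ss]] l0; move: ss; rewrite l0 => /size0nil ->;
  rewrite big_nil.
Qed.

Lemma realizes_morph1 : F 1%g = 1%g.
Proof. by apply: (mulgI (F 1%g)); rewrite -(realizes_morph real) !mulg1. Qed.

Lemma rhoM x y v : rho (x * y)%g v = rho x (rho y v).
Proof. by rewrite /rho (realizes_morph real) cox_actM. Qed.

Lemma rho1 v : rho 1%g v = v.
Proof. by rewrite /rho realizes_morph1 cox_act1. Qed.

Lemma rho_gen i v : i \in K -> rho (g i) v = refl m i v.
Proof. by move=> iK; rewrite /rho (realizes_gen real) // cox_act_gen. Qed.

Lemma rho_lin x p u q v : rho x (lin p u q v) = lin p (rho x u) q (rho x v).
Proof. exact: cox_act_lin. Qed.

Lemma rho_word s v : {subset s <= K} -> rho (\prod_(k <- s) g k)%g v = act m s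
  v.
Proof.
elim: s v => [|i s IHs] v sK; first by rewrite big_nil rho1.
rewrite big_cons rhoM IHs; last by move=> j js; apply: sK; rewrite inE js orbT.
by rewrite rho_gen ?sK ?mem_head.
Qed.

Lemma rho_out x v k : over x -> k \notin K -> rho x v k = v k.
Proof.
move=> [_ [s [sK -> _]]] kK; rewrite rho_word //; elim: s sK => //= i s IHs sK.
have iK := sK i (mem_head _ _).
rewrite ffunE IHs; last by move=> j js; apply: sK; rewrite inE js orbT.
have /negPf -> : k != i by apply: contraNneq kK => ->.
by rewrite mul0r subr0.
Qed.

Lemma rho_fix x v : (forall i, i \in K -> coroot m i v = 0) -> over x ->
  rho x v = v.
Proof.
move=> vK [_ [s [sK -> _]]]; rewrite rho_word //; elim: s sK => //= i s IHs sK.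
rewrite IHs; last by move=> j js; apply: sK; rewrite inE js orbT.
have iK := sK i (mem_head _ _).
by apply/ffunP => j; rewrite ffunE vK // mulr0 mulr0 subr0.
Qed.

Lemma nneg_lin p u q v : 0 <= p -> 0 <= q -> nneg u -> nneg v ->
  nneg (lin p u q v : {ffun I -> R}).
Proof. by move=> p0 q0 u0 v0 j; rewrite ffunE addr_ge0 // mulr_ge0. Qed.

(** Alternating words normalized by their last letter l, so that a longer one is obtained by adding
    a letter in front. *)
Let tail (k l : I) (n : nat) := if odd n then alternating l k n else
  alternating k l n.

Let tailS k l n : tail k l n.+1 = (if odd n then k else l) :: tail k l n.
Proof. by rewrite /tail /=; case: (odd n). Qed.

Let tail_sub k l n : k \in K -> l \in K -> {subset tail k l n <= K}.
Proof.
move=> kK lK; elim: n => [|n IHn] a; first by rewrite /tail.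
by rewrite tailS inE => /orP[/eqP ->|/IHn //]; case: (odd n).
Qed.

Let size_tail k l n : size (tail k l n) = n.
Proof. by elim: n => // n IHn; rewrite tailS /= IHn. Qed.

Let tail_last k l n : tail k l n.+1 = rcons (tail l k n) l.
Proof. by rewrite /tail !alternatingSr [odd n.+1]/=; case: (odd n). Qed.

(* Split a reduced expression of [x] so that its tail is a maximal alternating
   word in [i] and the last letter [l]; then [x (sroot i)] is computed in the
   dihedral group of [i] and [l]. *)
Lemma len_nneg x i : over x -> i \in K ->
  (len x <= len (x * g i)%g)%N -> nneg (rho x (sroot R i)).
Proof.
have [n] := ubnP (len x); elim: n x i => // n IHn x i xn ox iK xi.
have [x0|x0] := posnP (len x).
  rewrite (len_eq0 ox x0) rho1 => j; rewrite ffunE; exact: ler0n.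
have [s0 [s0K xE0 ss0]] := len_word ox.
case: (lastP s0) s0K xE0 ss0 => [|s l] s0K xE0 ss0.
  by move: x0; rewrite -ss0.
rewrite size_rcons in ss0.
have lK : l \in K by apply: s0K; rewrite mem_rcons mem_head.
have sK : {subset s <= K} by move=> a sa; apply: s0K;
  rewrite mem_rcons inE sa orbT.
have xE : x = (\prod_(k <- s) g k * g l)%g by rewrite xE0 big_rcons.
have li : i != l.
  apply: contraTneq xi => il; rewrite -ltnNge xE -il mulg_genK //.
  rewrite (_ : _ * _ = x)%g; last by rewrite xE il.
  by rewrite -ss0 ltnS len_le //; exists s.
pose P (k : nat) := `[< exists y, [/\ over y, x = (y * eval (tail i l k))%g &
                          len x = (len y + k)%N] >].
have ot k : over (eval (tail i l k)) by apply: over_word; exact: tail_sub.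
have lt k : (len (eval (tail i l k)) <= k)%N.
  apply: len_le; exists (tail i l k).
  by split; [exact: tail_sub|by []|rewrite size_tail].
have P1 : P 1.
  apply/asboolP; exists (\prod_(k <- s) g k)%g.
  have os := over_word sK; split=> //.
    by rewrite xE /eval tailS big_cons big_nil mulg1.
  apply/eqP; rewrite eqn_leq; apply/andP; split.
    by rewrite xE addn1; exact: len_mulg_gen.
  by rewrite -ss0 addn1 ltnS; apply: len_le; exists s.
have Pbound k : P k -> (k <= len x)%N.
  by move=> /asboolP[y [_ _ ->]]; rewrite leq_addl.
have evalS k : eval (tail i l k.+1) =
    (g (if odd k then i else l) * eval (tail i l k))%g.
  by rewrite /eval tailS big_cons.
have rK k : (if odd k then i else l) \in K by case: ifP.
have Pdec k : P k.+1 -> P k.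
  move=> /asboolP[y [oy xy ly]]; apply/asboolP.
  set r := if odd k then i else l.
  have oyr : over (y * g r)%g by apply: overM => //; apply/over_gen/rK.
  have xy' : x = (y * g r * eval (tail i l k))%g.
    by rewrite {1}xy evalS mulgA.
  exists (y * g r)%g; split=> //.
  apply/eqP; rewrite eqn_leq; apply/andP; split.
    rewrite {1}xy'; apply: leq_trans (lenM oyr (ot k)) _.
    by rewrite leq_add2l lt.
  rewrite ly addnS -addSn leq_add2r; apply: len_mulg_gen => //; exact: rK.
case: (ex_maxnP (ex_intro _ 1 P1) Pbound) => k Pk kmax.
have k1 : (0 < k)%N := kmax _ P1.
(* If the tail reached length m(i, l), the braid relation would make it end in i, and x times g i
   would be shorter than x. *)
have klt : if m i l is Some q then (k < q)%N else true.
  case mil : (m i l) => [q|] //; rewrite ltnNge; apply/negP => qk.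
  have q2 : (2 <= q)%N by have := cox_label_ge2 m i l; rewrite mil.
  have {Pk} /asboolP[y [oy xy ly]] : P q.
    rewrite -(subKn qk); elim: (k - q)%N => [|d]; first by rewrite subn0.
    rewrite subnS; case: (k - d)%N => // a; exact: Pdec.
  have : eval (tail i l q) = eval (tail l i q).
    rewrite /eval /tail; case: ifP => _; last exact: (realizes_braid real).
    apply: (realizes_braid real) => //; first by rewrite eq_sym.
    by rewrite cox_label_sym.
  case: q q2 {qk mil} xy ly => // q _ xy ly.
  rewrite {2}/eval (tail_last l i) big_rcons /= => ev.
  move: xi; rewrite {2}xy ev mulgA mulg_genK // leqNgt => /negP[].
  rewrite ly addnS ltnS; apply/len_le/has_wordM; first exact: len_word.
  by exists (tail i l q); split; [exact: tail_sub|by []|rewrite size_tail].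
have /asboolP[y [oy xy ly]] := Pk.
have yn : (len y < n)%N by move: xn; rewrite ly; lia.
(* The letter in question would lengthen the tail, so maximality of k forbids y from getting
   shorter. *)
have next : nneg (rho y (sroot R (if odd k then i else l))).
  apply: IHn => //; rewrite leqNgt; apply/negP => lt_y.
  set r := if odd k then i else l in lt_y.
  have oyr : over (y * g r)%g by apply: overM => //; apply/over_gen/rK.
  have /kmax : P k.+1.
    apply/asboolP; exists (y * g r)%g; split=> //.
      by rewrite evalS -/r mulgA mulg_genK ?rK.
    have := len_mulg_genV oy (rK k); rewrite -/r => ?; rewrite ly; lia.
  by rewrite ltnn.
(* The other letter is the first one of the tail after its leading letter: if it shortened y, it
   would give an expression of x shorter than [len x]. *)
have prev : nneg (rho y (sroot R (if odd k then l else i))).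
  have -> : (if odd k then l else i) = if odd k.-1 then i else l.
    by rewrite -{1}(prednK k1) /=; case: odd.
  apply: IHn => //; rewrite leqNgt; apply/negP => lt_y.
  set r := if odd k.-1 then i else l in lt_y.
  have oyr : over (y * g r)%g by apply: overM => //; apply/over_gen/rK.
  have xy' : x = (y * g r * eval (tail i l k.-1))%g.
    by rewrite {1}xy -{1}(prednK k1) evalS mulgA.
  have : (len x <= len (y * g r)%g + k.-1)%N.
    rewrite {1}xy'; apply: leq_trans (lenM oyr (ot _)) _.
    by rewrite leq_add2l lt.
  rewrite ly; lia.
have -> : rho x (sroot R i) = rho y (act m (tail i l k) (sroot R i)).
  by rewrite {1}xy rhoM rho_word //; exact: tail_sub.
have c0 a : (a <= k.+1)%N -> 0 <= cheb (cosl R (m i l)) a.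
  move=> ak; apply: cheb_ge0; first exact: cox_label_ge2.
  by case: (m i l) klt => // q kq; apply: leq_trans kq.
move: next prev; rewrite /tail; have [ok|ek] := boolP (odd k) => ni nl.
  have li' : l != i by rewrite eq_sym.
  have := act_alternating R m k li'; rewrite ok => ->.
  by rewrite rho_lin cox_label_sym; apply: nneg_lin => //; apply: c0.
have := act_alternating R m k li; rewrite (negPf ek) => ->.
by rewrite rho_lin; apply: nneg_lin => //; apply: c0.
Qed.

Lemma rho_gen_root x i j : i \in K ->
  rho (x * g i)%g (sroot R i) j = - rho x (sroot R i) j.
Proof. by move=> iK; rewrite rhoM rho_gen // refl_root rho_lin ffunE; ring. Qed.

Lemma len_npos x i : over x -> i \in K ->
  (len (x * g i)%g < len x)%N -> npos (rho x (sroot R i)).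
Proof.
move=> ox iK xi j; have oxi : over (x * g i)%g by apply/overM/over_gen.
have /(_ oxi iK) := @len_nneg (x * g i)%g i.
by rewrite mulg_genK // ltnW // => /(_ isT j); rewrite rho_gen_root // oppr_ge0.
Qed.

Lemma root_sign x i : over x -> i \in K ->
  nneg (rho x (sroot R i)) \/ npos (rho x (sroot R i)).
Proof.
move=> ox iK; case: (leqP (len x) (len (x * g i)%g)).
  by left; exact: len_nneg.
by right; exact: len_npos.
Qed.

Lemma rho_root_neq0 x i : exists j, rho x (sroot R i) j != 0.
Proof.
apply: contrapT => no; suff /eqP : cform m (rho x (sroot R i)) (rho x (sroot R
  i)) = 0.
  by rewrite form_cox_act form_root1 oner_eq0.
rewrite /cform big1 // => j _; have [->|/eqP nz] :=
  eqVneq (rho x (sroot R i) j) 0.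
  by rewrite mul0r.
by case: no; exists j; apply/eqP.
Qed.

Lemma nneg_nposF x i : nneg (rho x (sroot R i)) ->
  npos (rho x (sroot R i)) -> False.
Proof.
move=> h1 h2; have [j] := rho_root_neq0 x i.
by rewrite eq_le h1 h2.
Qed.

Lemma npos_len x i : over x -> i \in K ->
  npos (rho x (sroot R i)) -> (len (x * g i)%g < len x)%N.
Proof.
move=> ox iK h; rewrite ltnNge; apply/negP => /(len_nneg ox iK) h'.
exact: nneg_nposF h' h.
Qed.

Lemma exists_descent x : over x -> x <> 1%g ->
  exists2 i, i \in K & (len (x * g i)%g < len x)%N.
Proof.
move=> ox x1; have [s [sK xE ss]] := len_word ox.
case: (lastP s) sK xE ss => [|t l] sK xE ss; first by case: x1;
  rewrite xE big_nil.
have lK : l \in K by apply: sK; rewrite mem_rcons mem_head.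
exists l => //; rewrite {1}xE big_rcons mulg_genK // -ss size_rcons ltnS.
by apply: len_le; exists t; split=> // a ta; apply: sK;
  rewrite mem_rcons inE ta orbT.
Qed.

Lemma nneg_eq1 x : over x -> (forall i, i \in K ->
  nneg (rho x (sroot R i))) -> x = 1%g.
Proof.
move=> ox h; apply: contrapT => /(exists_descent ox)[i iK /(len_npos ox iK)].
exact/nneg_nposF/h.
Qed.

Lemma nneg_root i : nneg (sroot R i).
Proof. by move=> j; rewrite ffunE ler0n. Qed.

(** The quotient keeps every simple root of K positive, so it is 1. Identities in G thereby follow
    from computations in the representation of W. *)
Lemma rho_faithful x y : over x -> over y ->
  (forall i, i \in K -> rho x (sroot R i) = rho y (sroot R i)) -> x = y.
Proof.
move=> ox oy h; suff : (y^-1 * x)%g = 1%g.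
  by move=> e; rewrite -[x](mulVKg y) e mulg1.
apply: nneg_eq1; first by apply: overM => //; exact: overV.
move=> i iK; rewrite rhoM h // -rhoM mulVg rho1; exact: nneg_root.
Qed.

(** Each letter of a reduced expression of x shortens the product with w, since w makes nonnegative
    combinations of the simple roots of K nonpositive. In particular such a w has maximal length. *)
Lemma longest_len w x : over w -> over x ->
  (forall i, i \in K -> npos (rho w (sroot R i))) ->
  (len (w * x)%g + len x <= len w)%N.
Proof.
move=> ow ox wn; have [n xn] := ubnP (len x).
elim: n x ox xn => // n IHn x ox xn.
have [->|/eqP x1] := eqVneq x 1%g.
  by rewrite mulg1 (eqP (_ : len 1%g == 0)) ?addn0 // -leqn0 len_le //;
    exact: has_word1.
have [i iK xi] := exists_descent ox x1.
have oxi : over (x * g i)%g by apply/overM/over_gen.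
have := IHn _ oxi (leq_trans xi xn).
have xpos : nneg (rho (x * g i)%g (sroot R i)).
  by apply: len_nneg; rewrite // mulg_genK // ltnW.
have : npos (rho (w * (x * g i))%g (sroot R i)).
  move=> j; rewrite rhoM /rho cox_act_matrix sumr_le0 // => k _.
  have [kK|kK] := boolP (k \in K); first by rewrite mulr_ge0_le0 // ?xpos ?wn.
  rewrite -[cox_act (F (x * g i)%g) _]/(rho (x * g i)%g _) rho_out // ffunE.
  have /negPf -> : k != i by apply: contraNneq kK => ->.
  by rewrite mul0r.
move=> /(npos_len (overM ow oxi) iK); rewrite -!mulgA (realizes_sqr real iK)
  mulg1.
move=> h1 h2; apply: leq_trans h2; apply: leq_trans (leq_add h1 (leqnn _)).
by rewrite addSnnS leq_add2l; exact: len_mulg_genV.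
Qed.

End Length.

(** * Simple roots sent to simple roots up to sign *)

Section SimpleImage.
Variables (R : realType) (I : finType) (m : coxeter_matrix I).
Implicit Types (x : cox_group m) (i j : I) (e : R) (J : {set I}).

(** Applying the inverse of x to the image of the simple root i writes this root as a sum of
    nonnegative vectors; nothing can cancel, so each is a multiple of it, and norm 1 leaves only the
    multiple e. The sign e is -1 for oppositions and 1 for shortest conjugating elements. *)
Lemma simple_image x i e J : e ^+ 2 = 1 ->
  (forall j, j \notin J -> cox_act x (sroot R i) j = 0) ->
  (forall j, 0 <= e * cox_act x (sroot R i) j) ->
  (forall j k, j \in J -> 0 <= e * cox_act x^-1%g (sroot R j) k) ->
  exists2 j, j \in J & forall k, cox_act x (sroot R i) k = e * sroot R j k.
Proof.
move=> e2 out pos posV; set v := cox_act x (sroot R i) in out pos *.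
have [j vj] : exists j, v j != 0.
  apply: contrapT => no; suff /eqP : cform m v v = 0.
    by rewrite form_cox_act form_root1 oner_eq0.
  rewrite /cform big1 // => j _; have [->|nz] := eqVneq (v j) 0.
    by rewrite mul0r.
  by case: no; exists j.
have jJ : j \in J by apply: contraNT vj => /out ->.
pose u := cox_act x^-1%g (sroot R j).
have uk k : k != i -> u k = 0.
  move=> ki; have := cox_actK x (sroot R i) => /ffunP/(_ k).
  rewrite -/v cox_act_matrix [RHS]ffunE (negPf ki) => /eqP.
  rewrite psumr_eq0 => [|l _]; last first.
    have [lJ|/out ->] := boolP (l \in J); last by rewrite mul0r.
    rewrite -[_ * _]mul1r -e2 expr2 mulrACA mulr_ge0 ?posV //.
  move=> /allP /(_ j); rewrite mem_index_enum => /(_ isT) /=.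
  by rewrite mulf_eq0 (negPf vj) => /eqP.
pose d := u i; have uE : u = lin d (sroot R i) 0 (sroot R i).
  apply/ffunP => k; rewrite !ffunE; have [->|ki] := eqVneq k i.
    by rewrite mulr1 mul0r addr0.
  by rewrite uk // !mulr0 addr0.
have d2 : d ^+ 2 = 1.
  have : cform m u u = 1 by rewrite form_cox_act form_root1.
  by rewrite uE form_lin form_linl form_root1 => <-; ring.
have ed : e * d = 1.
  have : 0 <= e * d by apply: posV.
  have : (e * d - 1) * (e * d + 1) = 0.
    have -> : (e * d - 1) * (e * d + 1) = e ^+ 2 * d ^+ 2 - 1 by ring.
    by rewrite e2 d2 mulr1 subrr.
  by move/eqP; rewrite mulf_eq0 => /orP[] /eqP; lra.
have {}ed : d = e by rewrite -[d]mul1r -e2 expr2 -mulrA ed mulr1.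
exists j => // k; have := cox_actKV x (sroot R j);
  rewrite -/u uE cox_act_lin -/v ed.
by move=> /ffunP/(_ k); rewrite !ffunE => <-;
  rewrite mul0r addr0 mulrA -expr2 e2 mul1r.
Qed.

End SimpleImage.

(** * Longest elements *)

Section LongestElement.
Variables (R : realType) (I : finType) (m : coxeter_matrix I).
Variables (G : groupType) (F : G -> cox_group m) (g : I -> G) (K : {set I}).
Hypothesis real : realizes F g K.
Implicit Types (x u : G) (i j : I) (v : {ffun I -> R}).
Local Notation over := (over g K).
Local Notation len := (len g K).
Variable w : G.
Hypothesis ow : over w.

Lemma maximal_npos : (forall u, over u -> (len u <= len w)%N) ->
  forall i, i \in K -> npos (rho F w (sroot R i)).
Proof.
move=> wmax i iK; apply: (len_npos R real) => //.
rewrite ltnNge; apply/negP => /(len_nneg R real ow iK) h.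
have oi : over (w * g i)%g by apply: overM => //; exact: over_gen.
have := wmax _ oi; rewrite leqNgt => /negP[].
rewrite -{1}(mulg_genK real w iK); apply: (npos_len (R := R) real oi iK) => j.
by rewrite (rho_gen_root R real) // oppr_le0.
Qed.

Hypothesis wneg : forall i, i \in K -> npos (rho F w (sroot R i)).

Lemma inverse_npos i : i \in K -> npos (rho F w^-1%g (sroot R i)).
Proof.
move=> iK; have oV := overV real ow.
have [pos|//] := root_sign R real oV iK; exfalso.
have : rho F w (rho F w^-1%g (sroot R i)) i = 1.
  by rewrite -(rhoM real) mulgV (rho1 real) ffunE eqxx.
rewrite /rho cox_act_matrix => h.
have : \sum_j cox_act (F w^-1%g) (sroot R i) j * cox_act (F w) (sroot R j) i <=
  0.
  rewrite sumr_le0 // => j _; have [jK|jK] := boolP (j \in K).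
    by rewrite mulr_ge0_le0 ?pos //; exact: wneg.
  rewrite -[cox_act (F w^-1%g) _]/(rho F w^-1%g _) (rho_out real) // ffunE.
  have /negPf -> : j != i by apply: contraNneq jK => ->.
  by rewrite mul0r.
by rewrite h; lra.
Qed.

Lemma realizes_morphV x : F x^-1%g = (F x)^-1%g.
Proof.
by apply: (mulgI (F x)); rewrite -(realizes_morph real) !mulgV (realizes_morph1
  real).
Qed.

Lemma opposite_image : exists e : I -> I, forall i, i \in K ->
  e i \in K /\ rho F w (sroot R i) = - sroot R (e i).
Proof.
have /choice[e he] : forall i, exists j, i \in K ->
    j \in K /\ rho F w (sroot R i) = - sroot R j.
  move=> i; have [iK|iK] := boolP (i \in K); last by exists i.
  have [||||j jK hj] := @simple_image R I m (F w) i (-1) K.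
  - by rewrite sqrrN expr1n.
  - move=> j jK; rewrite -[cox_act _ _]/(rho F w _) (rho_out real) // ffunE.
    by have /negPf -> : j != i by apply: contraNneq jK => ->.
  - by move=> j; rewrite mulN1r oppr_ge0; exact: wneg.
  - move=> j k jK; rewrite mulN1r oppr_ge0 -realizes_morphV;
      exact: inverse_npos.
  by exists j => _; split=> //; apply/ffunP => k; rewrite [LHS]hj !ffunE mulN1r.
by exists e.
Qed.

Variable e : I -> I.
Hypothesis we : forall i, i \in K -> e i \in K /\
  rho F w (sroot R i) = - sroot R (e i).

Lemma sroot_inj : injective (@sroot R I).
Proof.
move=> i j /ffunP/(_ i); rewrite !ffunE eqxx => /esym/eqP.
by rewrite eqr_nat; case: (eqVneq i j).
Qed.

Lemma opp_linE v : - v = lin (-1) v 0 v.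
Proof. by apply/ffunP => j; rewrite !ffunE; ring. Qed.

Lemma opposite_square i : i \in K ->
  rho F (w * w)%g (sroot R i) = sroot R (e (e i)).
Proof.
move=> iK; have [eK wi] := we iK; have [_ wei] := we eK.
rewrite (rhoM real) wi opp_linE rho_lin wei.
by apply/ffunP => k; rewrite !ffunE; ring.
Qed.

Lemma opposite_involution : (w * w)%g = 1%g.
Proof.
apply: (nneg_eq1 (R := R) real); first exact: overM.
by move=> i iK; rewrite opposite_square //; exact: nneg_root.
Qed.

Lemma oppositeK i : i \in K -> e (e i) = i.
Proof.
by move=> /opposite_square; rewrite opposite_involution (rho1 real) =>
  /sroot_inj.
Qed.

Lemma opposite_gram i j : i \in K -> j \in K ->
  gram R m (e i) (e j) = gram R m i j.
Proof.
move=> iK jK; have [_ wi] := we iK; have [_ wj] := we jK.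
rewrite -!coroot_root -!form_root -[RHS](form_cox_act (F w)) -!/(rho _ _ _) wi
  wj.
by rewrite !opp_linE form_lin !form_linl; ring.
Qed.

(** w permutes the simple roots of K up to sign and preserves the form, so it carries the reflection
    of i to that of [e i]; faithfulness brings this back to G. *)
Lemma opposite_conj i : i \in K -> (w * g i = g (e i) * w)%g.
Proof.
move=> iK; have [eK wi] := we iK.
apply: (rho_faithful (R := R) real); try by apply: overM => //; exact: over_gen.
move=> k kK; have [_ wk] := we kK.
rewrite !(rhoM real) !(rho_gen real) // wk !reflE rho_lin wi wk.
rewrite !opp_linE coroot_lin !coroot_root opposite_gram //.
by apply/ffunP => j; rewrite !ffunE; ring.
Qed.

End LongestElement.

(** * Positivity of the form of a finite Coxeter group *)

Lemma pres_class_pos_word (V : choiceType) (r : word V -> word V ->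
  Prop) (s : seq V) :
  (\prod_(k <- s) pres_gen r k)%g = pres_class r (pos_word s).
Proof.
elim: s => [|i s IHs]; first by rewrite big_nil.
by rewrite big_cons IHs [LHS]pres_mulE.
Qed.

(** * Generators of a Coxeter group and parity of letters *)

Section CoxeterGroup.
Variables (I : finType) (m : coxeter_matrix I).

Lemma cox_realizes (K : {set I}) : realizes (fun x => x) (cox_gen m) K.
Proof.
split=> // [i _|i j n _ _ ij mij].
  rewrite [LHS]pres_mulE; apply/pres_classP/PresRel.
  exact: CoxSquare.
rewrite !pres_class_pos_word; apply/pres_classP/PresRel.
exact: CoxBraid.
Qed.

Lemma cox_over (x : cox_group m) : over (cox_gen m) [set: I] x.
Proof.
have r := cox_realizes [set: I].
rewrite -(pres_reprK x); elim: (pres_repr x) => [|[i b] s IHs].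
  exact: over1.
have -> : pres_class (cox_rel m) ((i, b) :: s) =
          (pres_class (cox_rel m) [:: (i, b)] * pres_class (cox_rel m) s)%g.
  by rewrite [RHS]pres_mulE.
apply: overM IHs; have oi : over (cox_gen m) [set: I] (cox_gen m i).
  by apply: over_gen; rewrite inE.
case: b => //; rewrite -(invgK (pres_class _ _)); apply: (overV r).
rewrite (_ : _^-1%g = cox_gen m i) //; apply: mulg1_eq.
by rewrite [LHS]pres_mulE; apply/pres_classP; exact: (PresCancel _ (i, true)).
Qed.

Variable S : {set I}.
Hypothesis evenS : forall i j n,
  i \in S -> j \notin S -> m i j = Some n -> ~~ odd n.

(** A homomorphism to Z/2: when all finite labels between S and its complement are even, both sides
    of every relation have the same parity of letters in S. Conjugate generators therefore lie on
    the same side of S. *)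
Definition sparity (s : word I) := odd (count (fun a => a.1 \in S) s).

Lemma sparity_cat s t : sparity (s ++ t) = sparity s (+) sparity t.
Proof. by rewrite /sparity count_cat oddD. Qed.

Lemma count_alternating (i j : I) n : ~~ odd n ->
  count (mem S) (alternating i j n) = count (mem S) (alternating j i n).
Proof.
move=> en; rewrite -(even_halfK en).
elim: n./2 => // k IHk; rewrite doubleS /= IHk; lia.
Qed.

Lemma count_alternating_const (b : bool) (i j : I) n :
  (i \in S) = b -> (j \in S) = b -> count (mem S) (alternating i j n) = (b *
    n)%N.
Proof.
elim: n i j => [|n IHn] i j iS jS; first by rewrite muln0.
by rewrite /= iS IHn // mulnS; case: b {iS jS IHn}.
Qed.

Lemma pres_eq_sparity s t : pres_eq (cox_rel m) s t -> sparity s = sparity t.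
Proof.
elim=> {s t} [s t [i|i j n ij mij]|[i b]|s|s t _ IH|
    s t u _ IH1 _ IH2|s s' t t' _ IH1 _ IH2] //.
- by rewrite /sparity /=; case: (i \in S).
- rewrite /sparity /pos_word !count_map.
  rewrite -!/(count (mem S) _); congr odd.
  case iS : (i \in S); case jS : (j \in S).
  + by rewrite !(count_alternating_const (b := true)).
  + by apply: count_alternating; apply: (evenS iS _ mij); rewrite jS.
  + apply: count_alternating; apply: (evenS jS _ (_ : m j i = _)).
      by rewrite iS.
    by rewrite cox_label_sym.
  + by rewrite !(count_alternating_const (b := false)).
- by rewrite /sparity /=; case: (i \in S).
- by rewrite IH1.
- by rewrite !sparity_cat IH1 IH2.
Qed.

Lemma conj_gen_parity (x : cox_group m) i j :
  (x * cox_gen m i = cox_gen m j * x)%g -> (i \in S) = (j \in S).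
Proof.
rewrite -(pres_reprK x) /cox_gen /pres_gen => h.
have /pres_classP/pres_eq_sparity : pres_class (cox_rel m) (pres_repr x ++
  pos_word [:: i])
  = pres_class (cox_rel m) (pos_word [:: j] ++ pres_repr x).
  by move: h; rewrite [LHS]pres_mulE [X in _ = X]pres_mulE.
rewrite !sparity_cat addbC => /addIb; rewrite /sparity /= !addn0.
by case: (i \in S); case: (j \in S).
Qed.

End CoxeterGroup.

(** * Finitely many roots and the averaged form *)

Section Positivity.
Variables (R : realType) (I : finType) (m : coxeter_matrix I).
Local Notation vec := {ffun I -> R}.
Local Notation W := (cox_group m).
Implicit Types (u v : vec) (i j : I) (s : seq I).

Definition cadj : rel I := [rel i j | (i != j) && (m i j != Some 2)].

Lemma cadj_sym : symmetric cadj.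
Proof. by move=> i j; rewrite /cadj /= eq_sym cox_label_sym. Qed.

Lemma cadj_neq i j : cadj i j -> i != j.
Proof. by case/andP. Qed.

Lemma cadj_label i j : cadj i j -> label_geq 3 (m i j).
Proof.
move=> /andP[_]; have := cox_label_ge2 m i j; case: (m i j) => [n|] //=.
by rewrite leq_eqVlt => /orP[/eqP <-|].
Qed.

Lemma gram_cadj i j : cadj i j -> gram R m i j <= - 2^-1.
Proof.
move=> a; have /andP[/negPf ij _] := a.
by rewrite /gram ij lerN2 cosl_gt0 ?cadj_label.
Qed.

Lemma gram_nadj i j : i != j -> ~~ cadj i j -> gram R m i j = 0.
Proof.
move=> ij; rewrite /cadj /= ij /= negbK => /eqP mij.
by rewrite /gram (negPf ij) mij cosl2 oppr0.
Qed.

Variables (w : seq I) (e : I -> I).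
Hypothesis we : forall i, act m w (sroot R i) = - sroot R (e i).
Hypothesis conn : forall i j, connect cadj i j.

Definition is_root v := exists (x : W) i, v = cox_act x (sroot R i).

(** For the word s_1 ... s_n these are the images of the root of s_k under s_n ... s_(k+1). A
    positive root that the word makes negative changes sign at some letter, where it must be the
    simple root of that letter, so it occurs here. *)
Fixpoint inversions s : seq vec :=
  if s is i :: s' then act m (rev s') (sroot R i) :: inversions s' else [::].

Lemma is_root_sroot i : is_root (sroot R i).
Proof. by exists 1%g, i; rewrite cox_act1. Qed.

Lemma is_root_refl i v : is_root v -> is_root (refl m i v).
Proof.
by move=> [x [j ->]]; exists (cox_gen m i * x)%g, j;
  rewrite cox_actM cox_act_gen.
Qed.

Lemma is_root_act s v : is_root v -> is_root (act m s v).
Proof. by move=> rv; elim: s => //= i s; exact: is_root_refl. Qed.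

Lemma is_root_sign v : is_root v -> nneg v \/ npos v.
Proof.
move=> [x [i ->]].
by apply: (root_sign R (cox_realizes m [set: I])); rewrite ?inE //;
  exact: cox_over.
Qed.

Lemma is_root_norm v : is_root v -> cform m v v = 1.
Proof. by move=> [x [i ->]]; rewrite form_cox_act form_root1. Qed.

Lemma is_rootN v : is_root v -> is_root (- v).
Proof.
move=> [x [i ->]]; exists (x * cox_gen m i)%g, i.
rewrite cox_actM cox_act_gen refl_root cox_act_lin.
by apply/ffunP => j; rewrite !ffunE; ring.
Qed.

Lemma inversionsP s v : is_root v -> nneg v -> npos (act m s v) ->
  v \in inversions s.
Proof.
move=> rv v0; elim: s => [|i s IHs] /= neg.
  have := is_root_norm rv; rewrite /cform big1 => [/esym/eqP|j _].
    by rewrite oner_eq0.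
  by rewrite (_ : v j = 0) ?mul0r //; apply/eqP; rewrite eq_le v0 neg.
have [pos|/IHs h] := is_root_sign (is_root_act s rv); last first.
  by rewrite inE h orbT.
pose u := act m s v; have uk k : k != i -> u k = 0.
  move=> /negPf ki; apply/eqP; rewrite eq_le pos andbT.
  by have := neg k; rewrite ffunE ki mul0r subr0.
have uE : u = lin (u i) (sroot R i) 0 (sroot R i).
  apply/ffunP => k; rewrite !ffunE; have [->|ki] := eqVneq k i.
    by rewrite mulr1 mul0r addr0.
  by rewrite uk // !mulr0 addr0.
have d2 : u i ^+ 2 = 1.
  have : cform m u u = 1 by apply/is_root_norm/is_root_act.
  rewrite [in cform _ _ _]uE form_lin !form_linl form_root1 => <-; ring.
have ui : u i = 1.
  have : (u i - 1) * (u i + 1) = 0.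
    by rewrite -[RHS](subrr 1) -{3}d2; ring.
  by have := pos i; rewrite -/u => ? /eqP; rewrite mulf_eq0 => /orP[] /eqP; lra.
rewrite inE; apply/orP; left; apply/eqP; rewrite -[LHS](actK m s) -/u;
  congr act.
by rewrite uE ui; apply/ffunP => k; rewrite !ffunE; ring.
Qed.

Definition roots : seq vec :=
  [seq v <- undup (inversions w ++ map -%R (inversions w)) | `[< is_root v >]].

Lemma act_w_npos v : nneg v -> npos (act m w v).
Proof.
move=> v0 k; rewrite act_matrix sumr_le0 // => i _.
by rewrite we mulr_ge0_le0 // !ffunE oppr_le0 ler0n.
Qed.

(** w makes every positive root negative, so all positive roots are among its inversions: this is
    the finiteness of the root system. *)
Lemma mem_roots v : (v \in roots) = `[< is_root v >].
Proof.
rewrite mem_filter; apply/andb_idr => /asboolP rv; rewrite mem_undup mem_cat.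
have [v0|v0] := is_root_sign rv.
  by rewrite inversionsP //; apply: act_w_npos.
apply/orP; right; apply/mapP; exists (- v); last by rewrite opprK.
have nv : nneg (- v) by move=> j; rewrite ffunE oppr_ge0.
by apply: inversionsP => //; [exact: is_rootN|exact: act_w_npos].
Qed.

(* An invariant positive form: it is proportional to [cform] because both are
   invariant under every simple reflection. *)
Definition rform u v : R := \sum_(r <- roots) cform m r u * cform m r v.

Lemma rform_sym u v : rform u v = rform v u.
Proof. by apply: eq_bigr => r _; rewrite mulrC. Qed.

Lemma rform_refl i u v : rform (refl m i u) (refl m i v) = rform u v.
Proof.
have pr : perm_eq (map (refl m i) roots) roots.
  apply: uniq_perm.
  - rewrite map_inj_uniq ?filter_uniq ?undup_uniq //.
    exact/can_inj/reflK.
  - by rewrite filter_uniq ?undup_uniq.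
  move=> v'; rewrite mem_roots; apply/mapP/asboolP => [[u' + ->]|rv].
    by rewrite mem_roots => /asboolP; exact: is_root_refl.
  exists (refl m i v'); last by rewrite reflK.
  by rewrite mem_roots; apply/asboolP/is_root_refl.
rewrite /rform -(perm_big _ pr) /= big_map.
by apply: eq_bigr => r _; rewrite !form_refl.
Qed.

Lemma rform_lin w' p u q v : rform w' (lin p u q v) = p * rform w' u + q *
  rform w' v.
Proof.
rewrite /rform !mulr_sumr -big_split /=; apply: eq_bigr => r _.
by rewrite form_lin; ring.
Qed.

Let c i := rform (sroot R i) (sroot R i).

(** The component of v orthogonal to the root of i is fixed by the reflection, which negates that
    root; so [rform] vanishes on the pair. *)
Lemma rform_root i v : rform (sroot R i) v = c i * coroot m i v.
Proof.
pose u := lin 1 v (- coroot m i v) (sroot R i).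
have cu : coroot m i u = 0.
  by rewrite coroot_lin coroot_root gramii; ring.
have ru : refl m i u = u.
  by apply/ffunP => j; rewrite ffunE cu; ring.
have : rform (sroot R i) u = - rform (sroot R i) u.
  rewrite -{1}(rform_refl i) ru refl_root rform_sym rform_lin rform_sym; ring.
rewrite /u rform_lin -/(c i) => h; lra.
Qed.

(** For adjacent vertices, computing [rform] of their roots in both orders equates the two factors,
    the gram entry being nonzero; connectedness spreads the equality. *)
Lemma rform_scale i : forall u v, rform u v = c i * cform m u v.
Proof.
have cE j : c j = c i.
  have /connectP[p + ->] := conn i j; elim: p i =>
    //= k p IHp l /andP[lk /IHp ->].
  have := rform_root l (sroot R k); rewrite rform_sym rform_root !coroot_root
    gram_sym.
  have /negbTE g0 : gram R m l k != 0.
    by rewrite ltr0_neq0 //; apply: le_lt_trans (gram_cadj lk) _; lra.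
  by move=> /eqP; rewrite -subr_eq0 -mulrBl mulf_eq0 g0 orbF subr_eq0 => /eqP.
move=> u v; rewrite /cform mulr_sumr.
have -> : rform u v = \sum_j u j * rform (sroot R j) v.
  rewrite /rform; under eq_bigr => r _ do rewrite form_sym [cform m u r]/cform
    mulr_suml.
  rewrite exchange_big; apply: eq_bigr => j _; rewrite mulr_sumr.
  by apply: eq_bigr => r _; rewrite form_rootr; ring.
by apply: eq_bigr => j _; rewrite rform_root cE; ring.
Qed.

Lemma c_gt0 i : 0 < c i.
Proof.
rewrite /c /rform (bigD1_seq (sroot R i)) /=; last 2 first.
- by rewrite mem_roots; apply/asboolP/is_root_sroot.
- by rewrite filter_uniq ?undup_uniq.
rewrite form_root1 mulr1 ltr_pwDl // sumr_ge0 // => r _.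
by rewrite -expr2 sqr_ge0.
Qed.

(** A vector of norm 0 is orthogonal to all roots, hence fixed by w; but w makes nonnegative vectors
    nonpositive. *)
Lemma cform_gt0 v i : nneg v -> v i != 0 -> 0 < cform m v v.
Proof.
move=> v0 vi; rewrite lt_def; have cf := rform_scale i v v.
have r0 : 0 <= rform v v.
  by rewrite sumr_ge0 // => r _; rewrite -expr2 sqr_ge0.
rewrite cf (pmulr_rge0 _ (c_gt0 i)) in r0; rewrite r0 andbT.
apply/eqP => f0; move: cf; rewrite f0 mulr0 => /eqP.
rewrite psumr_eq0 => [|r _]; last by rewrite -expr2 sqr_ge0.
move=> /allP h; have ck j : coroot m j v = 0.
  have /h : sroot R j \in roots by rewrite mem_roots;
    apply/asboolP/is_root_sroot.
  by rewrite /= form_root mulf_eq0 orbb => /eqP.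
have wv : act m w v = v.
  elim: w => //= j s ->; apply/ffunP => k; rewrite ffunE ck; ring.
have := act_w_npos v0 i; rewrite wv => vi0.
by move: vi; rewrite eq_le vi0 v0.
Qed.

End Positivity.

(** * Graph automorphisms of paths and forks *)

(* Adjacency in the tree made of the path 0 - 1 - ... - k with the extra vertex
   k + 1 attached to i. *)
Definition fork_adj (k i a b : nat) : Prop :=
  (b = a.+1 /\ b <= k \/ a = b.+1 /\ a <= k \/
   a = i /\ b = k.+1 \/ b = i /\ a = k.+1)%N.

Lemma fork_adj_star a b : (a <= 3)%N -> (b <= 3)%N ->
  fork_adj 2 1 a b <-> a = 1 /\ b <> 1 \/ b = 1 /\ a <> 1.
Proof. by rewrite /fork_adj; lia. Qed.

Lemma coxeter_E6_fork a b : (a <= 5)%N -> (b <= 5)%N ->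
  fork_adj 4 2 a b /\ coxeter_E6 a b = Some 3 \/
  ~ fork_adj 4 2 a b /\ coxeter_E6 a b = Some 2.
Proof.
move=> a5 b5; rewrite /coxeter_E6 /simply_laced; case: ifP => c; [left|right];
by split=> //; move: c; rewrite /fork_adj /=; lia.
Qed.

Lemma coxeter_D_fork k a b : (2 <= k)%N -> (a <= k.+1)%N -> (b <= k.+1)%N ->
  let s c := if (c <= k)%N then (k - c)%N else c in
  fork_adj k 1 (s a) (s b) /\ coxeter_D k.+2 a b = Some 3 \/
  ~ fork_adj k 1 (s a) (s b) /\ coxeter_D k.+2 a b = Some 2.
Proof.
move=> k2 ak bk /=; rewrite /coxeter_D /simply_laced /=.
case: (leqP a k) => ak'; case: (leqP b k) => bk'; case: ifP => c;
  [left|right|left|right|left|right|left|right];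
by split=> //; move: c; rewrite /fork_adj; lia.
Qed.

Section NatAutomorphisms.
Variables (k : nat) (E : nat -> nat).
Local Open Scope nat_scope.

Lemma path_automorphism_id c :
  (forall a, a <= k -> E a <= k) ->
  (forall a b, a <= k -> b <= k -> a <> b -> E a <> E b) ->
  (forall a, a < k -> E a.+1 = (E a).+1 \/ E a = (E a.+1).+1) ->
  c < k -> E c = c -> E c.+1 = c.+1 -> forall a, a <= k -> E a = a.
Proof.
move=> Ek Einj Eadj ck Ec Ec1.
have up n : c + n.+1 <= k -> E (c + n) = c + n /\ E (c + n).+1 = (c + n).+1.
  elim: n => [|n IHn] cn; first by rewrite addn0.
  have [] := IHn ltac:(lia); rewrite -addnS => e0 e1; split=> //.
  have := Eadj (c + n.+1) ltac:(lia).
  have := @Einj (c + n) (c + n.+1).+1 ltac:(lia) ltac:(lia) ltac:(lia); lia.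
have down n : n <= c -> E (c - n) = c - n /\ E (c - n).+1 = (c - n).+1.
  elim: n => [|n IHn] cn; first by rewrite subn0.
  have [] := IHn ltac:(lia); have -> : c - n = (c - n.+1).+1 by lia.
  move=> e0 e1; split=> //; have := Eadj (c - n.+1) ltac:(lia).
  have := @Einj (c - n.+1) (c - n.+1).+2 ltac:(lia) ltac:(lia) ltac:(lia); lia.
move=> a ak; have [ac|ca] := leqP a c.
  by have [+ _] := down (c - a) ltac:(lia); rewrite subKn.
by have [_] := up (a - c.+1) ltac:(lia); have ->
  : (c + (a - c.+1)).+1 = a by lia.
Qed.

Hypothesis Einj : forall a b, a <= k.+1 -> b <= k.+1 -> a <> b -> E a <> E b.

Lemma fork_center i : 0 < i < k -> i < 3 -> (i = 2 -> 5 <= k) ->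
  (forall a b, a <= k.+1 -> b <= k.+1 -> fork_adj k i a b ->
    fork_adj k i (E a) (E b)) ->
  E i = i.
Proof.
move=> ik i3 i2 adj.
have n1 := @Einj i.-1 i.+1 ltac:(lia) ltac:(lia) ltac:(lia).
have n2 := @Einj i.-1 k.+1 ltac:(lia) ltac:(lia) ltac:(lia).
have n3 := @Einj i.+1 k.+1 ltac:(lia) ltac:(lia) ltac:(lia).
have a1 := @adj i i.-1 ltac:(lia) ltac:(lia) ltac:(rewrite /fork_adj; lia).
have a3 := @adj i i.+1 ltac:(lia) ltac:(lia) ltac:(rewrite /fork_adj; lia).
have az := @adj i k.+1 ltac:(lia) ltac:(lia) ltac:(rewrite /fork_adj; lia).
move: a1 a3 az n1 n2 n3 {adj}; rewrite /fork_adj.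
move: (E i) (E i.-1) (E i.+1) (E k.+1) => u x y z.
by case=> [?|[?|[?|?]]]; case=> [?|[?|[?|?]]]; case=> [?|[?|[?|?]]]; lia.
Qed.

(** The arms at vertex 2 have the distinct lengths 1, 2 and k - 2 >= 3. This removes E_7 and E_8 and
    leaves E_6, where k = 4. *)
Lemma fork2_automorphism_id :
  (forall a b, a <= k.+1 -> b <= k.+1 -> fork_adj k 2 a b ->
    fork_adj k 2 (E a) (E b)) ->
  5 <= k -> forall a, a <= k.+1 -> E a = a.
Proof.
move=> adj k5; have E2 : E 2 = 2 by apply: fork_center adj; lia.
have a1 : fork_adj k 2 2 (E 1).
  by rewrite -{2}E2; apply: adj; rewrite /fork_adj; lia.
have a3 : fork_adj k 2 2 (E 3).
  by rewrite -{2}E2; apply: adj; rewrite /fork_adj; lia.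
have az : fork_adj k 2 2 (E k.+1).
  by rewrite -{2}E2; apply: adj; rewrite /fork_adj; lia.
have a0 : fork_adj k 2 (E 1) (E 0) by apply: adj; rewrite /fork_adj; lia.
have a4 : fork_adj k 2 (E 3) (E 4) by apply: adj; rewrite /fork_adj; lia.
have a5 : fork_adj k 2 (E 4) (E 5) by apply: adj; rewrite /fork_adj; lia.
have n1 := @Einj 1 3 ltac:(lia) ltac:(lia) ltac:(lia).
have n2 := @Einj 1 k.+1 ltac:(lia) ltac:(lia) ltac:(lia).
have n3 := @Einj 3 k.+1 ltac:(lia) ltac:(lia) ltac:(lia).
have n0 := @Einj 2 0 ltac:(lia) ltac:(lia) ltac:(lia).
have n4 := @Einj 2 4 ltac:(lia) ltac:(lia) ltac:(lia).
have n5 := @Einj 3 5 ltac:(lia) ltac:(lia) ltac:(lia).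
rewrite E2 in n0 n4.
have E3 : E 3 = 3.
  move: a1 a3 a0 a4 a5 n1 n0 n4 n5 k5; rewrite /fork_adj; clear.
  move: (E 1) (E 3) (E 0) (E 4) (E 5) => u1 u3 u0 u4 u5.
  move=> h1 h3; have {}h1 : u1 = 1 \/ u1 = 3 \/ u1 = k.+1 by lia.
  have {}h3 : u3 = 1 \/ u3 = 3 \/ u3 = k.+1 by lia.
  by case: h1 => [?|[?|?]]; case: h3 => [?|[?|?]]; subst; lia.
have E1 : E 1 = 1.
  move: a1 a0 n1 n0 k5; rewrite /fork_adj E3; clear.
  by move: (E 1) (E 0) => u1 u0; lia.
have E0 : E 0 = 0.
  by move: a0 n0 k5; rewrite /fork_adj E1; clear; move: (E 0) => u0; lia.
have Ez : E k.+1 = k.+1.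
  move: az n2 n3 k5; rewrite /fork_adj E1 E3; clear.
  by move: (E k.+1) => u0; lia.
have up n : 3 + n <= k -> E (2 + n) = 2 + n /\ E (3 + n) = 3 + n.
  elim: n => [|n IHn] kn //; have [e0 e1] := IHn ltac:(lia).
  split; first by rewrite addnS -addSn.
  have := @adj (3 + n) (4 + n) ltac:(lia) ltac:(lia) ltac:(rewrite /fork_adj;
    lia).
  have := @Einj (2 + n) (4 + n) ltac:(lia) ltac:(lia) ltac:(lia).
  rewrite e0 e1 /fork_adj (_ : 3 + n.+1 = 4 + n) //; move: (E (4 + n)) kn;
    clear; lia.
case=> [|[|[|a]]] // ak.
have [aklt|] := leqP a.+3 k; last by move=> ?; have -> : a.+3 = k.+1 by lia.
by have [] := up a aklt.
Qed.

(** For k > 2 only the two short arms 0 and k + 1 can be exchanged. For k = 2, the diagram D_4, all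
    three leaves are alike, and an involution exchanges two of them. *)
Lemma fork1_automorphism :
  (forall a b, a <= k.+1 -> b <= k.+1 -> fork_adj k 1 a b ->
    fork_adj k 1 (E a) (E b)) ->
  (forall a, a <= k.+1 -> E (E a) = a) -> (exists2 a, a <= k.+1 & E a <> a) ->
  2 <= k ->
  E 1 = 1 /\
  ([/\ E 0 = k.+1, E k.+1 = 0 & forall a, 0 < a -> a <= k -> E a = a] \/
   k = 2 /\ ([/\ E 2 = 0, E 0 = 2 & E 3 = 3] \/ [/\
     E 2 = 3, E 3 = 2 & E 0 = 0])).
Proof.
move=> adj EE [a0 a0k Ea0] k2.
have E1 : E 1 = 1 by apply: fork_center adj; lia.
have nb a : a <= k.+1 -> fork_adj k 1 1 a -> E a = 0 \/ E a = 2 \/ E a = k.+1.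
  move=> ak aa; have := @adj 1 a ltac:(lia) ak aa; rewrite E1 /fork_adj.
  by move: (E a) k2; clear; lia.
have b0 := nb 0 ltac:(lia) ltac:(rewrite /fork_adj; lia).
have b2 := nb 2 ltac:(lia) ltac:(rewrite /fork_adj; lia).
have bz := nb k.+1 ltac:(lia) ltac:(rewrite /fork_adj; lia).
have n1 := @Einj 0 2 ltac:(lia) ltac:(lia) ltac:(lia).
have n2 := @Einj 0 k.+1 ltac:(lia) ltac:(lia) ltac:(lia).
have n3 := @Einj 2 k.+1 ltac:(lia) ltac:(lia) ltac:(lia).
split=> //; have [E2|/eqP E2] := eqVneq (E 2) 2; last first.
  have k22 : k = 2.
    apply/eqP; rewrite eqn_leq k2 andbT leqNgt; apply/negP => k3.
    have := @adj 2 3 ltac:(lia) ltac:(lia) ltac:(rewrite /fork_adj; lia).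
    have := @Einj 1 3 ltac:(lia) ltac:(lia) ltac:(lia).
    move: b2 E2 k3; rewrite E1 /fork_adj; clear.
    by move: (E 2) (E 3) => u v; lia.
  right; split=> //; move: bz n2 n3 b0 b2; rewrite k22 => bz n2 n3 b0 b2.
  have ee := EE 2 ltac:(lia).
  have [e|e] : E 2 = 0 \/ E 2 = 3 by move: b2 E2; clear; lia.
    left; rewrite e in ee; split=> //.
    by move: bz n2 n3; rewrite ee e; clear; lia.
  right; rewrite e in ee; split=> //.
  by move: b0 n2 n1; rewrite ee e; clear; lia.
left; have up n : 2 + n <= k -> E (1 + n) = 1 + n /\ E (2 + n) = 2 + n.
  elim: n => [|n IHn] kn //; have [e0 e1] := IHn ltac:(lia).
  split; first by rewrite addnS -addSn.
  have := @adj (2 + n) (3 + n) ltac:(lia) ltac:(lia) ltac:(rewrite /fork_adj;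
    lia).
  have := @Einj (1 + n) (3 + n) ltac:(lia) ltac:(lia) ltac:(lia).
  rewrite e0 e1 /fork_adj (_ : 2 + n.+1 = 3 + n) //; move: (E (3 + n)) kn;
    clear; lia.
have Ea a : 0 < a -> a <= k -> E a = a.
  by case: a => [|[|a]] // _ ak; have [] := up a ak.
have E0 : E 0 <> 0.
  move=> E0; apply: Ea0; case: (posnP a0) => [->|a00] //.
  have [/Ea|ka] := leqP a0 k; first exact.
  have -> : a0 = k.+1 by lia.
  by move: bz n2 n3; rewrite E0 E2; clear; lia.
split=> //; first by move: b0 n1 E0; rewrite E2; clear; lia.
by move: bz n2 n3 b0 n1 E0; rewrite E2; clear; lia.
Qed.

End NatAutomorphisms.

(** * Excluded subgraphs *)

Section Exclusion.
Variables (R : realType) (I : finType) (m : coxeter_matrix I).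
Local Notation vec := {ffun I -> R}.
Implicit Types (u v : vec) (f : seq (I * R)) (c d : R).

Hypothesis pos : forall v i, nneg v -> v i != 0 -> 0 < cform m v v.

Definition heavy : rel I := [rel i j | (i != j) && label_geq 4 (m i j)].

Lemma heavy_sym i j : heavy i j = heavy j i.
Proof. by rewrite /heavy /= eq_sym cox_label_sym. Qed.

(* By [pos], the subgraphs excluded in the classification are those carrying an
   f with d <= 0. *)
Definition bounded f d := exists v,
  [/\ nneg v, forall p, p \in f -> v p.1 = p.2,
  forall x, x \notin map fst f -> v x = 0 & cform m v v <= d].

Lemma bounded_gt0 f d x a : bounded f d -> (x, a) \in f -> a != 0 -> 0 < d.
Proof.
move=> [v [v0 vf _ vd]] /vf /= vx a0; apply: lt_le_trans vd.
by apply: (pos (i := x)); rewrite // vx.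
Qed.

Lemma bounded_le f d d' : bounded f d -> d <= d' -> bounded f d'.
Proof. by move=> [v [v0 vf v1 vd]] dd'; exists v; split=> //;
  exact: le_trans dd'. Qed.

Lemma bounded_nil : bounded [::] 0.
Proof.
exists [ffun=> 0]; split=> // [j|x _|]; rewrite ?ffunE //.
by rewrite /cform big1 // => i _; rewrite ffunE mul0r.
Qed.

(** Adding c times the root of x to v changes the form by c^2 + 2 c [coroot m x v]. *)
Lemma bounded_step f d x c b : bounded f d -> x \notin map fst f -> 0 <= c ->
  (forall v, nneg v -> v x = 0 -> (forall p, p \in f -> v p.1 = p.2) ->
     coroot m x v <= - b) ->
  bounded ((x, c) :: f) (d + c ^+ 2 - 2 * c * b).
Proof.
move=> [v [v0 vf v1 vd]] xf c0 hb; exists (lin c (sroot R x) 1 v); split.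
- by move=> j; rewrite !ffunE addr_ge0 ?mul1r // mulr_ge0 ?ler0n.
- move=> [y a]; rewrite inE => /orP[/eqP[-> ->]|yf]; rewrite !ffunE /=.
    by rewrite eqxx v1 // mulr1 mulr0 addr0.
  have /negPf -> : y != x.
    by apply: contraNneq xf => <-; apply/mapP; exists (y, a).
  by rewrite (vf _ yf) mulr0 mul1r add0r.
- move=> y; rewrite inE negb_or => /andP[/negPf yx yf]; rewrite !ffunE yx v1 //.
  by rewrite !mulr0 addr0.
- rewrite form_lin !form_linl form_root1 form_root form_rootr.
  have := hb v v0 (v1 _ xf) vf => ?; nra.
Qed.

(** Off-diagonal gram entries are nonpositive, so neighbours left out of the list only lower the
    form. A subgraph can thus be excluded knowing just some of its edges. *)
Lemma coroot_le x v (s : seq I) : uniq s -> x \notin s -> v x = 0 -> nneg v ->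
  coroot m x v <= \sum_(y <- s) gram R m x y * v y.
Proof.
move=> us xs vx v0; rewrite /coroot [leRHS]big_uniq //=.
rewrite [leRHS]big_mkcond /=; apply: ler_sum => y _; case: ifPn => // ys.
have [->|xy] := eqVneq y x; first by rewrite vx mulr0.
by rewrite mulr_le0_ge0 // gram_le0 1?eq_sym.
Qed.

Lemma bounded_isolated f d x c : bounded f d -> x \notin map fst f -> 0 <= c ->
  bounded ((x, c) :: f) (d + c ^+ 2).
Proof.
move=> fd xf c0; have -> : d + c ^+ 2 = d + c ^+ 2 - 2 * c * 0 by ring.
apply: bounded_step => // v v0 vx _; rewrite oppr0.
by have := coroot_le (s := [::]) isT isT vx v0; rewrite big_nil.
Qed.

Lemma notin_cons f x y a : x != y -> x \notin map fst f ->
  x \notin map fst ((y, a) :: f).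
Proof. by move=> xy xf; rewrite inE negb_or xy. Qed.

Lemma fst_notin f x y a : x \notin map fst f -> (y, a) \in f -> x != y.
Proof. by move=> xf ya; apply: contraNneq xf => ->; apply/mapP; exists (y, a).
  Qed.

Lemma bounded_leaf f d x c y a b : bounded f d -> x \notin map fst f ->
  0 <= c ->
  (y, a) \in f -> gram R m x y <= - b ->
    bounded ((x, c) :: f) (d + c ^+ 2 - 2 * c * (b * a)).
Proof.
move=> fd xf c0 ya gxy; apply: bounded_step => // v v0 vx vf.
have xy := fst_notin xf ya.
have := @coroot_le x v [:: y] isT _ vx v0; rewrite inE big_seq1 => /(_ xy) h.
have vy : v y = a := vf _ ya.
have := v0 y; rewrite vy in h * => ?; nra.
Qed.

Lemma bounded_close f d x c y z : bounded f d -> x \notin map fst f ->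
  0 <= c -> (y, 1) \in f -> (z, 1) \in f -> y != z -> cadj m x y ->
    cadj m x z ->
  bounded ((x, c) :: f) (d + c ^+ 2 - 2 * c).
Proof.
move=> fd xf c0 yf zf yz xy xz; rewrite -[2 * c]mulr1;
  apply: bounded_step => // v v0 vx vf.
have uyz : uniq [:: y; z] by rewrite /= inE yz.
have xyz : x \notin [:: y; z] by rewrite !inE negb_or !(@cadj_neq _ m).
have := coroot_le uyz xyz vx v0; rewrite big_cons big_seq1.
rewrite (vf _ yf) (vf _ zf) /=.
have := gram_cadj R xy; have := gram_cadj R xz; lra.
Qed.

(** The weight 1/2 minimizes c^2 - c. *)
Lemma bounded_light f d x y : bounded f d -> x \notin map fst f ->
  (y, 1) \in f -> cadj m x y -> bounded ((x, 2^-1) :: f) (d - 4^-1).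
Proof.
move=> fd xf yf xy; apply: bounded_le.
  apply: (bounded_leaf (b := 2^-1) (c := 2^-1) fd xf _ yf); first by lra.
  exact: gram_cadj.
lra.
Qed.

(** The weight cos(pi / 4) minimizes c^2 - 2 c cos(pi / 4), with minimum -1/2. *)
Lemma bounded_heavy f d x y : bounded f d -> x \notin map fst f ->
  (y, 1) \in f -> heavy x y ->
  bounded ((x, cosl R (Some 4)) :: f) (d - 2^-1).
Proof.
move=> fd xf yf /andP[xy hxy]; have c0 : 0 <= cosl R (Some 4) by apply:
  cosl_ge0.
apply: bounded_le.
  apply: (bounded_leaf (b := cosl R (Some 4)) fd xf c0 yf).
  by rewrite /gram (negPf xy) lerN2 cosl_le.
have := cosl4_sqr R; nra.
Qed.

Section Path.
Variables (p : nat -> I) (k : nat).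
Hypothesis pinj : forall a b, (a <= k)%N -> (b <= k)%N -> p a = p b -> a = b.
Hypothesis padj : forall a, (a < k)%N -> cadj m (p a) (p a.+1).

Definition seg i n : seq (I * R) := [seq (p a, 1) | a <- iota i n].

Lemma segP x i n : reflect (exists2 a, (i <= a < i + n)%N & x = p a) (x \in map
  fst (seg i n)).
Proof.
rewrite /seg -map_comp; apply: (iffP mapP) => -[a]; rewrite ?mem_iota => h ->.
  by exists a.
by exists a; rewrite ?mem_iota.
Qed.

Lemma mem_seg i n a : (i <= a < i + n)%N -> (p a, 1) \in seg i n.
Proof. by move=> h; apply/mapP; exists a; rewrite ?mem_iota. Qed.

Lemma p_neq a b : (a <= k)%N -> (b <= k)%N -> a <> b -> p a != p b.
Proof. by move=> ak bk ab; apply/eqP => /pinj-/(_ ak bk). Qed.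

Lemma notin_seg b i n : (i + n <= k.+1)%N -> (b <= k)%N ->
  ~ (i <= b < i + n)%N ->
  p b \notin map fst (seg i n).
Proof.
move=> ik bk h; apply/segP => -[a ha /pinj e]; apply: h.
by rewrite e //; lia.
Qed.

(** All weights are 1: the n + 1 vertices contribute n + 1, and each of the n edges at most -1. *)
Lemma bounded_seg i n : (i + n <= k)%N -> bounded (seg i n.+1) 1.
Proof.
elim: n i => [|n IHn] i ik.
  have := bounded_isolated (x := p i) (c := 1) bounded_nil isT ler01.
  by rewrite add0r expr1n.
have h := IHn i.+1 ltac:(lia).
apply: bounded_le.
  apply: (bounded_leaf (c := 1) (b := 2^-1) (y := p i.+1) h) => //.
  - apply: notin_seg; lia.
  - by apply: mem_seg; lia.
  - by apply/gram_cadj/padj; lia.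
lra.
Qed.

(** The constant vector 1 on a cycle is the null vector of affine type A. *)
Lemma no_cycle x i n : (0 < n)%N -> (i + n <= k)%N ->
  x \notin map fst (seg i n.+1) ->
  cadj m x (p i) -> cadj m x (p (i + n)) -> False.
Proof.
move=> n0 ik xs xi xn; have h := bounded_seg ik.
have /bounded_gt0 : bounded ((x, 1) :: seg i n.+1) (1 + 1 ^+ 2 - 2 * 1).
  apply: (bounded_close h xs ler01 _ _ _ xi xn).
  - by apply: mem_seg; lia.
  - by apply: mem_seg; lia.
  - by apply: p_neq; lia.
by move=> /(_ x 1); rewrite mem_head oner_eq0 => /(_ isT isT); lra.
Qed.

Lemma no_chord a b : (a.+1 < b)%N -> (b <= k)%N -> ~~ cadj m (p b) (p a).
Proof.
move=> ab bk; apply/negP => h.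
apply: (@no_cycle (p b) a (b.-1 - a)) h _; try lia.
- by apply: notin_seg; lia.
- have -> : (a + (b.-1 - a) = b.-1)%N by lia.
  by rewrite cadj_sym -{2}(@prednK b) 1?padj; lia.
Qed.

Lemma path_cadj a b : (a <= k)%N -> (b <= k)%N ->
  cadj m (p a) (p b) = (a.+1 == b) || (b.+1 == a).
Proof.
move=> ak bk; apply/idP/idP => [h|/orP[]/eqP e].
- have [||e] := ltngtP a b; last by move: (cadj_neq h); rewrite e eqxx.
    rewrite leq_eqVlt => /orP[/eqP ->|/no_chord/(_ bk)]; first by rewrite eqxx.
    by rewrite cadj_sym h.
  rewrite leq_eqVlt => /orP[/eqP ->|/no_chord/(_ ak)];
    first by rewrite eqxx orbT.
  by rewrite h.
- by rewrite -e; apply: padj; lia.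
- by rewrite -e cadj_sym; apply: padj; lia.
Qed.

(** The null vector of affine type C, with weight 1 inside and cos(pi / 4) at both ends. *)
Lemma one_heavy a b : (a < b)%N -> (b < k)%N -> heavy (p a) (p a.+1) ->
  heavy (p b) (p b.+1) -> False.
Proof.
move=> ab bk ha hb.
have h := @bounded_seg a.+1 (b - a.+1) ltac:(lia).
have {}h : bounded ((p a, cosl R (Some 4)) :: seg a.+1 (b - a.+1).+1) (1 -
  2^-1).
  apply: (bounded_heavy h _ _ ha); first by apply: notin_seg; lia.
  by apply: mem_seg; lia.
have /bounded_gt0 : bounded ((p b.+1, cosl R (Some 4)) ::
    (p a, cosl R (Some 4)) :: seg a.+1 (b - a.+1).+1) (1 - 2^-1 - 2^-1).
  apply: (bounded_heavy (y := p b) h).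
  - by apply: notin_cons; [apply: p_neq|apply: notin_seg]; lia.
  - by rewrite inE mem_seg ?orbT //; lia.
  - by rewrite heavy_sym.
move=> /(_ (p b) 1); rewrite oner_eq0 => /(_ _ isT) h'.
suff : (0 : R) < 1 - 2^-1 - 2^-1 by lra.
by apply: h'; rewrite 2!in_cons mem_seg ?orbT //; lia.
Qed.

End Path.
End Exclusion.

(** * Forks: affine types B, D, E_6 and E_7 *)

Section Fork.
Variables (R : realType) (I : finType) (m : coxeter_matrix I).
Local Notation vec := {ffun I -> R}.
Hypothesis pos : forall (v : vec) i, nneg v -> v i != 0 -> 0 < cform m v v.
Variables (p : nat -> I) (k : nat).
Hypothesis pinj : forall a b, (a <= k)%N -> (b <= k)%N -> p a = p b -> a = b.
Hypothesis padj : forall a, (a < k)%N -> cadj m (p a) (p a.+1).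

Local Notation bnd := (@bounded R I m).
Local Notation seg := (@seg R I p).
Local Notation c4 := (cosl R (Some 4)).

Lemma in_tail (f : seq (I * R)) q r : q \in f -> q \in r :: f.
Proof. by rewrite in_cons => ->; rewrite orbT. Qed.

Lemma bounded_absurd f d x a : bnd f d -> (x, a) \in f -> a != 0 ->
  d <= 0 -> False.
Proof. by move=> fd xf a0; rewrite leNgt (bounded_gt0 pos fd xf a0). Qed.

Lemma padjV a : (0 < a <= k)%N -> cadj m (p a.-1) (p a).
Proof. by move=> ak; rewrite -{2}(@prednK a) 1?padj; lia. Qed.

Lemma notin_seg_out z i n : (i + n <= k.+1)%N -> (forall a, (a <= k)%N ->
  z != p a) ->
  z \notin map fst (seg i n).
Proof. by move=> ik zp; apply/segP => -[a ha /eqP]; apply/negP/zp; lia. Qed.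

Variables (z : I) (i : nat).
Hypothesis zp : forall a, (a <= k)%N -> z != p a.
Hypothesis ik : (0 < i < k)%N.
Hypothesis zi : cadj m z (p i).

Local Ltac leaf :=
  first [apply: notin_cons; leaf | apply: notin_seg_out; [lia | done] |
         apply: (notin_seg R pinj); lia | by apply: zp;
           lia | by rewrite eq_sym; apply: zp; lia |
         by apply: (p_neq pinj); lia | done | lia].
Local Ltac inside := repeat first [apply: mem_seg; lia | apply: in_tail].

Lemma fork_no_heavy_z : ~ heavy m z (p i).
Proof.
move=> h.
have b0 : bnd (seg i 1) 1 by apply: (bounded_seg R pinj padj); lia.
have b1 : bnd ((p i.-1, 2^-1) :: seg i 1) (1 - 4^-1).
  by apply: (bounded_light b0 (y := p i)); [leaf|inside|apply: padjV; lia].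
have b2 : bnd ((p i.+1, 2^-1) :: (p i.-1, 2^-1) :: seg i 1) (1 - 4^-1 - 4^-1).
  by apply: (bounded_light b1 (y := p i)); [leaf|inside|rewrite cadj_sym;
    apply: padj; lia].
have b3 : bnd ((z, c4) :: (p i.+1, 2^-1) :: (p i.-1, 2^-1) :: seg i 1)
    (1 - 4^-1 - 4^-1 - 2^-1).
  by apply: (bounded_heavy b2 (y := p i)); [leaf|inside|].
by apply: (bounded_absurd b3 (x := p i) (a := 1));
  [inside|rewrite oner_eq0|lra].
Qed.

(** The null vector of affine type B: weight 1 from the branch vertex to the heavy edge, cos(pi / 4)
    at its far end, and 1/2 on the two other neighbours of the branch vertex. *)
Lemma fork_no_heavy a : (a < k)%N -> ~ heavy m (p a) (p a.+1).
Proof.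
move=> ak h; case: (leqP i a) => ia.
  have b0 : bnd (seg i (a - i).+1) 1 by apply: (bounded_seg R pinj padj); lia.
  have b1 : bnd ((p i.-1, 2^-1) :: seg i (a - i).+1) (1 - 4^-1).
    by apply: (bounded_light b0 (y := p i)); [leaf|inside|apply: padjV; lia].
  have b2 : bnd ((z, 2^-1) :: (p i.-1, 2^-1) :: seg i (a - i).+1) (1 - 4^-1 -
    4^-1).
    by apply: (bounded_light b1 (y := p i)); [leaf|inside|].
  have b3 : bnd ((p a.+1, c4) :: (z, 2^-1) :: (p i.-1,
    2^-1) :: seg i (a - i).+1)
      (1 - 4^-1 - 4^-1 - 2^-1).
    by apply: (bounded_heavy b2 (y := p a)); [leaf|inside|rewrite heavy_sym].
  by apply: (bounded_absurd b3 (x := p i) (a := 1));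
    [inside|rewrite oner_eq0|lra].
have b0 : bnd (seg a.+1 (i - a.+1).+1) 1 by apply: (bounded_seg R pinj padj);
  lia.
have b1 : bnd ((p i.+1, 2^-1) :: seg a.+1 (i - a.+1).+1) (1 - 4^-1).
  by apply: (bounded_light b0 (y := p i)); [leaf|inside|rewrite cadj_sym;
    apply: padj; lia].
have b2 : bnd ((z, 2^-1) :: (p i.+1, 2^-1) :: seg a.+1 (i - a.+1).+1) (1 - 4^-1
  - 4^-1).
  by apply: (bounded_light b1 (y := p i)); [leaf|inside|].
have b3 : bnd ((p a, c4) :: (z, 2^-1) :: (p i.+1,
  2^-1) :: seg a.+1 (i - a.+1).+1)
    (1 - 4^-1 - 4^-1 - 2^-1).
  by apply: (bounded_heavy b2 (y := p a.+1)); [leaf|inside|].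
by apply: (bounded_absurd b3 (x := p i) (a := 1));
  [inside|rewrite oner_eq0|lra].
Qed.

Lemma fork_neighbor j : (j <= k)%N -> cadj m z (p j) -> j = i.
Proof.
move=> jk zj; case: (ltngtP j i) => // ji; exfalso.
  apply: (no_cycle pos pinj padj (x := z) (i := j) (n := i - j)) => //; try lia.
    apply: notin_seg_out zp; lia.
  by rewrite subnKC // ltnW.
apply: (no_cycle pos pinj padj (x := z) (i := i) (n := j - i)) => //; try lia.
  apply: notin_seg_out zp; lia.
by rewrite subnKC // ltnW.
Qed.

Lemma bounded_simple f d x c y a : bnd f d -> x \notin map fst f -> 0 <= c ->
  (y, a) \in f -> cadj m x y -> bnd ((x, c) :: f) (d + c ^+ 2 - c * a).
Proof.
move=> fd xf c0 ya xy; apply: bounded_le.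
  exact: (bounded_leaf fd xf c0 ya (gram_cadj R xy)).
lra.
Qed.

Local Ltac inside2 := repeat first [done | apply: mem_head | apply: in_tail].

Section Second.
Variable z' : I.
Hypothesis z'p : forall a, (a <= k)%N -> z' != p a.
Hypothesis zz' : z' != z.

Local Ltac leaf' :=
  first [apply: notin_cons; leaf' | leaf | by apply: z'p; lia].

(** The null vector of affine type D: four weights 1/2 around a segment of weight 1, which is a
    single vertex when the two branches leave from the same place. *)
Lemma fork_second j : (0 < j < k)%N -> cadj m z' (p j) -> False.
Proof.
move=> jk z'j; case: (ltngtP i j) => ij; last first.
- have b0 : bnd (seg i 1) 1 by apply: (bounded_seg R pinj padj); lia.
  have b1 : bnd ((p i.-1, 2^-1) :: seg i 1) (1 - 4^-1).
    by apply: (bounded_light b0 (y := p i)); [leaf|inside|apply: padjV; lia].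
  have b2 : bnd ((p i.+1, 2^-1) :: (p i.-1, 2^-1) :: seg i 1) (1 - 4^-1 - 4^-1).
    by apply: (bounded_light b1 (y := p i)); [leaf|inside|rewrite cadj_sym;
      apply: padj; lia].
  have b3 : bnd ((z, 2^-1) :: (p i.+1, 2^-1) :: (p i.-1, 2^-1) :: seg i 1)
      (1 - 4^-1 - 4^-1 - 4^-1).
    by apply: (bounded_light b2 (y := p i)); [leaf|inside|].
  have b4 : bnd ((z', 2^-1) :: (z, 2^-1) :: (p i.+1, 2^-1) :: (p i.-1,
    2^-1) :: seg i 1)
      (1 - 4^-1 - 4^-1 - 4^-1 - 4^-1).
    by apply: (bounded_light b3 (y := p i)); [leaf'|inside|rewrite ij].
  by apply: (bounded_absurd b4 (x := p i) (a := 1));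
    [inside|rewrite oner_eq0|lra].
- have b0 : bnd (seg j (i - j).+1) 1 by apply: (bounded_seg R pinj padj); lia.
  have b1 : bnd ((p j.-1, 2^-1) :: seg j (i - j).+1) (1 - 4^-1).
    by apply: (bounded_light b0 (y := p j)); [leaf|inside|apply: padjV; lia].
  have b2 : bnd ((p i.+1, 2^-1) :: (p j.-1,
    2^-1) :: seg j (i - j).+1) (1 - 4^-1 - 4^-1).
    by apply: (bounded_light b1 (y := p i)); [leaf|inside|rewrite cadj_sym;
      apply: padj; lia].
  have b3 : bnd ((z, 2^-1) :: (p i.+1, 2^-1) :: (p j.-1,
    2^-1) :: seg j (i - j).+1)
      (1 - 4^-1 - 4^-1 - 4^-1).
    by apply: (bounded_light b2 (y := p i)); [leaf|inside|].
  have b4 : bnd ((z', 2^-1) :: (z, 2^-1) :: (p i.+1, 2^-1) :: (p j.-1, 2^-1) ::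
      seg j (i - j).+1) (1 - 4^-1 - 4^-1 - 4^-1 - 4^-1).
    by apply: (bounded_light b3 (y := p j)); [leaf'|inside|].
  by apply: (bounded_absurd b4 (x := p i) (a := 1));
    [inside|rewrite oner_eq0|lra].
have b0 : bnd (seg i (j - i).+1) 1 by apply: (bounded_seg R pinj padj); lia.
have b1 : bnd ((p i.-1, 2^-1) :: seg i (j - i).+1) (1 - 4^-1).
  by apply: (bounded_light b0 (y := p i)); [leaf|inside|apply: padjV; lia].
have b2 : bnd ((p j.+1, 2^-1) :: (p i.-1,
  2^-1) :: seg i (j - i).+1) (1 - 4^-1 - 4^-1).
  by apply: (bounded_light b1 (y := p j)); [leaf|inside|rewrite cadj_sym;
    apply: padj; lia].
have b3 : bnd ((z, 2^-1) :: (p j.+1, 2^-1) :: (p i.-1,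
  2^-1) :: seg i (j - i).+1)
    (1 - 4^-1 - 4^-1 - 4^-1).
  by apply: (bounded_light b2 (y := p i)); [leaf|inside|].
have b4 : bnd ((z', 2^-1) :: (z, 2^-1) :: (p j.+1, 2^-1) :: (p i.-1, 2^-1) ::
    seg i (j - i).+1) (1 - 4^-1 - 4^-1 - 4^-1 - 4^-1).
  by apply: (bounded_light b3 (y := p j)); [leaf'|inside|].
by apply: (bounded_absurd b4 (x := p i) (a := 1));
  [inside|rewrite oner_eq0|lra].
Qed.

(** The weights 3; 2, 2, 2; 1, 1, 1 are the marks of affine E_6. *)
Lemma fork_extended : (2 <= i)%N -> (i + 2 <= k)%N -> cadj m z' z -> False.
Proof.
move=> i2 ik2 z'z; have b0 := bounded_nil R m.
have b1 := bounded_isolated (x := p i) (c := 3) b0 isT ltac:(lra).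
have b2 := bounded_simple (c := 2) (a := 3) (x := p i.-1) (y := p i) b1
  ltac:(leaf) ltac:(lra) ltac:(inside2) ltac:(apply: padjV; lia).
have b3 := bounded_simple (c := 2) (a := 3) (x := p i.+1) (y := p i) b2
  ltac:(leaf) ltac:(lra) ltac:(inside2) ltac:(rewrite cadj_sym; apply: padj;
    lia).
have b4 := bounded_simple (c := 2) (a := 3) (x := z) (y :=
  p i) b3 ltac:(leaf) ltac:(lra) ltac:(inside2) zi.
have b5 := bounded_simple (c := 1) (a := 2) b4 (x := p i.-2) (y := p i.-1)
  ltac:(leaf) ltac:(lra) ltac:(inside2) ltac:(apply: (padjV (a := i.-1)); lia).
have b6 := bounded_simple (c := 1) (a := 2) b5 (x := p i.+2) (y := p i.+1)
  ltac:(leaf) ltac:(lra) ltac:(inside2) ltac:(rewrite cadj_sym; apply: padj;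
    lia).
have b7 := bounded_simple (c := 1) (a := 2) (x := z') (y := z) b6
  ltac:(leaf') ltac:(lra) ltac:(inside2) z'z.
by apply: (bounded_absurd b7 (x := z') (a := 1));
  [inside2|rewrite oner_eq0|lra].
Qed.

End Second.

(** The weights 1, 2, 3, 4, 3, 2, 1 along the path and 2 at z are the marks of affine E_7. *)
Lemma fork_long : (3 <= i)%N -> (i + 3 <= k)%N -> False.
Proof.
move=> i2 ik2; have b0 := bounded_nil R m.
have b1 := bounded_isolated (x := p i) (c := 4) b0 isT ltac:(lra).
have b2 := bounded_simple (c := 3) (a := 4) (x := p i.-1) (y := p i) b1
  ltac:(leaf) ltac:(lra) ltac:(inside2) ltac:(apply: padjV; lia).
have b3 := bounded_simple (c := 3) (a := 4) (x := p i.+1) (y := p i) b2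
  ltac:(leaf) ltac:(lra) ltac:(inside2) ltac:(rewrite cadj_sym; apply: padj;
    lia).
have b4 := bounded_simple (c := 2) (a := 3) (x := p i.-2) (y := p i.-1) b3
  ltac:(leaf) ltac:(lra) ltac:(inside2) ltac:(apply: (padjV (a := i.-1)); lia).
have b5 := bounded_simple (c := 2) (a := 3) (x := p i.+2) (y := p i.+1) b4
  ltac:(leaf) ltac:(lra) ltac:(inside2) ltac:(rewrite cadj_sym; apply: padj;
    lia).
have b6 := bounded_simple (c := 1) (a := 2) (x := p (i - 3)) (y := p i.-2) b5
  ltac:(leaf) ltac:(lra) ltac:(inside2)
  ltac:(rewrite (_ : i - 3 = i.-2.-1)%N; [apply: padjV|]; lia).
have b7 := bounded_simple (c := 1) (a := 2) (x := p i.+3) (y := p i.+2) b6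
  ltac:(leaf) ltac:(lra) ltac:(inside2) ltac:(rewrite cadj_sym; apply: padj;
    lia).
have b8 := bounded_simple (c := 2) (a := 4) (x := z) (y :=
  p i) b7 ltac:(leaf) ltac:(lra) ltac:(inside2) zi.
by apply: (bounded_absurd b8 (x := z) (a := 2));
  [inside2|rewrite pnatr_eq0|lra].
Qed.

End Fork.

(** * Type D_l with l even *)

Section SignParity.
Variables (R : realType) (I : finType) (m : coxeter_matrix I).
Variables (k : nat) (h : nat -> I).
Hypothesis hinj : forall a b, (a <= k.+1)%N -> (b <= k.+1)%N -> a <> b ->
  h a != h b.
Hypothesis hcover : forall x, exists2 a, (a <= k.+1)%N & x = h a.
Hypothesis hadj : forall a b, (a <= k.+1)%N -> (b <= k.+1)%N ->
  cadj m (h a) (h b) <-> fork_adj k 1 a b.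
Hypothesis hlabel : forall x y, cadj m x y -> m x y = Some 3.
Hypothesis k2 : (2 <= k)%N.

Local Notation z := (h k.+1).

(* Up to scaling, the orthogonal frame on which a group of type D acts by
   permutations and even sign changes. *)
Fixpoint frame (j : nat) : {ffun I -> R} :=
  match j with
  | 0 => lin 1 (sroot R (h 0)) (-1) (sroot R z)
  | 1 => lin 1 (sroot R (h 0)) 1 (sroot R z)
  | j'.+1 => lin 1 (frame j') 2 (sroot R (h j'))
  end.

Lemma frameSS j : frame j.+2 = lin 1 (frame j.+1) 2 (sroot R (h j.+1)).
Proof. by []. Qed.

Lemma gram_adj a b : (a <= k.+1)%N -> (b <= k.+1)%N -> fork_adj k 1 a b ->
  gram R m (h a) (h b) = - 2^-1.
Proof.
move=> ak bk /hadj-/(_ ak bk) ab; rewrite /gram.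
by rewrite (negPf (cadj_neq ab)) (hlabel ab) cosl3.
Qed.

Lemma gram_nonadj a b : (a <= k.+1)%N -> (b <= k.+1)%N -> a <> b ->
  ~ fork_adj k 1 a b -> gram R m (h a) (h b) = 0.
Proof.
move=> ak bk ab nab; apply: gram_nadj; first exact: hinj.
by apply/negP => /hadj-/(_ ak bk).
Qed.

Lemma coroot_frame0 b : (b <= k.+1)%N -> coroot m (h b) (frame 0) =
  if b == 0 then 1 else if b == k.+1 then -1 else 0.
Proof.
move=> bk; rewrite coroot_lin !coroot_root; have [->|b0] := eqVneq b 0.
  by rewrite gramii gram_nonadj //; [lra|rewrite /fork_adj; lia].
have [->|bk1] := eqVneq b k.+1.
  by rewrite gramii gram_nonadj //; [lra|rewrite /fork_adj; lia].
have [->|b1] := eqVneq b 1.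
  by rewrite !gram_adj //; [lra|rewrite /fork_adj; lia..].
by rewrite !gram_nonadj //; [lra|rewrite /fork_adj; lia..].
Qed.

Lemma coroot_frame j b : (j <= k)%N -> (b <= k.+1)%N ->
  coroot m (h b) (frame j.+1) =
  if (b == 0) || (b == k.+1) then (j == 0)%:R
  else (j == b)%:R - (j.+1 == b)%:R.
Proof.
move=> jk bk; elim: j jk => [|j IHj] jk.
  rewrite coroot_lin !coroot_root; have [->|b0] := eqVneq b 0.
    by rewrite gramii gram_nonadj //=; [lra|rewrite /fork_adj; lia].
  have [->|bk1] := eqVneq b k.+1.
    by rewrite gramii gram_nonadj //=; [lra|rewrite /fork_adj; lia].
  have [->|b1] := eqVneq b 1.
    by rewrite !gram_adj //=; [lra|rewrite /fork_adj; lia..].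
  rewrite !gram_nonadj //=; [|rewrite /fork_adj; lia..].
  lra.
rewrite frameSS coroot_lin coroot_root IHj; last by lia.
have [b00|b0] := eqVneq b 0.
  rewrite b00 /=; case: j jk {IHj} => [|j] jk.
    rewrite gram_adj; try (rewrite ?/fork_adj; lia); rewrite /=; lra.
  rewrite gram_nonadj; try (rewrite ?/fork_adj; lia); rewrite /=; lra.
have [bz|bk1] := eqVneq b k.+1.
  rewrite bz /=; case: j jk {IHj} => [|j] jk.
    rewrite gram_adj; try (rewrite ?/fork_adj; lia); rewrite /=; lra.
  rewrite gram_nonadj; try (rewrite ?/fork_adj; lia); rewrite /=; lra.
rewrite /=; have [bj|bj] := eqVneq j.+1 b.
  rewrite -bj gramii (_ : j == j.+1 = false); last by lia.
  rewrite (_ : j.+2 == j.+1 = false); last by lia.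
  rewrite /=; lra.
have [bj1|bj1] := eqVneq j b.
  rewrite gram_adj; try (rewrite ?/fork_adj; lia).
  rewrite (_ : j.+2 == b = false); last by lia.
  rewrite /=; lra.
have [bj2|bj2] := eqVneq j.+2 b.
  rewrite gram_adj; try (rewrite ?/fork_adj; lia); rewrite /=; lra.
rewrite gram_nonadj; try (rewrite ?/fork_adj; lia); rewrite /=; lra.
Qed.

(** All frame vectors have the same coordinate 1 at [h 0], so this coordinate of plus or minus any
    frame vector is its sign. *)
Lemma frame_coord0 j : (j <= k.+1)%N -> frame j (h 0) = 1.
Proof.
have z0 : (h 0 == z) = false by apply/negbTE/hinj.
elim: j => [|j IHj] jk; first by rewrite !ffunE eqxx z0 mulr0 addr0 mulr1.
case: j IHj jk => [|j] IHj jk; first by rewrite !ffunE eqxx z0 mulr0 addr0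
  mulr1.
have n0 : h 0 != h j.+1 by apply: hinj; lia.
rewrite frameSS ffunE IHj 1?ltnW // ffunE (negPf n0) /=; lra.
Qed.

Definition signed (b : bool) (v : {ffun I -> R}) := lin ((-1) ^+ b) v 0 v.

Lemma refl_frame x : exists (s : {perm 'I_k.+2}) (t : pred 'I_k.+2),
  \big[addb/false]_j t j = false /\
  forall j : 'I_k.+2, refl m x (frame j) = signed (t j) (frame (s j)).
Proof.
have fixed (b c d : nat) : (b <= k.+1)%N ->
  forall j : 'I_k.+2, coroot m (h b) (frame j) = 0 ->
    refl m (h b) (frame j) = signed false (frame j).
  move=> bk j cj; rewrite reflE cj; apply/ffunP => y; rewrite !ffunE; lra.
have [b bk ->] := hcover x.
have [->|b0] := posnP b.
  (* The root of [h 0] is half the sum of the frame vectors 0 and 1, so its reflection exchanges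
     them with two sign changes. The other simple roots are half differences, whose reflections are
     plain transpositions. *)
  exists (tperm ord0 (inord 1)), [pred j | (j == ord0) || (j == inord 1)].
  have i1 : nat_of_ord (inord 1 : 'I_k.+2) = 1%N by rewrite inordK.
  split.
    have n01 : ord0 != inord 1 :> 'I_k.+2 by rewrite -val_eqE /= i1.
    rewrite (bigD1 ord0) //= (bigD1 (inord 1)) 1?eq_sym //= !eqxx orbT.
    by rewrite big1 // => j /andP[/negPf -> /negPf ->].
  move=> j; have [->|j0] := eqVneq j ord0.
    rewrite tpermL i1 /= reflE coroot_frame0 //=.
    by apply/ffunP => y; rewrite !ffunE; ring.
  have [->|j1] := eqVneq j (inord 1).
    rewrite tpermR /= i1 reflE coroot_frame //= eqxx orbT.
    by apply/ffunP => y; rewrite !ffunE; ring.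
  rewrite tpermD 1?eq_sym //= (negPf j0) (negPf j1); apply: fixed => //.
  case: j j0 j1 => [[|[|j]] jk] //=; rewrite -!val_eqE /= ?i1 // => _ _.
  by rewrite (coroot_frame (j := j.+1)) //=; lia.
have [->|bk1] := eqVneq b k.+1.
  exists (tperm ord0 (inord 1)), pred0.
  have i1 : nat_of_ord (inord 1 : 'I_k.+2) = 1%N by rewrite inordK.
  split; first by rewrite big1.
  move=> j; have [->|j0] := eqVneq j ord0.
    rewrite tpermL i1 reflE coroot_frame0 // eqxx /=.
    by apply/ffunP => y; rewrite !ffunE; ring.
  have [->|j1] := eqVneq j (inord 1).
    rewrite tpermR i1 reflE coroot_frame // eqxx orbT /=.
    by apply/ffunP => y; rewrite !ffunE; ring.
  rewrite tpermD 1?eq_sym //=; apply: fixed => //.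
  case: j j0 j1 => [[|[|j]] jk] //=; rewrite -!val_eqE /= ?i1 // => _ _.
  by rewrite (coroot_frame (j := j.+1)) ?eqxx ?orbT //=; lia.
have bk' : (b <= k)%N by lia.
have ib : nat_of_ord (inord b : 'I_k.+2) = b by rewrite inordK.
have ib1 : nat_of_ord (inord b.+1 : 'I_k.+2) = b.+1 by rewrite inordK.
exists (tperm (inord b) (inord b.+1)), pred0.
split; first by rewrite big1.
have bz : (b == 0) || (b == k.+1) = false by lia.
move=> j; have [->|j0] := eqVneq j (inord b).
  rewrite tpermL ib ib1 reflE; case: b b0 bk bk' bz {bk1 ib ib1 j} =>
    // b _ bk bk' bz.
  rewrite coroot_frame ?bz //; try lia.
  rewrite eqxx (_ : b == b.+1 = false) /=; last by lia.
  by apply/ffunP => y; rewrite !ffunE; ring.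
have [->|j1] := eqVneq j (inord b.+1).
  rewrite tpermR ib ib1 reflE coroot_frame ?bz // eqxx (_ : b.+1 == b = false);
    last by lia.
  case: b b0 {bk bk' bz bk1 ib ib1 j j0} => // b _.
  by apply/ffunP => y; rewrite frameSS !ffunE /=; ring.
rewrite tpermD 1?eq_sym //=; apply: fixed => //.
move: j0 j1; rewrite -!val_eqE /= ib ib1; case: j => [[|j] jk] /= j0 j1.
  by rewrite coroot_frame0 //; move: bz; case: ifP => // _; case: ifP.
rewrite coroot_frame ?bz //; try lia.
have jb : j == b = false by lia.
by rewrite (negPf j0) jb subr0.
Qed.

Lemma act_frame s : exists (q : {perm 'I_k.+2}) (t : 'I_k.+2 -> bool),
  \big[addb/false]_j t j = false /\
  forall j : 'I_k.+2, act m s (frame j) = signed (t j) (frame (q j)).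
Proof.
elim: s => [|x s [q [t [tE st]]]].
  exists 1%g, pred0; split=> [|j]; first by rewrite big1.
  by rewrite perm1; apply/ffunP => y; rewrite !ffunE /=; ring.
have [q' [t' [t'E xt]]] := refl_frame x.
exists (q * q')%g, (fun j => t j (+) t' (q j)); split.
  by rewrite big_split /= tE /= -[RHS]t'E [RHS](reindex_inj (@perm_inj _ q)).
move=> j; rewrite permM [LHS]/= st /signed refl_lin xt /signed.
apply/ffunP => y; rewrite !ffunE signr_addb; ring.
Qed.

Lemma big_addb_neq0 n : \big[addb/false]_(j < n.+1) (j != ord0) = odd n.
Proof.
rewrite big_ord_recl /=; elim: n => [|n IHn]; first by rewrite big_ord0.
by rewrite big_ord_recr /= -IHn /= addbT; congr (~~ _).
Qed.

(** w fixes the frame vector 0, since the exchange of [h 0] and [h k.+1] compensates the sign, and w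
    makes k + 1 sign changes on the others; their number is even. *)
Lemma swap_parity (w : seq I) (e : I -> I) :
  (forall i, act m w (sroot R i) = - sroot R (e i)) ->
  e (h 0) = z -> e z = h 0 -> (forall a, (0 < a <= k)%N -> e (h a) = h a) ->
    odd k.
Proof.
move=> we e0 ez ea; have [q [t [tE wt]]] := act_frame w.
have z0 : (h 0 == z) = false by apply/negbTE/hinj.
have tj (j : 'I_k.+2) : act m w (frame j) (h 0) = (-1) ^+ t j.
  by rewrite wt ffunE frame_coord0 ?mul0r ?addr0 ?mulr1 // -ltnS.
have neg j : (j <= k)%N -> act m w (frame j.+1) (h 0) = -1.
  elim: j => [|j IHj] jk.
    by rewrite act_lin !we e0 ez !ffunE eqxx z0 /=; ring.
  have n0 : h 0 != h j.+1 by apply: hinj; lia.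
  rewrite frameSS act_lin we ea ?jk // ffunE IHj 1?ltnW // !ffunE (negPf n0)
    /=; lra.
have tE' (j : 'I_k.+2) : t j = (j != ord0).
  move: (tj j); case: j => [[|j] jk].
    rewrite [act _ _ _]act_lin !we e0 ez !ffunE eqxx z0 /= => te.
    by apply/negbTE/negP => tt; move: te; rewrite tt expr1; lra.
  rewrite neg // -val_eqE /=; case: (t _) => //= te; exfalso; move: te.
  by rewrite expr0; lra.
move: tE; under eq_bigr => j _ do rewrite tE'.
by rewrite big_addb_neq0 /= => /negbFE.
Qed.

End SignParity.

(** * Classification *)

Definition cox_type (I : finType) (m : coxeter_matrix I) (n : nat)
    (M : nat -> nat -> label) : Prop :=
  exists h : 'I_n -> I, [/\ injective h, forall x, exists i, x = h i &
    forall i j : 'I_n, i != j -> m (h i) (h j) = M i j].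

Definition cox_admissible (I : finType) (m : coxeter_matrix I) : Prop :=
  [\/ exists2 l, (2 <= l)%N & cox_type m l coxeter_A,
      exists2 l, (5 <= l)%N && odd l & cox_type m l (coxeter_D l),
      cox_type m 6 coxeter_E6 |
      exists2 p, (5 <= p)%N && odd p & cox_type m 2 (coxeter_I2 p)].

Section Labels.
Variables (I : finType) (m : coxeter_matrix I).

Lemma label3 x y : cadj m x y -> ~ heavy m x y -> m x y = Some 3.
Proof.
move=> xy nh; have := cadj_label xy; have xy' := cadj_neq xy.
move: nh; rewrite /heavy /= xy' /=; case: (m x y) => [[|[|[|[|n]]]]|] //=.
Qed.

Lemma label2 x y : x != y -> ~~ cadj m x y -> m x y = Some 2.
Proof. by move=> xy; rewrite /cadj /= xy /= negbK => /eqP. Qed.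

Lemma cox_type_of_nat n (M : nat -> nat -> label) (h : nat -> I) :
  (forall a b, (a < n)%N -> (b < n)%N -> h a = h b -> a = b) ->
  (forall x, exists2 a, (a < n)%N & x = h a) ->
  (forall a b, (a < n)%N -> (b < n)%N -> a <> b -> m (h a) (h b) = M a b) ->
  cox_type m n M.
Proof.
move=> hinj hcover hM; exists (fun i : 'I_n => h i); split.
- by move=> i j /hinj h'; apply/val_inj/h'.
- by move=> x; have [a an ->] := hcover x; exists (Ordinal an).
- by move=> i j ij; apply: hM => //; apply/eqP.
Qed.

Lemma connect_boundary (P : pred I) x y : connect (cadj m) x y -> P x ->
  ~~ P y ->
  exists a b, [/\ P a, ~~ P b & cadj m a b].
Proof.
move=> /connectP[s + ->]; elim: s x => [|z s IHs] x /=.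
  by move=> _ Px; rewrite Px.
move=> /andP[xz zs] Px Py; have [Pz|Pz] := boolP (P z);
  first exact: IHs zs Pz Py.
by exists x, z.
Qed.

Definition is_path (p : nat -> I) k :=
  (forall a b, (a <= k)%N -> (b <= k)%N -> p a = p b -> a = b) /\
  (forall a, (a < k)%N -> cadj m (p a) (p a.+1)).

Lemma longest_path (x0 : I) : exists p k, is_path p k /\
  forall q n, is_path q n -> (n <= k)%N.
Proof.
pose P n := `[< exists p, is_path p n >].
have P0 : exists n, P n.
  exists 0; apply/asboolP; exists (fun=> x0); split=> // a b.
  by rewrite !leqn0 => /eqP -> /eqP ->.
have Pb n : P n -> (n <= #|I|)%N.
  move=> /asboolP[p [pinj _]]; apply: ltnW.
  rewrite -[n.+1]card_ord; apply: (@leq_card _ _ (fun i : 'I_n.+1 => p i)).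
  by move=> i j /pinj h; apply/val_inj/h; rewrite -ltnS.
case: (ex_maxnP P0 Pb) => k /asboolP[p pk] kmax; exists p, k; split=> // q n qn.
by apply: kmax; apply/asboolP; exists q.
Qed.

Lemma is_path_rev p k : is_path p k -> is_path (fun a => p (k - a)%N) k.
Proof.
move=> [pinj padj]; split=> [a b ak bk /pinj h|a ak]; first by have :=
  h ltac:(lia) ltac:(lia); lia.
by rewrite cadj_sym (_ : k - a = (k - a.+1).+1)%N; [apply: padj|]; lia.
Qed.

Lemma is_path_cons x p k : is_path p k -> (forall a, (a <= k)%N -> x != p a) ->
  cadj m x (p 0) -> is_path (fun a => if a is b.+1 then p b else x) k.+1.
Proof.
move=> [pinj padj] xp x0; split.
  move=> [|a] [|b] //= ak bk; last by move=> /pinj ->.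
    by move=> xe; have := xp b bk; rewrite xe eqxx.
  by move=> xe; have := xp a ak; rewrite xe eqxx.
by case=> [|a] //= ak; exact: padj.
Qed.

Lemma is_path_shift p k i : is_path p k -> (i <= k)%N ->
  is_path (fun a => p (i + a)%N) (k - i).
Proof.
move=> [pinj padj] ik; split=> [a b ak bk /pinj h|a ak].
  by have := h ltac:(lia) ltac:(lia); lia.
by rewrite addnS; apply: padj; lia.
Qed.

End Labels.

Section Classification.
Variables (R : realType) (I : finType) (m : coxeter_matrix I).
Local Notation vec := {ffun I -> R}.
Variables (w : seq I) (e : I -> I).
Hypothesis we : forall i, act m w (sroot R i) = - sroot R (e i).
Hypothesis conn : forall i j, connect (cadj m) i j.

Let pos (v : vec) i : nneg v -> v i != 0 -> 0 < cform m v v :=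
  @cform_gt0 R I m w e we conn v i.

Let r := cox_realizes m [set: I].
Let x := (\prod_(k <- w) cox_gen m k)%g.
Let ox : over (cox_gen m) [set: I] x := cox_over x.

Let rho_x i : i \in [set: I] ->
  e i \in [set: I] /\ rho (fun y => y) x (sroot R i) = - sroot R (e i).
Proof. by move=> _; split; rewrite ?inE // (rho_word r) // => j; rewrite inE.
  Qed.

Lemma epsK i : e (e i) = i.
Proof. by apply: (oppositeK r ox rho_x); rewrite inE. Qed.

Lemma eps_inj : injective e.
Proof. exact: can_inj epsK. Qed.

Lemma eps_conj i : (x * cox_gen m i = cox_gen m (e i) * x)%g.
Proof. by apply: (opposite_conj r ox rho_x); rewrite inE. Qed.

Lemma eps_gram i j : gram R m (e i) (e j) = gram R m i j.
Proof. by apply: (opposite_gram rho_x); rewrite inE. Qed.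

Lemma eps_label i j : i != j -> m (e i) (e j) = m i j.
Proof.
move=> ij; have eij : e i != e j by apply: contraNneq ij => /eps_inj ->.
apply: (label_inj (R := R)) (cox_label_ge2 _ _ _) (cox_label_ge2 _ _ _) _.
by have := eps_gram i j; rewrite /gram (negPf ij) (negPf eij) => /oppr_inj.
Qed.

Lemma eps_cadj i j : cadj m (e i) (e j) = cadj m i j.
Proof.
rewrite /cadj /=; have [->|ij] := eqVneq i j; first by rewrite eqxx.
by rewrite eps_label // (inj_eq eps_inj) ij.
Qed.

Lemma eps_heavy i j : heavy m (e i) (e j) = heavy m i j.
Proof.
rewrite /heavy /=; have [->|ij] := eqVneq i j; first by rewrite eqxx.
by rewrite eps_label // (inj_eq eps_inj) ij.
Qed.

Lemma nat_automorphism n (h : nat -> I) :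
  (forall a b, (a < n)%N -> (b < n)%N -> h a = h b -> a = b) ->
  (forall y, exists2 a, (a < n)%N & y = h a) ->
  exists E, forall a, (a < n)%N -> (E a < n)%N /\ e (h a) = h (E a).
Proof.
move=> hinj hcover.
have /choice[E hE] : forall a, exists b, (a < n)%N -> (b < n)%N /\
  e (h a) = h b.
  by move=> a; have [b bn eb] := hcover (e (h a)); exists b.
by exists E.
Qed.

Variable x0 : I.
Hypothesis ex0 : e x0 <> x0.

(* The opposition e reverses the path, so a heavy edge is the middle one; an
   even label is impossible because e x is conjugate to x, while the parity of
   the letters on one side of that edge is invariant under conjugation. *)
Lemma path_admissible p k : is_path m p k ->
  (forall y, exists2 a, (a <= k)%N & y = p a) -> cox_admissible m.
Proof.
move=> [pinj padj] cover.
have [E EP] : exists E, forall a, (a < k.+1)%N -> (E a < k.+1)%N /\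
  e (p a) = p (E a).
  by apply: nat_automorphism => // a b; rewrite !ltnS; exact: pinj.
have Ek a : (a <= k)%N -> (E a <= k)%N by move=> ak; have [] := EP a ak.
have eE a : (a <= k)%N -> e (p a) = p (E a) by move=> ak; have [] := EP a ak.
have Einj a b : (a <= k)%N -> (b <= k)%N -> a <> b -> E a <> E b.
  move=> ak bk ab Eab; apply: ab; apply: pinj => //.
  by apply: eps_inj; rewrite !eE // Eab.
have adj a b (ak : (a <= k)%N) (bk : (b <= k)%N) :=
  path_cadj pos pinj padj ak bk.
have Eadj a : (a < k)%N -> E a.+1 = (E a).+1 \/ E a = (E a.+1).+1.
  move=> ak; have := padj a ak; rewrite -eps_cadj !eE ?adj ?Ek //; try lia.
have not_id : ~ forall a, (a <= k)%N -> E a = a.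
  by move=> id; have [a ak xa] := cover x0; apply: ex0; rewrite xa eE // id.
have k1 : (0 < k)%N.
  rewrite lt0n; apply/negP => /eqP k0; apply: not_id => a ak.
  by have := Ek a ak; move: ak; rewrite k0; lia.
have [[a ak ha]|no_heavy] := pselect (exists2 a,
  (a < k)%N & heavy m (p a) (p a.+1)); last first.
  constructor 1; exists k.+1 => //; apply: (cox_type_of_nat (h :=
    p)) => // [a b ak bk ab].
  have pab : p a != p b by apply/eqP => /pinj; lia.
  have aj := adj a b ak bk; rewrite /coxeter_A /simply_laced /=.
  case: ifP => c.
    apply: label3; first by rewrite aj; lia.
    move=> hab; apply: no_heavy; case/orP: c => /eqP c.
      by exists a; [lia|rewrite -c].
    by exists b; [lia|rewrite -c heavy_sym].
  by apply: label2 => //; rewrite aj; lia.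
have heavy_eq b : (b < k)%N -> heavy m (p b) (p b.+1) -> b = a.
  move=> bk hb; case: (ltngtP a b) => // ab; exfalso.
    exact: (one_heavy pos pinj padj ab bk).
  exact: (one_heavy pos pinj padj ab ak).
have [Ea Ea1] : E a = a.+1 /\ E a.+1 = a.
  have := ha; rewrite -eps_heavy !eE // => [h|]; last by lia.
  case: (Eadj a ak) => c.
    have Eaa : E a = a by apply: heavy_eq; [have := Ek a.+1 ak; lia|rewrite -c].
    case: not_id; apply: (path_automorphism_id (c := a)) => //.
    by rewrite c Eaa.
  have Eaa : E a.+1 = a by apply: heavy_eq; [have := Ek a;
    lia|rewrite -c heavy_sym].
  by rewrite c Eaa.
have pa1 : p a != p a.+1 by apply/eqP => /pinj; lia.
(* With an infinite label, weights 1 and 1 would have norm at most 1 + 1 - 2 = 0. *)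
case mE : (m (p a) (p a.+1)) => [n|]; last first.
  exfalso; have b0 := bounded_nil R m.
  have b1 := bounded_isolated (x := p a) (c := 1) b0 isT ler01.
  have /(bounded_leaf b1)/(_ ler01) : p a.+1 \notin [seq q.1 | q <- [:: (p a,
    1 : R)]].
    by rewrite inE eq_sym.
  have g1 : gram R m (p a.+1) (p a) <= - 1.
    by rewrite /gram eq_sym (negPf pa1) cox_label_sym mE.
  move=> /(_ (p a) 1 1 (mem_head _ _) g1) b2.
  by apply: (bounded_absurd pos b2 (mem_head _ _)); [exact: oner_neq0|lra].
have n4 : (4 <= n)%N by move: ha; rewrite /heavy /= mE => /andP[].
have n_odd : odd n.
  apply: contraT => en; exfalso.
  pose S := [set y | `[< exists2 b, (b <= a)%N & y = p b >]].
  have inS b : (b <= k)%N -> (p b \in S) = (b <= a)%N.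
    move=> bk; rewrite inE; apply/asboolP/idP => [[c ca /pinj h]|ba];
      last by exists b.
    by rewrite h //; lia.
  suff : (p a \in S) = (e (p a) \in S) by rewrite eE 1?ltnW // Ea !inS //; lia.
  apply: (@conj_gen_parity I m S _ x); last exact: eps_conj.
  move=> y y' l; have [b bk ->] := cover y; have [b' bk' ->] := cover y'.
  rewrite !inS // => ba ab'.
  have [e1|ne] := eqVneq b' b.+1.
    have {ba ab'} ba : b = a by lia.
    by rewrite e1 ba mE => -[<-].
  rewrite label2 => [[<-] //||]; first by apply/eqP => /pinj; lia.
  by rewrite adj //; lia.
have n5 : (5 <= n)%N by move: n4 n_odd; rewrite leq_eqVlt => /orP[/eqP <-|].
constructor 4; exists n; first by rewrite n5.
have [k11|k1'] := eqVneq k 1.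
  have a0 : a = 0 by lia.
  rewrite a0 k11 in ak mE cover pinj *.
  apply: (cox_type_of_nat (h := p)) => // [[|[|b]] [|[|c]]] //= _ _ _;
    rewrite /coxeter_I2 //.
  by rewrite cox_label_sym.
(* The opposition exchanges the ends of the heavy edge, so a further edge on one side has a
   counterpart on the other. The weights 1/2, 1, 1, 1/2 then give at most 2 - 2 * 3/4 - 1/4 - 1/4 =
   0. *)
exfalso; have [a0 ak2] : (0 < a)%N /\ (a.+2 <= k)%N.
  case: (posnP a) => [a0|a0].
    have := Eadj a.+1 ltac:(lia); have :=
      Einj a a.+2 ltac:(lia) ltac:(lia) ltac:(lia); lia.
  have := Eadj a.-1 ltac:(lia); rewrite prednK // => ad.
  have := Einj a.-1 a.+1 ltac:(lia) ltac:(lia) ltac:(lia).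
  have := Ek a.-1 ltac:(lia); split=> //; lia.
have g34 : gram R m (p a.+1) (p a) <= - (3 / 4).
  rewrite /gram eq_sym (negPf pa1) cox_label_sym mE lerN2.
  apply: le_trans (cosl5 R) _; exact: cosl_le.
have b0 := bounded_nil R m.
have b1 := bounded_isolated (x := p a) (c := 1) b0 isT ler01.
have ne b c : (b <= k)%N -> (c <= k)%N -> b <> c -> p b != p c by exact: p_neq.
have b2 := bounded_leaf (x := p a.+1) (y := p a) (c := 1) (a := 1) b1
  ltac:(by rewrite inE; apply: ne; lia) ler01 (mem_head _ _) g34.
have b3 := bounded_light (x := p a.-1) (y := p a) b2
  ltac:(by rewrite !inE negb_or; apply/andP; split; apply: ne; lia)
  ltac:(by rewrite in_cons mem_head orbT) ltac:(by rewrite adj; lia).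
have b4 := bounded_light (x := p a.+2) (y := p a.+1) b3
  ltac:(by rewrite !inE !negb_or; do ?[apply/andP; split]; apply: ne; lia)
  ltac:(by rewrite in_cons mem_head orbT) ltac:(by rewrite adj; lia).
apply: (bounded_absurd pos b4 (x := p a.+1) (a := 1)); last by lra.
  by rewrite in_cons in_cons mem_head !orbT.
exact: oner_neq0.
Qed.

Definition is_fork (h : nat -> I) k i :=
  [/\ forall a b, (a <= k.+1)%N -> (b <= k.+1)%N -> a <> b -> h a != h b,
      forall y, exists2 a, (a <= k.+1)%N & y = h a,
      forall a b, (a <= k.+1)%N -> (b <= k.+1)%N ->
        cadj m (h a) (h b) <-> fork_adj k i a b &
      forall y y', cadj m y y' -> m y y' = Some 3].

Lemma path_end q k y j : is_path m q k -> (forall p n, is_path m p n ->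
  (n <= k)%N) ->
  (forall a, (a <= k)%N -> y != q a) -> (j <= k)%N -> cadj m y (q j) ->
    (0 < j < k)%N.
Proof.
move=> qk kmax yq jk yj; apply/andP; split; rewrite ltnNge; apply/negP => h.
  have j0 : j = 0 by apply/eqP; rewrite -leqn0.
  by rewrite j0 in yj; have := kmax _ _ (is_path_cons qk yq yj); rewrite ltnn.
have jk' : j = k by apply/eqP; rewrite eqn_leq jk.
have yq' a : (a <= k)%N -> y != q (k - a)%N by move=> ak; apply: yq;
  exact: leq_subr.
have yk : cadj m y (q (k - 0)%N) by rewrite subn0 -jk'.
by have := kmax _ _ (is_path_cons (is_path_rev qk) yq' yk); rewrite ltnn.
Qed.

(** Otherwise z', z, q i, ..., q k is a path longer than the longest one. *)
Lemma short_branch q k i z z' : is_path m q k ->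
  (forall p n, is_path m p n -> (n <= k)%N) ->
  (i <= k)%N -> (forall a, (a <= k)%N -> z != q a) ->
    (forall a, (a <= k)%N -> z' != q a) ->
  z' != z -> cadj m z (q i) -> cadj m z' z -> (2 <= i)%N.
Proof.
move=> qk kmax ik zq z'q zz' zi z'z; have qi := is_path_shift qk ik.
have le a : (a <= k - i)%N -> (i + a <= k)%N by lia.
have z1 a : (a <= k - i)%N -> z != q (i + a)%N by move=> /le; exact: zq.
have z0 : cadj m z (q (i + 0)%N) by rewrite addn0.
have qz := is_path_cons qi z1 z0.
have z2 a : (a <= (k - i).+1)%N -> z' != (if a is b.+1 then q (i + b)%N else z).
  by case: a => // a /le; exact: z'q.
by have := kmax _ _ (is_path_cons qz z2 z'z); move: ik; clear; lia.
Qed.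

Section Fork.
Variables (p : nat -> I) (k i : nat) (z : I).
Hypothesis pk : is_path m p k.
Hypothesis kmax : forall q n, is_path m q n -> (n <= k)%N.
Hypothesis zp : forall a, (a <= k)%N -> z != p a.
Hypothesis ik : (0 < i < k)%N.
Hypothesis zi : cadj m z (p i).

(** By connectedness a further vertex would be attached to the path, giving affine D, or to z, where
    maximality of the path in both directions makes both its arms long enough for affine E_6. *)
Lemma fork_cover y : (exists2 a, (a <= k)%N & y = p a) \/ y = z.
Proof.
have [pinj padj] := pk; apply: contrapT => ny.
pose P := [pred v | `[< (exists2 a, (a <= k)%N & v = p a) \/ v = z >]].
have Pz : P z by apply/asboolP; right.
have nPy : ~~ P y by apply/asboolP.
have [u [z' [/asboolP Pu /asboolP Pz' uz']]] :=
  connect_boundary (conn z y) Pz nPy.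
have z'p a : (a <= k)%N -> z' != p a.
  by move=> ak; apply/eqP => z'e; apply: Pz'; left; exists a.
have zz' : z' != z by apply/eqP => z'e; apply: Pz'; right.
move: uz'; rewrite cadj_sym => z'u; case: Pu z'u => [[j jk ->]|->] z'u.
  apply: (fork_second pos pinj padj zp ik zi z'p zz' (j := j)) => //.
  exact: (path_end pk kmax z'p).
have ik' : (i <= k)%N by case/andP: ik => _ /ltnW.
apply: (fork_extended pos pinj padj zp ik zi z'p zz') => //.
  exact: short_branch pk kmax ik' zp z'p zz' zi z'u.
have rp a : (a <= k)%N -> z != p (k - a)%N by move=> _; apply: zp;
  exact: leq_subr.
have rp' a : (a <= k)%N -> z' != p (k - a)%N by move=> _; apply: z'p;
  exact: leq_subr.
have zi' : cadj m z (p (k - (k - i))%N) by rewrite subKn.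
have := short_branch (is_path_rev pk) kmax (leq_subr _ _) rp rp' zz' zi' z'u.
by move: ik'; clear; lia.
Qed.

Lemma fork_of_path : is_fork (fun a => if (a <= k)%N then p a else z) k i.
Proof.
have [pinj padj] := pk; pose h a := if (a <= k)%N then p a else z.
have hp a : (a <= k)%N -> h a = p a by rewrite /h => ->.
have hz : h k.+1 = z by rewrite /h ltnn.
have zadj a : (a <= k)%N -> cadj m z (p a) = (a == i).
  move=> ak; apply/idP/eqP => [|->] //.
  exact: (fork_neighbor pos pinj padj zp ik zi).
have top a : (a <= k.+1)%N -> (a <= k)%N = false -> a = k.+1 by clear; lia.
have hcover y : exists2 a, (a <= k.+1)%N & y = h a.
  have [[a ak ->]| ->] := fork_cover y; last by exists k.+1.
  by exists a; [exact: leqW|rewrite hp].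
have hadj a b : (a <= k.+1)%N -> (b <= k.+1)%N ->
    cadj m (h a) (h b) <-> fork_adj k i a b.
  move=> ak bk; rewrite /h; case: ifP => ha; case: ifP => hb.
  - by rewrite (path_cadj pos pinj padj) // /fork_adj; move: ha hb; clear; lia.
  - rewrite cadj_sym zadj // (top b bk hb) /fork_adj; move: ha ik; clear.
    by case: eqVneq => [->|]; lia.
  - rewrite zadj // (top a ak ha) /fork_adj; move: hb ik; clear.
    by case: eqVneq => [->|]; lia.
  - rewrite (top a ak ha) (top b bk hb) /cadj /= eqxx /fork_adj.
    by move: ik; clear; lia.
split=> // [a b ak bk ab|y y' yy'].
  rewrite /h; case: ifP => ha; case: ifP => hb.
  - by apply: (p_neq pinj).
  - by rewrite eq_sym zp.
  - exact: zp.
  - by case: ab; rewrite (top a ak ha) (top b bk hb).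
apply: label3 => //; have [a ak ya] := hcover y; have [b bk yb] := hcover y'.
have /hadj-/(_ ak bk) fab : cadj m (h a) (h b) by rewrite -ya -yb.
have nh c : (c < k)%N -> ~ heavy m (p c) (p c.+1).
  exact: (fork_no_heavy pos pinj padj zp ik zi).
have nz : ~ heavy m z (p i) by exact: (fork_no_heavy_z pos pinj padj zp ik zi).
have ik' : (i <= k)%N by case/andP: ik => _ /ltnW.
rewrite ya yb; case: fab => [[-> bk']|[[-> ak']|[[-> ->]|[-> ->]]]].
- by rewrite !hp //; [exact: nh|exact: ltnW].
- by rewrite heavy_sym !hp //; [exact: nh|exact: ltnW].
- by rewrite heavy_sym hz hp.
- by rewrite hz hp.
Qed.

End Fork.

Section ForkTypes.
Variables (h : nat -> I) (k i : nat).
Hypothesis hk : is_fork h k i.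

Lemma fork_inj a b : (a < k.+2)%N -> (b < k.+2)%N -> h a = h b -> a = b.
Proof.
have [hneq _ _ _] := hk => ak bk hab; apply/eqP/negPn/negP => /eqP ab.
by have := hneq a b ak bk ab; rewrite hab eqxx.
Qed.

Lemma fork_label2 a b : (a <= k.+1)%N -> (b <= k.+1)%N -> a <> b ->
  ~ fork_adj k i a b -> m (h a) (h b) = Some 2.
Proof.
have [hneq _ hadj _] := hk => ak bk ab nf; apply: label2; first exact: hneq.
by apply/negP => /hadj-/(_ ak bk).
Qed.

Lemma fork_label3 a b : (a <= k.+1)%N -> (b <= k.+1)%N ->
  fork_adj k i a b -> m (h a) (h b) = Some 3.
Proof. by have [_ _ hadj hlabel] := hk => ak bk /(hadj a b ak bk);
  exact: hlabel. Qed.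

Lemma fork_opposition : exists E,
  [/\ forall a, (a <= k.+1)%N -> (E a <= k.+1)%N /\ e (h a) = h (E a),
      forall a b, (a <= k.+1)%N -> (b <= k.+1)%N -> a <> b -> E a <> E b,
      forall a b, (a <= k.+1)%N -> (b <= k.+1)%N ->
        fork_adj k i a b -> fork_adj k i (E a) (E b),
      forall a, (a <= k.+1)%N -> E (E a) = a &
      exists2 a, (a <= k.+1)%N & E a <> a].
Proof.
have [hneq hcover hadj _] := hk; have [E EP] :=
  nat_automorphism fork_inj hcover.
have Ek a : (a <= k.+1)%N -> (E a <= k.+1)%N by move=> ak; have [] := EP a ak.
have eE a : (a <= k.+1)%N -> e (h a) = h (E a) by move=> ak; have [] := EP a ak.
exists E; split=> //.
- move=> a b ak bk ab Eab; apply: ab; apply: fork_inj => //.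
  by apply: eps_inj; rewrite !eE // Eab.
- move=> a b ak bk /(hadj a b ak bk) hab; apply/hadj; rewrite ?Ek //.
  by rewrite -!eE // eps_cadj.
- by move=> a ak; apply: fork_inj; rewrite ?ltnS ?Ek // -!eE ?Ek // epsK.
have [a ak xa] := hcover x0; exists a => // Ea.
by apply: ex0; rewrite xa eE // Ea.
Qed.

End ForkTypes.

Lemma fork2_admissible h k : is_fork h k 2 -> (4 <= k)%N -> cox_admissible m.
Proof.
move=> hk; rewrite leq_eqVlt => /orP[/eqP k4|k5]; last first.
  have [E [_ Einj Eadj _ [a ak]]] := fork_opposition hk; case.
  exact: (fork2_automorphism_id Einj Eadj).
rewrite -{k}k4 in hk; have [_ hcover _ _] := hk; constructor 3.
apply: (cox_type_of_nat (h := h)) => [||a b ak bk ab] //;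
  first exact: fork_inj hk.
have [[f ->]|[f ->]] := coxeter_E6_fork ak bk.
  exact: (fork_label3 hk).
exact: (fork_label2 hk).
Qed.

Lemma fork_relabel h (s : nat -> nat) : is_fork h 2 1 ->
  (forall a, (a <= 3)%N -> (s a <= 3)%N /\ s (s a) = a) -> s 1 = 1 ->
  is_fork (h \o s) 2 1.
Proof.
move=> [hneq hcover hadj hlabel] ss s1.
have sk a ak := (ss a ak).1; have sK a ak := (ss a ak).2.
have s_1 c : (c <= 3)%N -> s c = 1 <-> c = 1.
  by move=> ck; split=> [sc|->] //; rewrite -(sK c ck) sc.
split=> //= [a b ak bk ab|y|a b ak bk].
- apply: hneq; rewrite ?sk // => sab; apply: ab.
  by rewrite -(sK a ak) sab sK.
- by have [a ak ->] := hcover y; exists (s a); [exact: sk|rewrite sK].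
by rewrite hadj ?sk // !fork_adj_star ?sk // !s_1.
Qed.

Lemma fork1_parity h k : is_fork h k 1 -> (2 <= k)%N -> odd k.
Proof.
move=> hk k2; have [E [EP Einj Eadj EE Ea]] := fork_opposition hk.
have Ek a : (a <= k.+1)%N -> (E a <= k.+1)%N by move=> ak; have [] := EP a ak.
have eE a : (a <= k.+1)%N -> e (h a) = h (E a) by move=> ak; have [] := EP a ak.
have [hneq hcover hadj hlabel] := hk.
have [E1 [[E0 Ez Ep]|[k22 EC]]] := fork1_automorphism Einj Eadj EE Ea k2.
  apply: (swap_parity hneq hcover hadj hlabel k2 we); rewrite ?eE ?E0 ?Ez //.
  by move=> a /andP[a1 ak]; rewrite eE ?Ep //; exact: leqW.
exfalso; rewrite {}k22 in hk k2 eE EE Ek {EP Einj Eadj Ea hneq hcover hadj}.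
(* In type D_4 any two leaves can be renamed 0 and 3, and [swap_parity] would make 2 odd. *)
have relabel (s : nat -> nat) : (forall a, (a <= 3)%N -> (s a <= 3)%N /\
  s (s a) = a) ->
    s 1 = 1 -> E (s 0) = s 3 -> E (s 3) = s 0 -> E (s 2) = s 2 -> False.
  move=> ss s1 Es0 Es3 Es2; have sk a ak := (ss a ak).1.
  have [hneq hcover hadj _] := fork_relabel hk ss s1.
  have two a : (0 < a <= 2)%N -> a = 1 \/ a = 2 by clear; lia.
  suff : odd 2 by [].
  apply: (swap_parity hneq hcover hadj hlabel k2 we) => /=.
  - by rewrite eE ?Es0 ?sk.
  - by rewrite eE ?Es3 ?sk.
  move=> a /two[->|->]; first by rewrite s1 eE // E1.
  by rewrite eE ?Es2 ?sk.
case: EC => [[E2 E0 E3]|[E2 E3 E0]].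
  apply: (relabel (fun a => if a == 2 then 3 else if a == 3 then 2 else a)) =>
    //.
  by case=> [|[|[|[|]]]].
apply: (relabel (fun a => if a == 0 then 2 else if a == 2 then 0 else a)) => //.
by case=> [|[|[|[|]]]].
Qed.

Lemma fork1_admissible h k : is_fork h k 1 -> (2 <= k)%N -> cox_admissible m.
Proof.
move=> hk k2; have odd_k := fork1_parity hk k2; have [_ hcover _ _] := hk.
constructor 2; exists k.+2.
  by rewrite /= negbK odd_k andbT; case: (k) k2 odd_k => [|[|[]]].
(* The path is reversed: [coxeter_D] attaches the extra vertex next to its last vertex, the fork
   next to its first. *)
pose s a := if (a <= k)%N then (k - a)%N else a.
have sk a : (a <= k.+1)%N -> (s a <= k.+1)%N.
  by rewrite /s; case: ifP => // _ _; rewrite leqW // leq_subr.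
have sK a : (a <= k.+1)%N -> s (s a) = a.
  by rewrite /s => _; case: (leqP a k) => ak;
    [rewrite leq_subr subKn|rewrite leqNgt ak].
apply: (cox_type_of_nat (h := h \o s)).
- move=> a b ak bk /= /(fork_inj hk) => h'.
  by rewrite -(sK a ak) h' ?sK ?ltnS ?sk.
- by move=> y; have [a ak ->] := hcover y; exists (s a);
    [exact: sk|rewrite /= sK].
move=> a b ak bk ab; have sab : s a <> s b.
  by move=> sab; apply: ab; rewrite -(sK a ak) sab sK.
have [[f ->]|[f ->]] := coxeter_D_fork k2 ak bk.
  by apply: (fork_label3 hk) f; exact: sk.
by apply: (fork_label2 hk) sab f; exact: sk.
Qed.

Lemma fork_admissible p k z i : is_path m p k ->
  (forall q n, is_path m q n -> (n <= k)%N) ->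
  (forall a, (a <= k)%N -> z != p a) -> (0 < i)%N -> (i + i <= k)%N ->
  cadj m z (p i) -> cox_admissible m.
Proof.
move=> pk kmax zp i0 iik zi; have [pinj padj] := pk.
have ik : (0 < i < k)%N by move: i0 iik; clear; lia.
have hk := fork_of_path pk kmax zp ik zi.
have [i3|i3] := leqP 3 i.
  case: (fork_long pos pinj padj zp ik zi) => //.
  by apply: leq_trans iik; rewrite leq_add2l.
case: i i0 i3 iik hk {zi ik} => [|[|[|i]]] // _ _ k2 hk.
  exact: fork1_admissible hk k2.
exact: fork2_admissible hk k2.
Qed.

Theorem classification : cox_admissible m.
Proof.
have [p [k [pk kmax]]] := longest_path m x0.
have [cover|] := pselect (forall y, exists2 a, (a <= k)%N & y = p a).
  exact: path_admissible pk cover.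
move=> /existsNP[y ny].
pose P := [pred v | `[< exists2 a, (a <= k)%N & v = p a >]].
have P0 : P (p 0) by apply/asboolP; exists 0.
have nPy : ~~ P y by apply/asboolP.
have [u [z [/asboolP[i ik ->] /asboolP nz]]] :=
  connect_boundary (conn (p 0) y) P0 nPy.
rewrite cadj_sym => zi.
have zp a : (a <= k)%N -> z != p a by move=> ak; apply/eqP => za; apply: nz;
  exists a.
have zp' a : (a <= k)%N -> z != p (k - a)%N by move=> ak; apply: zp; lia.
have nz0 : i <> 0.
  by move=> i0; rewrite i0 in zi; have := kmax _ _ (is_path_cons pk zp zi);
    rewrite ltnn.
have nzk : i <> k.
  move=> i0; have zk : cadj m z (p (k - 0)%N) by rewrite subn0 -i0.
  by have := kmax _ _ (is_path_cons (is_path_rev pk) zp' zk); rewrite ltnn.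
(* Up to reversing the path, z is attached in its first half. *)
have [ii|ii] := leqP (i + i) k.
  by apply: (fork_admissible pk kmax zp _ ii zi); lia.
apply: (fork_admissible (is_path_rev pk) kmax zp' (i := (k - i)%N)); try lia.
by rewrite subKn.
Qed.
End Classification.

(** * Conjugate sets of simple roots *)

Section FiniteParabolic.
Variables (R : realType) (I : finType) (m : coxeter_matrix I).
Local Notation vec := {ffun I -> R}.
Local Notation W := (cox_group m).
Local Notation overW K := (over (cox_gen m) K).
Local Notation lenW K := (len (cox_gen m) K).
Implicit Types (u y z : W) (i j : I) (K J A : {set I}).
Let r K := cox_realizes m K.

Definition cadj_in K : rel I := [rel i j | [&& i \in K, j \in K & cadj m i j]].

Lemma overW_sub K K' u : K \subset K' -> overW K u -> overW K' u.
Proof.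
by move=> sub [n [s [sK -> sn]]]; exists n, s; split=> // i /sK;
  exact: (subsetP sub).
Qed.

Lemma act_root_neq K u i k : overW K u -> k \notin K -> k != i ->
  cox_act u (sroot R i) k = 0.
Proof.
by move=> ou kK /negPf ki; rewrite -[cox_act _ _]/(rho (fun y =>
  y) u _) (rho_out (r K)) // ffunE ki.
Qed.

Variables (K : {set I}) (x : I).
Hypothesis xK : x \in K.
Hypothesis connK : forall k, k \in K -> connect (cadj_in K) x k.
Local Notation J := (K :\ x).

(* An element of W_J fixing the whole orbit fixes the span of the orbit, and
   connectedness propagates this from x to all of K. *)
Lemma fix_orbit_eq1 (O : seq vec) u : sroot R x \in O ->
  (forall j v, j \in J -> v \in O -> refl m j v \in O) ->
  overW J u -> (forall v, v \in O -> cox_act u v = v) -> u = 1%g.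
Proof.
move=> xO OJ ou uO.
suff fixK k : k \in K -> forall y, overW J y -> (forall v, v \in O ->
  cox_act y v = v) ->
    cox_act y (sroot R k) = sroot R k.
  apply: (nneg_eq1 (R := R) (r J)) => // j jJ.
  rewrite /rho (fixK j) //; first exact: nneg_root.
  by move: jJ; rewrite !inE => /andP[].
move=> /connK/connectP[p + ->] {k}; elim/last_ind: p => [_|p k IHp].
  by move=> y _; apply.
rewrite last_rcons rcons_path => /andP[/IHp {}IHp /and3P[lK kK lk]] y oy yO.
have [->|kx] := eqVneq k x; first exact: yO.
have kJ : k \in J by rewrite !inE kx.
set l := last x p in IHp lk.
have og : overW J (cox_gen m k) by exact: over_gen.
have H := IHp (cox_gen m k * y * cox_gen m k)%g ltac:(by do 2?apply: overM).
have {}H : refl m k (cox_act y (refl m k (sroot R l))) = sroot R l.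
  rewrite -!cox_act_gen -!cox_actM; apply: H => v vO.
  by rewrite !cox_actM !cox_act_gen yO ?reflK //; exact: OJ.
have {H} : cox_act y (refl m k (sroot R l)) = refl m k (sroot R l).
  by rewrite -{2}H reflK.
have kl : k != l by rewrite eq_sym (cadj_neq lk).
rewrite refl_root_neq // cox_act_lin (IHp y oy yO).
set c := cosl R _ => e.
have c0 : c != 0.
  apply: lt0r_neq0; apply: lt_le_trans (cosl_gt0 R (cadj_label _));
    first by lra.
  by rewrite cadj_sym.
apply/ffunP => a; have /ffunP/(_ a) := e; rewrite !ffunE !mul1r => /addIr h.
by move: h; apply: mulfI; rewrite mulf_neq0 // pnatr_eq0.
Qed.

(** By [fix_orbit_eq1] an element of W_J is determined by its action on the finite list O, recorded
    as a function between finite types; so W_J is finite and lengths in it are bounded. *)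
Lemma finite_orbit_longest (O : seq vec) : sroot R x \in O ->
  (forall j v, j \in J -> v \in O -> refl m j v \in O) ->
  exists2 w, overW J w & forall u, overW J u -> (lenW J u <= lenW J w)%N.
Proof.
move=> xO OJ; have actO u v : overW J u -> v \in O -> cox_act u v \in O.
  move=> [_ [s [sJ -> _]]] vO; rewrite -[cox_act _ _]/(rho (fun y =>
    y) _ v) (rho_word (r J)) //.
  elim: s sJ => //= i s IHs sJ; apply: OJ; first by apply: sJ; rewrite mem_head.
  by apply: IHs => j js; apply: sJ; rewrite inE js orbT.
pose code u : {ffun 'I_(size O) -> 'I_(size O).+1} :=
  [ffun i : 'I_(size O) => inord (index (cox_act u O`_i) O)].
have code_inj u u' : overW J u -> overW J u' -> code u = code u' -> u = u'.
  move=> ou ou' cuu'; suff e1 : (u'^-1 * u)%g = 1%g by rewrite -[u](mulVKg u')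
    e1 mulg1.
  apply: (fix_orbit_eq1 xO OJ) => [|v vO]; first by apply: overM => //;
    exact: (overV (r J)).
  have vi : (index v O < size O)%N by rewrite index_mem.
  have /ffunP/(_ (Ordinal vi)) := cuu'; rewrite !ffunE /= nth_index //.
  move=> /(congr1 val) /=; rewrite !inordK ?ltnS ?index_size // => ii.
  have uu : cox_act u v = cox_act u' v.
    by rewrite -[LHS](nth_index 0 (actO u v ou vO)) ii nth_index // actO.
  by rewrite cox_actM uu cox_actK.
have /choice[f fP] : forall c, exists n, forall u, overW J u ->
  code u = c -> lenW J u = n.
  move=> c; have [[u ou uc]|no] := pselect (exists2 u, overW J u & code u = c).
    by exists (lenW J u) => u' ou' u'c; rewrite (code_inj u' u) // u'c uc.
  by exists 0 => u ou uc; case: no; exists u.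
pose P n := `[< exists2 u, overW J u & lenW J u = n >].
have P0 : exists n, P n.
  by exists (lenW J 1%g); apply/asboolP; exists 1%g => //; exact: over1.
have Pb n : P n -> (n <= \max_c f c)%N.
  move=> /asboolP[u ou <-]; rewrite (fP _ u ou erefl).
  exact: (leq_bigmax (code u)).
case: (ex_maxnP P0 Pb) => n /asboolP[w ow wn] nmax; exists w => // u ou.
by rewrite wn; apply: nmax; apply/asboolP; exists u.
Qed.

Variables (nu : W) (p : I -> I) (t : I).
Hypothesis onu : overW K nu.
Hypothesis nuJ : forall j, j \in J -> p j \in K /\
  cox_act nu (sroot R j) = sroot R (p j).
Hypothesis nux : npos (cox_act nu (sroot R x)).
Hypothesis pt : forall k, k \in K -> k != t -> exists2 j, j \in J & k = p j.
Hypothesis tp : forall j, j \in J -> p j != t.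

(** If it were 0, the image of the root of x would be a combination of images of roots of J, and the
    root of x itself a combination of roots of J. *)
Lemma nu_coord_t : cox_act nu (sroot R x) t < 0.
Proof.
rewrite lt_neqAle nux andbT; apply/eqP => vt.
have : cox_act nu^-1%g (cox_act nu (sroot R x)) x = 1.
  by rewrite cox_actK ffunE eqxx.
rewrite cox_act_matrix big1 => [/eqP|k _]; first by rewrite eq_sym oner_eq0.
have [kK|kK] := boolP (k \in K); last first.
  by rewrite (act_root_neq onu) ?mul0r //; apply: contraNneq kK => ->.
have [->|kt] := eqVneq k t; first by rewrite vt mul0r.
have [j jJ ->] := pt kK kt; have [_ <-] := nuJ jJ.
rewrite cox_actK ffunE; move: jJ; rewrite !inE eq_sym => /andP[/negPf -> _].
by rewrite mulr0.
Qed.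

(** u leaves the coordinate 1 at x unchanged and adds only roots of J, whose images under [nu] are
    simple roots different from that of t. *)
Lemma nu_orbit_coord u : overW J u -> cox_act nu (cox_act u (sroot R x)) t < 0.
Proof.
move=> ou; have xJ : x \notin J by rewrite !inE eqxx.
rewrite cox_act_matrix (bigD1 x) //= big1 => [|i ix].
  rewrite addr0 -[cox_act u _]/(rho (fun y =>
    y) u _) (rho_out (r J)) // ffunE eqxx mul1r.
  exact: nu_coord_t.
have [iJ|iJ] := boolP (i \in J).
  have [_ ->] := nuJ iJ; rewrite ffunE eq_sym (negPf (tp iJ)).
  by rewrite mulr0.
by rewrite (act_root_neq ou) ?mul0r.
Qed.

Lemma nu_orbit_npos u : overW J u -> npos (cox_act nu (cox_act u (sroot R x))).
Proof.
move=> ou; have JK : J \subset K by exact: subD1set.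
have onuu : overW K (nu * u)%g by apply: overM => //; exact: overW_sub ou.
have [pos|neg] := root_sign R (r K) onuu xK.
  by have := nu_orbit_coord ou; rewrite -cox_actM ltNge (pos t).
by move=> j; have := neg j; rewrite /rho cox_actM.
Qed.

(* [nu] makes every root of K outside J negative, so the W_J-orbit of the root
   of x consists of inversions of [nu] and is finite; hence W_J has a longest
   element, and its product with [nu] is the longest element of W_K. *)
Lemma longest_of_partial : exists w0 e, [/\ overW K w0,
  forall k, k \in K -> e k \in K /\ cox_act w0 (sroot R k) = - sroot R (e k) &
    e x = t].
Proof.
have JK : J \subset K by exact: subD1set.
have xJ : x \notin J by rewrite !inE eqxx.
have [s nus] : exists s : seq I, forall v : vec, cox_act nu v = act m s v.
  have [_ [s [sK nuE _]]] := onu; exists s => v; rewrite nuE.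
  by rewrite -[LHS]/(rho (fun y => y) _ v) (rho_word (r K)).
pose isO v := exists2 u, overW J u & v = cox_act u (sroot R x).
pose O := [seq v <- undup (inversions R m s) | `[< isO v >]].
have memO v : (v \in O) = `[< isO v >].
  rewrite mem_filter; apply/andb_idr => /asboolP[u ou ->]; rewrite mem_undup.
  have ouK := overW_sub JK ou.
  apply: inversionsP; first by exists u, x.
    have [//|neg] := root_sign R (r K) ouK xK; exfalso.
    by have := neg x; rewrite (rho_out (r J)) // ffunE eqxx lern0.
  by rewrite -nus; exact: nu_orbit_npos.
have xO : sroot R x \in O.
  by rewrite memO; apply/asboolP; exists 1%g; [exact: over1|rewrite cox_act1].
have OJ j v : j \in J -> v \in O -> refl m j v \in O.
  rewrite !memO => jJ /asboolP[u ou ->]; apply/asboolP.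
  exists (cox_gen m j * u)%g; first by apply: overM => //; exact: over_gen.
  by rewrite cox_actM cox_act_gen.
have [wJ owJ wJmax] := finite_orbit_longest xO OJ.
have wJneg := maximal_npos R (r J) owJ wJmax.
pose w0 := (nu * wJ)%g; have ow0 : overW K w0.
  by apply: overM => //; exact: overW_sub owJ.
have w0neg i : i \in K -> npos (rho (fun y => y) w0 (sroot R i)).
  move=> iK; rewrite /rho cox_actM; have [->|ix] := eqVneq i x;
    first exact: nu_orbit_npos.
  have iJ : i \in J by rewrite !inE ix.
  move=> k; rewrite cox_act_matrix sumr_le0 // => j _.
  have [jJ|jJ] := boolP (j \in J).
    have [_ ->] := nuJ jJ; rewrite mulr_le0_ge0 ?ffunE ?ler0n //; exact: wJneg.
  by rewrite (act_root_neq owJ) ?mul0r //; apply: contraNneq jJ => ->.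
have [e he] := opposite_image (r K) ow0 w0neg.
exists w0, e; split=> //.
have [_ hx] := he x xK; apply/eqP/negPn/negP => ext.
have := nu_orbit_coord owJ; rewrite -cox_actM -[cox_act _ _]/(rho (fun y =>
  y) w0 _) hx.
by rewrite !ffunE eq_sym (negPf ext) oppr0 ltxx.
Qed.

End FiniteParabolic.

(** * Decomposition into elementary steps *)

Section Chain.
Variables (R : realType) (I : finType) (m : coxeter_matrix I).
Local Notation vec := {ffun I -> R}.
Local Notation W := (cox_group m).
Local Notation overW K := (over (cox_gen m) K).
Local Notation lenW K := (len (cox_gen m) K).
Implicit Types (u w y z : W) (i j x t : I) (K J A B : {set I}).
Let r K := cox_realizes m K.

(* Induction on the length of w: for a right descent x of w and the component K
   of x in A + x, the W_K-factor of w moves A to (A + x) - t, and the cofactor is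
   shorter. *)
Lemma simple_sets_chain (P : {set I} -> Prop) B :
  (forall A x t K w0 e, P A -> x \notin A -> t \in A -> K \subset x |: A ->
     x \in K -> t \in K ->
     (forall k, (k \in K) = connect (cadj_in m (x |: A)) x k) ->
     overW K w0 ->
     (forall k, k \in K -> e k \in K /\ cox_act w0 (sroot R k) = - sroot R (e
       k)) ->
     e x = t -> P ((x |: A) :\ t)) ->
  forall w A, P A -> #|A| = #|B| ->
  (forall i, i \in A -> exists2 j, j \in B & cox_act w (sroot R i) = sroot R j)
    -> P B.
Proof.
move=> step w; have [n] := ubnP (lenW [set: I] w);
  elim: n w => // n IHn w wn A PA AB wA.
have [w1|/eqP w1] := eqVneq w 1%g.
  suff -> : B = A by [].
  apply/esym/eqP; rewrite eqEcard AB leqnn andbT; apply/subsetP => i /wA[j jB].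
  by rewrite w1 cox_act1 => /sroot_inj ->.
have ow := cox_over w.
have [x _ wx] := exists_descent (r [set: I]) ow w1.
have xT : x \in [set: I] by rewrite inE.
have wxneg : npos (cox_act w (sroot R x)) := len_npos R (r [set: I]) ow xT wx.
have xA : x \notin A.
  by apply/negP => /wA[j _ wxj]; have := wxneg j; rewrite wxj ffunE eqxx lern0.
have [K KE] : exists K : {set I}, forall k,
    (k \in K) = connect (cadj_in m (x |: A)) x k.
  by exists [set k | connect (cadj_in m (x |: A)) x k] => k; rewrite inE.
have xK : x \in K by rewrite KE connect0.
have KxA : K \subset x |: A.
  apply/subsetP => k; rewrite KE => /connectP[p + ->].
  case/lastP: p => [|p y]; first by rewrite !inE eqxx.
  by rewrite last_rcons rcons_path => /andP[_ /and3P[]].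
have connK k : k \in K -> connect (cadj_in m K) x k.
  rewrite KE => /connectP[p + ->]; elim/last_ind: p => [|p y IHp] //.
  rewrite rcons_path last_rcons => /andP[pp /and3P[lA yA ly]].
  apply: connect_trans (IHp pp) (connect1 _).
  have lK : last x p \in K by rewrite KE; apply/connectP; exists p.
  rewrite /cadj_in /= lK ly andbT KE; apply: connect_trans (_ : connect _ x
    (last x p)) _.
    by rewrite -KE.
  by apply: connect1; rewrite /cadj_in /= lA yA.
(* w' is the shortest element of the coset w W_K: it keeps the simple roots of K positive, and it is
   shorter than w because x is a descent of w. *)
pose Q (q : nat) := `[< exists2 u, overW K u & lenW [set: I] (w * u)%g = q >].
have Q0 : exists q, Q q.
  by exists (lenW [set: I] (w * 1)%g); apply/asboolP; exists 1%g => //;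
    exact: over1.
case: (ex_minnP Q0) => q /asboolP[u ou uq] qmin.
pose w' := (w * u)%g; pose nu := u^-1%g.
have onu : overW K nu by exact: (overV (r K)).
have wE : w = (w' * nu)%g by rewrite mulgK.
have w'n : (lenW [set: I] w' < n)%N.
  have qw : (q < lenW [set: I] w)%N.
    apply: leq_ltn_trans wx; apply: qmin; apply/asboolP.
    by exists (cox_gen m x) => //; exact: over_gen.
  by rewrite /w' uq; apply: leq_trans qw _; rewrite -ltnS.
have w'K k : k \in K -> nneg (cox_act w' (sroot R k)).
  move=> kK; apply: (len_nneg R (r [set: I])); rewrite ?inE //;
    first exact: cox_over.
  rewrite {1}/w' uq; apply: qmin; apply/asboolP; exists (u * cox_gen m k)%g.
    by apply: overM => //; exact: over_gen.
  by rewrite mulgA.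
have wnu (v : vec) : cox_act w v = cox_act w' (cox_act nu v).
  by rewrite {1}wE cox_actM.
have w'sum k v : cox_act w' v k = \sum_i v i * cox_act w' (sroot R i) k.
  exact: cox_act_matrix.
have JA j : j \in K :\ x -> j \in A.
  by rewrite !inE => /andP[jx /(subsetP KxA)]; rewrite !inE (negPf jx).
have /choice[p hp] : forall j, exists k, j \in K :\ x ->
    k \in K /\ cox_act nu (sroot R j) = sroot R k.
  move=> j; have [jJ|jJ] := boolP (j \in K :\ x); last by exists j.
  have [j' j'B wj] := wA j (JA j jJ).
  have jK : j \in K by move: jJ; rewrite !inE => /andP[].
  have nuE : cox_act nu (sroot R j) = cox_act w'^-1%g (sroot R j').
    by rewrite -wj wnu cox_actK.
  have out k : k \notin K -> cox_act nu (sroot R j) k = 0.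
    by move=> kK; apply: (act_root_neq R onu) => //; apply: contraNneq kK => ->.
  have pos : nneg (cox_act nu (sroot R j)).
    have [//|neg] := root_sign R (r K) onu jK; exfalso.
    have : cox_act w' (cox_act nu (sroot R j)) j' <= 0.
      rewrite w'sum sumr_le0 // => k _; have [kK|kK] := boolP (k \in K).
        by rewrite mulr_le0_ge0 ?w'K //; exact: neg.
      by rewrite out ?mul0r.
    by rewrite -wnu wj ffunE eqxx lern0.
  (* On this root the inverse of w' agrees with [nu], which bounds the support by K, while w' keeps
     the roots of K positive. *)
  have [||||k kK hk] := @simple_image R I m w'^-1%g j' 1 K.
  - by rewrite expr1n.
  - by move=> k kK; rewrite -nuE out.
  - by move=> k; rewrite mul1r -nuE.
  - by move=> k l kK; rewrite mul1r invgK; exact: w'K.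
  exists k => _; split=> //; rewrite nuE; apply/ffunP => l; rewrite hk;
    exact: mul1r.
have pinj : {in K :\ x &, injective p}.
  move=> j j' jJ j'J pjj'; have [_ hj] := hp j jJ; have [_ hj'] := hp j' j'J.
  by apply: (@sroot_inj R); rewrite -[LHS](cox_actK nu) -[RHS](cox_actK nu) hj
    hj' pjj'.
have cardJ : #|p @: (K :\ x)| = #|K :\ x| by rewrite card_in_imset.
have pJK : p @: (K :\ x) \subset K.
  by apply/subsetP => k /imsetP[j jJ ->]; have [] := hp j jJ.
(* p maps K minus x injectively into K, so it misses exactly one element. *)
have /set0Pn[t] : K :\: p @: (K :\ x) != set0.
  rewrite -card_gt0 cardsD (setIidPr pJK) cardJ (cardsD1 x K) xK; lia.
rewrite inE => /andP[tp tK].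
have ptE : K :\ t = p @: (K :\ x).
  apply/esym/eqP; rewrite eqEcard; apply/andP; split.
    by rewrite subsetD1 pJK.
  rewrite cardJ; have := cardsD1 x K; have := cardsD1 t K; rewrite xK tK; lia.
have pt k : k \in K -> k != t -> exists2 j, j \in K :\ x & k = p j.
  by move=> kK kt; apply/imsetP; rewrite -ptE !inE kt.
have tp' j : j \in K :\ x -> p j != t.
  by move=> jJ; apply: contraNneq tp => <-; apply: imset_f.
have nux : npos (cox_act nu (sroot R x)).
  have [pos|//] := root_sign R (r K) onu xK; exfalso.
  have pos' : nneg (rho (fun y => y) w (sroot R x)).
    move=> j; rewrite /rho wnu w'sum sumr_ge0 // => k _; have [kK|kK] :=
      boolP (k \in K).
      by rewrite mulr_ge0 ?w'K //; exact: pos.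
    by rewrite (act_root_neq R onu) ?mul0r //; apply: contraNneq kK => ->.
  exact: nneg_nposF pos' wxneg.
have [w0 [e [ow0 he ext]]] := longest_of_partial xK connK onu hp nux pt tp'.
have txA : t \in x |: A by exact: (subsetP KxA).
apply: (IHn w' w'n ((x |: A) :\ t)).
- have [tx|tx] := eqVneq t x; first by rewrite tx setU1K.
  apply: (step A x t K w0 e) => //.
  by move: txA; rewrite !inE (negPf tx).
- by have := cardsD1 t (x |: A); rewrite txA cardsU1 xA AB; lia.
move=> i; rewrite !inE => /andP[it ixA].
have [iK|iK] := boolP (i \in K).
  have [j jJ ->] := pt i iK it; have [_ <-] := hp j jJ.
  by rewrite -wnu; apply/wA/JA.
have ix : i != x by apply: contraNneq iK => ->.
have iA : i \in A by move: ixA; rewrite (negPf ix).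
have [j jB wi] := wA i iA; exists j => //; rewrite -wi wnu;
  congr (cox_act w' _).
(* i lies in another component of A + x, so its root is orthogonal to those of K and fixed by
   [nu]. *)
apply/esym/(rho_fix (r K) _ onu) => k kK; rewrite coroot_root.
apply: gram_nadj; first by apply: contraNneq iK => <-.
apply: contra iK => ki; rewrite KE; apply: connect_trans (_ : connect _ x k) _.
  by rewrite -KE.
apply: connect1; rewrite /cadj_in /= ki (subsetP KxA) //= andbT.
by rewrite !inE iA orbT.
Qed.

End Chain.

(** * Embedding of a Dyer group in a Coxeter group *)

Section PresentedMorphism.
Variables (V : choiceType) (r : word V -> word V ->
  Prop) (H : groupType) (f : V -> H).
Local Open Scope group_scope.

Definition eval_word (s : word V) : H :=
  \prod_(a <- s) (if a.2 then (f a.1)^-1 else f a.1).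

Hypothesis fr : forall s t, r s t -> eval_word s = eval_word t.

Lemma eval_word_cat s t : eval_word (s ++ t) = eval_word s * eval_word t.
Proof. by rewrite /eval_word big_cat. Qed.

Lemma pres_eq_eval s t : pres_eq r s t -> eval_word s = eval_word t.
Proof.
elim=> {s t} [s t|[v b]|s|s t _ IH|s t u _ IH1 _ IH2|s s' t t' _ IH1 _ IH2] //.
- exact: fr.
- by rewrite /eval_word big_cons big_seq1 big_nil; case: b;
    rewrite /= ?mulgV ?mulVg.
- by rewrite IH1.
- by rewrite !eval_word_cat IH1 IH2.
Qed.

Lemma presented_morphism : exists F : presented r -> H,
  {morph F : x y / x * y} /\ forall v, F (pres_gen r v) = f v.
Proof.
have FE s : eval_word (pres_repr (pres_class r s)) = eval_word s.
  exact/pres_eq_eval/pres_repr_class.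
exists (fun x => eval_word (pres_repr x)); split=> [x y|v].
  by rewrite FE eval_word_cat.
by rewrite FE /eval_word big_seq1.
Qed.

End PresentedMorphism.

Section DihedralRelation.
Variables (G : groupType) (a b : G).
Local Open Scope group_scope.

Lemma prod_alternating_even (T : Type) (f : T -> G) (u v : T) n :
  \prod_(k <- alternating u v n.*2) f k = (f u * f v) ^+ n.
Proof.
elim: n => [|n IHn]; first by rewrite big_nil.
by rewrite doubleS [alternating _ _ _]/= !big_cons IHn mulgA -expgS.
Qed.

Hypotheses (a2 : a * a = 1) (b2 : b * b = 1).

(** For involutions b a is the inverse of a b. This turns the braid relation of the two involutions
    attached to a vertex into the order relation of that vertex. *)
Lemma alternating_power (T : Type) (f : T -> G) (u v : T) n :
  f u = a -> f v = b ->
  \prod_(k <- alternating u v n) f k = \prod_(k <- alternating v u n) f k ->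
  (a * b) ^+ n = 1.
Proof.
move=> fu fv; have ba : b * a = (a * b)^-1.
  by rewrite invgM (mulg1_eq a2) (mulg1_eq b2).
rewrite -[n]odd_double_half; case: (odd n); last first.
  rewrite add0n !prod_alternating_even fu fv ba expVgn => e.
  by rewrite -addnn expgnDr -{2}[(a * b) ^+ _]invgK -e mulgV.
rewrite add1n /= !big_cons !prod_alternating_even fu fv ba expVgn => e.
apply: (mulgI ((a * b) ^- n./2)); rewrite mulg1 -addnn -addSn addnC expgnDr
  mulKg.
by apply: (mulgI a); rewrite e expgS !mulgA a2 mul1g.
Qed.

End DihedralRelation.

Section DyerMatrix.
Variables (V : finType) (Gamma : dyer_graph V).
Local Notation I := (V * bool)%type.

(* (v, false) and (v, true) are involutions whose product has order f(v); a
   vertex v of order greater than 2 is sent to this product, and a vertex of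
   order 2 to (v, false). *)
Definition dyer_label (i j : I) : label :=
  if i.2 == j.2 then
    if i.2 || (i.1 == j.1) then Some 2 else mlabel Gamma i.1 j.1
  else if i.1 == j.1 then vlabel Gamma i.1 else Some 2.

Lemma mlabel_sym u v : mlabel Gamma u v = mlabel Gamma v u.
Proof. by rewrite /mlabel adj_sym; case: ifP => // /elabel_sym. Qed.

Lemma label_geq_trans n k l : (n <= k)%N -> label_geq k l -> label_geq n l.
Proof. by case: l => //= p nk /(leq_trans nk). Qed.

Lemma mlabel_ge2 u v : label_geq 2 (mlabel Gamma u v).
Proof.
by rewrite /mlabel; case: ifP => // /elabel_gt2; exact: label_geq_trans.
Qed.

Lemma dyer_label_sym i j : dyer_label i j = dyer_label j i.
Proof.
rewrite /dyer_label eq_sym [j.1 == _]eq_sym; case: eqP => [->|_].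
  by rewrite mlabel_sym.
by case: eqP => // ->.
Qed.

Lemma dyer_label_ge2 i j : label_geq 2 (dyer_label i j).
Proof.
rewrite /dyer_label; case: ifP => _; case: ifP => _ //; first exact: mlabel_ge2.
exact: vlabel_geq2.
Qed.

Definition dyer_matrix := CoxeterMatrix dyer_label_sym dyer_label_ge2.
Local Notation W := (cox_group dyer_matrix).
Local Notation gen := (cox_gen dyer_matrix).
Local Open Scope group_scope.

Definition dyer_embed (v : V) : W :=
  if vlabel Gamma v == Some 2 then gen (v, false)
  else gen (v, false) * gen (v, true).

Let r := cox_realizes dyer_matrix [set: I].

Lemma gen_sqr i : gen i * gen i = 1.
Proof. by apply: (realizes_sqr r); rewrite inE. Qed.

Lemma gen_commute i j : dyer_label i j = Some 2 ->
  gen i * gen j = gen j * gen i.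
Proof.
have [->|ij] := eqVneq i j; first by [].
move=> l; have := realizes_braid r (finset.in_setT i) (finset.in_setT j) ij l.
by rewrite /= !big_cons big_nil !mulg1.
Qed.

(** The only braid relations of D at a vertex of order above 2 are therefore commutations. *)
Lemma mlabel_large u v : u != v ->
  vlabel Gamma u != Some 2 \/ vlabel Gamma v != Some 2 ->
  mlabel Gamma u v = None \/ mlabel Gamma u v = Some 2.
Proof.
have ge3 w : vlabel Gamma w != Some 2 -> label_geq 3 (vlabel Gamma w).
  have := vlabel_geq2 Gamma w; case: (vlabel Gamma w) => [k|] //=.
  by rewrite leq_eqVlt => /orP[/eqP <-|].
move=> uv h; rewrite /mlabel; case: ifP => auv; last by right.
left; case: h => /ge3 h; last exact: elabel_infty.
by rewrite elabel_sym // elabel_infty // adj_sym.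
Qed.

Lemma embed_commute u v : u != v -> mlabel Gamma u v = Some 2 ->
  dyer_embed u * dyer_embed v = dyer_embed v * dyer_embed u.
Proof.
move=> uv uv2; have c b c' : commute (gen (u, b)) (gen (v, c')).
  apply: gen_commute; rewrite /dyer_label /= (negPf uv) orbF.
  by case: b; case: c'.
rewrite /dyer_embed; case: ifP => _; case: ifP => _; rewrite -/(commute _ _).
- exact: c.
- by apply: commuteM; exact: c.
- by apply/commute_sym/commuteM; apply/commute_sym/c.
- by apply: commuteM; apply/commute_sym/commuteM; apply/commute_sym/c.
Qed.

Lemma eval_pos_word (H : groupType) (f : V -> H) (s : seq V) :
  eval_word f (pos_word s) = \prod_(k <- s) f k.
Proof. by rewrite /eval_word /pos_word big_map. Qed.

Lemma map_alternating (T T' : Type) (f : T -> T') u v n :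
  map f (alternating u v n) = alternating (f u) (f v) n.
Proof. by elim: n u v => //= n IHn u v; rewrite IHn. Qed.

Lemma prod_nseq (H : groupType) (f : V ->
  H) n v : \prod_(k <- nseq n v) f k = f v ^+ n.
Proof. by elim: n => [|n IHn]; rewrite ?big_nil //= big_cons IHn -expgS. Qed.

Lemma dyer_embed_rel s t : dyer_rel Gamma s t ->
  eval_word dyer_embed s = eval_word dyer_embed t.
Proof.
case=> {s t} [v n vn|u v n uv uvn]; rewrite !eval_pos_word.
  rewrite prod_nseq [RHS]/eval_word big_nil /dyer_embed.
  case: eqP => [v2|_].
    by move: v2; rewrite vn => -[->]; rewrite expgS expg1 gen_sqr.
  apply: (alternating_power (gen_sqr _) (gen_sqr _) (f := gen) erefl erefl).
  apply: (realizes_braid r); rewrite ?inE //.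
    by apply/eqP => -[].
  by rewrite /= /dyer_label /= eqxx.
have [/andP[/eqP u2 /eqP v2]|] :=
    boolP ((vlabel Gamma u == Some 2) && (vlabel Gamma v == Some 2)).
  have embE a b k : vlabel Gamma a = Some 2 -> vlabel Gamma b = Some 2 ->
      \prod_(c <- alternating a b k) dyer_embed c =
      \prod_(c <- alternating (a, false) (b, false) k) gen c.
    move=> a2 b2; rewrite -(map_alternating (fun c => (c, false))) big_map.
    elim: k a b a2 b2 => [|k IHk] a b a2 b2; first by rewrite !big_nil.
    by rewrite /= !big_cons IHk // {1}/dyer_embed a2 eqxx.
  rewrite !embE //; apply: (realizes_braid r); rewrite ?inE //.
    by apply: contraNneq uv => -[->].
  by rewrite /= /dyer_label /= (negPf uv).
rewrite negb_and => /orP h.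
have [|uv2] := mlabel_large uv h; first by rewrite uvn.
move: uvn; rewrite uv2 => -[<-] /=; rewrite !big_cons big_nil !mulg1.
exact: embed_commute.
Qed.

End DyerMatrix.

(** * Conjugation along the edges of the graph *)

Section Parabolic.
Variables (D : groupType) (X : {fset D}).
Implicit Types (Y : {set X}) (d x y : D) (c : X).
Local Open Scope group_scope.

Lemma parabolic_ind Y (P : D -> Prop) : P 1 -> (forall x y, P x -> P y ->
  P (x * y^-1)) ->
  (forall c, c \in Y -> P (val c)) -> forall d, parabolic Y d -> P d.
Proof.
move=> P1 PM Pv d; apply; split=> [|_ [c /= cY <-]]; last exact: Pv.
split=> [|x y]; rewrite !classical_sets.inE; first exact: P1.
exact: PM.
Qed.

Lemma parabolic1 Y : parabolic Y 1.
Proof. by move=> A [[]]; rewrite classical_sets.inE. Qed.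

Lemma parabolic_div Y x y : parabolic Y x -> parabolic Y y ->
  parabolic Y (x * y^-1).
Proof.
move=> px py A h; have [[_ cl] _] := h.
have := cl x y; rewrite !classical_sets.inE; apply; [exact: px|exact: py].
Qed.

Lemma parabolicV Y x : parabolic Y x -> parabolic Y x^-1.
Proof.
move=> px; rewrite -[x^-1]mul1g; apply: parabolic_div => //.
exact: parabolic1.
Qed.

Lemma parabolicM Y x y : parabolic Y x -> parabolic Y y -> parabolic Y (x * y).
Proof.
move=> px py; rewrite -[y]invgK; apply: parabolic_div => //.
exact: parabolicV.
Qed.

Lemma parabolic_val Y c : c \in Y -> parabolic Y (val c).
Proof. by move=> cY A [_ sub]; apply: sub; exists c. Qed.

Lemma conjugate_byP (a d : D) (A : set D) : conjugate_by a A d <-> A (a^-1 * d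
  * a).
Proof.
split=> [[x Ax <-]|Ad]; first by rewrite !mulgA mulVg mul1g mulgVK.
by exists (a^-1 * d * a) => //; rewrite !mulgA mulgV mul1g mulgK.
Qed.

Lemma conjugate_byM (a b : D) (A : set D) :
  conjugate_by a (conjugate_by b A) = conjugate_by (a * b) A.
Proof.
apply/funext => d; apply/propext; rewrite !conjugate_byP.
by rewrite invgM !mulgA.
Qed.

Lemma conjugate_by1 (A : set D) : conjugate_by 1 A = A.
Proof.
by apply/funext => d; apply/propext; rewrite conjugate_byP invg1 mul1g mulg1.
Qed.

Lemma conjugate_parabolic_sub Y Y' a : conjugate_by a (elements Y) = elements
  Y' ->
  forall d, parabolic Y d -> parabolic Y' (a * d * a^-1).
Proof.
move=> e d; apply: (parabolic_ind (P := fun d => parabolic Y' (a * d * a^-1))).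
- by rewrite mulg1 mulgV; exact: parabolic1.
- move=> x y px py; have -> : a * (x * y^-1) * a^-1 = (a * x * a^-1) * (a * y *
    a^-1)^-1.
    by rewrite !invgM !invgK !mulgA mulgVK.
  exact: parabolic_div.
- move=> c cY; have : elements Y' (a * val c * a^-1).
    by rewrite -e; exists (val c) => //; exists c.
  by move=> [c' /= c'Y <-]; exact: parabolic_val.
Qed.

Lemma conjugate_parabolic Y Y' a : conjugate_by a (elements Y) = elements Y' ->
  conjugate_by a (parabolic Y) = parabolic Y'.
Proof.
move=> e; have e' : conjugate_by a^-1 (elements Y') = elements Y.
  by rewrite -e conjugate_byM mulVg conjugate_by1.
apply/funext => d; apply/propext; rewrite conjugate_byP; split.
  move=> /(conjugate_parabolic_sub e); rewrite !mulgA mulgV mul1g.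
  by rewrite mulgK.
by move=> /(conjugate_parabolic_sub e'); rewrite invgK.
Qed.

End Parabolic.

Section DyerSystem.
Variables (R : realType) (D : groupType) (X : {fset D}) (Gamma : dyer_graph X).
Local Notation m := (dyer_matrix Gamma).
Local Notation W := (cox_group m).
Local Notation gen := (cox_gen m).
Implicit Types (Y C : {set X}) (d x : D) (c : X).
Local Open Scope group_scope.

Lemma dyer_system_rel : dyer_system Gamma -> forall s t, dyer_rel Gamma s t ->
  eval_word val s = eval_word val t.
Proof.
move=> [phi [_ phiE]] s t st.
have phi1 : phi (1 : dyer_group Gamma) = 1.
  by apply: (mulgI (phi 1)); rewrite -gmulfM !mulg1.
have phi_word (u : word X) : eval_word val u = phi (pres_class (dyer_rel Gamma)
  u).
  elim: u => [|[c b] u IHu]; first by rewrite /eval_word big_nil -phi1.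
  have -> : pres_class (dyer_rel Gamma) ((c, b) :: u) =
      (pres_class (dyer_rel Gamma) [:: (c, b)] : dyer_group Gamma) *
      (pres_class (dyer_rel Gamma) u : dyer_group Gamma).
    by rewrite [RHS]pres_mulE.
  rewrite gmulfM -IHu /eval_word big_cons /=; congr (_ * _).
  rewrite -phiE; case: b => //; apply: mulg1_eq; rewrite -gmulfM -phi1.
  apply: (congr1 phi); rewrite [LHS]pres_mulE.
  by apply/pres_classP; exact: (PresCancel _ (c, false)).
have /pres_classP e : pres_eq (dyer_rel Gamma) s t by exact: PresRel.
by rewrite !phi_word e.
Qed.

Lemma dyer_system_morphism : dyer_system Gamma ->
  exists F : D -> W, {morph F : x y / x * y} /\
    forall c, F (val c) = dyer_embed Gamma c.
Proof.
move=> [phi [[psi phiK psiK] phiE]].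
have [E [EM Egen]] := presented_morphism (@dyer_embed_rel _ Gamma).
exists (fun d => E (psi d)); split=> [x y|c].
  by rewrite -EM; congr E; apply: (can_inj phiK); rewrite gmulfM !psiK.
by rewrite -phiE phiK; exact: Egen.
Qed.

Hypothesis rel : forall s t, dyer_rel Gamma s t ->
  eval_word val s = eval_word val t.
Variable F : D -> W.
Hypothesis FM : {morph F : x y / x * y}.
Hypothesis Fval : forall c, F (val c) = dyer_embed Gamma c.

Lemma F1 : F 1 = 1.
Proof. by apply: (mulgI (F 1)); rewrite -FM !mulg1. Qed.

Lemma FV d : F d^-1 = (F d)^-1.
Proof. by apply: (mulgI (F d)); rewrite -FM !mulgV F1. Qed.

Lemma gen_neq1 i : gen i <> 1.
Proof.
move=> /(congr1 (fun z => cox_act z (sroot R i) i)).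
rewrite cox_act_gen cox_act1 refl_root !ffunE eqxx /=; lra.
Qed.

Lemma vlabel_cosl_gt0 c : vlabel Gamma c != Some 2 ->
  0 < cosl R (vlabel Gamma c).
Proof.
move=> c2; apply: lt_le_trans (cosl_gt0 R _); first by lra.
have := vlabel_geq2 Gamma c; case: (vlabel Gamma c) c2 => [k|] //= k2.
by rewrite leq_eqVlt => /orP[/eqP e|//]; rewrite -e eqxx in k2.
Qed.

(** The relations bound the order of c only from above; the lower bound comes from W. If the image a
    b of a vertex with label other than 2 had square 1, then a and b would commute, but a b and b a
    send the root of b to vectors with coordinates -2 c and 2 c at a, where c > 0 is the cosine of
    the label. *)
Lemma order_two_label c : order_two (val c) = (vlabel Gamma c == Some 2).
Proof.
apply/idP/idP => [/andP[c1 /eqP c2]|/eqP c2].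
  apply: contraT => l2; exfalso.
  have : F (val c) * F (val c) = 1 by rewrite -FM -[_ * _]/(val c ^+ 2) c2 F1.
  rewrite Fval /dyer_embed (negPf l2); set a := gen _; set b := gen _ => ab2.
  have ab : a * b = b * a.
    by have := mulg1_eq ab2; rewrite invgM /a /b !(mulg1_eq (gen_sqr Gamma _)).
  have := congr1 (fun z => cox_act z (sroot R (c, true)) (c, false)) ab.
  have ne : (c, false) != (c, true) by apply/eqP => -[].
  have ne' : (c, true) != (c, false) by apply/eqP => -[].
  rewrite !cox_actM !cox_act_gen refl_root refl_lin (refl_root_neq R m ne).
  rewrite refl_lin refl_root (refl_root_neq R m ne') !ffunE (negPf ne) eqxx /=.
  rewrite [dyer_label _ (c, false) _]/dyer_label /= eqxx => h.
  by have := vlabel_cosl_gt0 l2; lra.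
rewrite /order_two; apply/andP; split.
  apply/eqP => c1; have := F1; rewrite -c1 Fval /dyer_embed c2 eqxx.
  exact: gen_neq1.
apply/eqP; have := rel (DyerOrder c2); rewrite eval_pos_word prod_nseq => ->.
by rewrite /eval_word big_nil.
Qed.

Lemma val_sqr c : vlabel Gamma c = Some 2 -> val c * val c = 1.
Proof.
move=> c2; have := rel (DyerOrder c2); rewrite eval_pos_word prod_nseq expgS
  expg1 => ->.
by rewrite /eval_word big_nil.
Qed.

Lemma val_braid c c' n : c != c' -> mlabel Gamma c c' = Some n ->
  \prod_(a <- alternating c c' n) val a = \prod_(a <- alternating c' c n) val a.
Proof. by move=> cc' l; have := rel (DyerBraid cc' l); rewrite !eval_pos_word.
  Qed.

Definition lift_false C : {set X * bool} := [set i | (i.1 \in C) && ~~ i.2]%SET.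
Local Notation g := (fun i : X * bool => val i.1).

Lemma lift_falseP C i : i \in lift_false C -> i = (i.1, false) /\ i.1 \in C.
Proof. by case: i => a b; rewrite inE /= => /andP[aC /negbTE ->]. Qed.

Lemma mem_lift_false C c : ((c, false) \in lift_false C) = (c \in C).
Proof. by rewrite inE /= andbT. Qed.

Section Involutive.
Variable C : {set X}.
Hypothesis C2 : forall c, c \in C -> vlabel Gamma c = Some 2.
Local Notation K := (lift_false C).

Lemma realizes_lift_false : realizes F g K.
Proof.
split=> // [i /lift_falseP[-> iC]|i /lift_falseP[-> iC]|i j n].
- by rewrite Fval /dyer_embed C2.
- by rewrite val_sqr // C2.
move=> /lift_falseP[-> iC] /lift_falseP[-> jC] ij l.
have nij : i.1 != j.1 by apply: contraNneq ij => ->.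
rewrite -!(map_alternating (fun c => (c, false))) !big_map /=.
by apply: val_braid => //; move: l; rewrite /= /dyer_label /= (negPf nij).
Qed.

Lemma has_wordP w n : has_word g K w n <-> exists2 s,
  expression C w s & size s = n.
Proof.
split=> [[s [sK -> <-]]|[s [sC ->] <-]].
  exists (map fst s); last by rewrite size_map.
  split; last by rewrite big_map.
  by move=> c /mapP[i /sK /lift_falseP[_ iC] ->].
exists (map (fun c => (c, false)) s); split; rewrite ?size_map ?big_map //.
by move=> i /mapP[c /sC cC ->]; rewrite mem_lift_false.
Qed.

Lemma has_lengthP w n : has_length C w n <-> over g K w /\ n = len g K w.
Proof.
split=> [[[s es sn] smin]|[ow ->]].
  have ow : over g K w by exists n; apply/has_wordP; exists s.
  split=> //; apply/eqP; rewrite eqn_leq; apply/andP; split.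
    by have /has_wordP[t et <-] := len_word ow; exact: smin.
  by apply: len_le; apply/has_wordP; exists s.
split; first exact/has_wordP/len_word.
by move=> s es; apply: len_le; apply/has_wordP; exists s.
Qed.

Lemma parabolic_over w : parabolic C w <-> over g K w.
Proof.
have r := realizes_lift_false; split.
  apply: parabolic_ind => [|x y ox oy|c cC].
  - exact: over1.
  - by apply: overM => //; exact: (overV r).
  - by have := @over_gen _ _ g K (c, false); rewrite mem_lift_false; apply.
move=> [_ [s [sK -> _]]]; elim: s sK => [|i s IHs] sK.
  by rewrite big_nil; exact: parabolic1.
rewrite big_cons; apply: parabolicM.
  by apply: parabolic_val; have [] := lift_falseP (sK i (mem_head _ _)).
by apply: IHs => j js; apply: sK; rewrite inE js orbT.
Qed.

Lemma longestP w : longest C w <->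
  over g K w /\ forall u, over g K u -> (len g K u <= len g K w)%N.
Proof.
split=> [[/parabolic_over ow [n /has_lengthP[_ ->] wmax]]|[ow wmax]].
  by split=> // u ou; apply: wmax; [exact: (parabolic_over u).2|exact:
    (has_lengthP u _).2].
split; first exact: (parabolic_over w).2.
exists (len g K w); first exact: (has_lengthP w _).2.
by move=> u n _ /has_lengthP[ou ->]; exact: wmax.
Qed.

End Involutive.

Lemma componentsP Y C : C \in components Gamma Y ->
  exists2 c, c \in Y & C = [set y in Y | connect (induced_adj Gamma Y) c y]%SET.
Proof. by move=> /imsetP[c cY ->]; exists c. Qed.

Lemma component_closed Y C c y : C \in components Gamma Y -> c \in C ->
  y \in Y ->
  y \notin C -> ~~ adj Gamma c y.
Proof.
move=> /componentsP[a aY ->]; rewrite !inE => /andP[cY ac] yY; rewrite yY /=.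
apply: contra => cy; apply: connect_trans ac (connect1 _).
by rewrite /induced_adj /= cY yY.
Qed.

Lemma component_sub Y C : C \in components Gamma Y -> C \subset Y.
Proof. by move=> /componentsP[a aY ->]; apply/fintype.subsetP => y;
  rewrite inE => /andP[]. Qed.

(** Conjugation by w0 permutes C through the opposition and fixes the remaining vertices of Z, which
    commute with C because C is a component of Z. *)
Lemma conj_edge_conjugate Z t t' : conj_edge Gamma Z t t' ->
  exists a, conjugate_by a (elements (Z :\ t)%SET) = elements (Z :\ t')%SET.
Proof.
move=> [/andP[t2 t2'] tt' [C [/andP[CZ CI] /andP[tC t'C] _ [w0 w0l tw]]]].
have C2 c : c \in C -> vlabel Gamma c = Some 2.
  move=> /(fintype.subsetP (component_sub CI)); rewrite inE => /andP[_].
  by rewrite order_two_label => /eqP.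
have r := realizes_lift_false C2.
have [ow wmax] := (longestP C2 w0).1 w0l.
have wneg := maximal_npos R r ow wmax.
have [e he] := opposite_image r ow wneg.
have ww : w0 * w0 = 1 := opposite_involution r ow he.
have w0V : w0^-1 = w0 := mulg1_eq ww.
have eC c : c \in C -> exists2 c', c' \in C & w0 * val c * w0 = val c'.
  move=> cC; have cK : (c, false) \in lift_false C by rewrite mem_lift_false.
  have [/lift_falseP[_ eC] _] := he _ cK; exists (e (c, false)).1 => //.
  by have := opposite_conj r ow he cK; rewrite /= => ->;
    rewrite -mulgA ww mulg1.
have fixZ y : y \in Z -> y \notin C -> w0 * val y * w0 = val y.
  move=> yZ yC; suff cyw : commute (val y) w0 by rewrite -cyw -mulgA ww mulg1.
  have [_ [s [sK -> _]]] := ow; elim: s sK => [|i s IHs] sK.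
    by rewrite big_nil; exact: commute1.
  rewrite big_cons; apply: commuteM; last first.
    by apply: IHs => j js; apply: sK; rewrite inE js orbT.
  have [_ iC] := lift_falseP (sK i (mem_head _ _)).
  have iy : i.1 != y by apply: contraNneq yC => <-.
  have := @val_braid i.1 y 2 iy; rewrite /mlabel (negPf (component_closed CZ iC
    yZ yC)).
  move=> /(_ erefl); rewrite /= !big_cons big_nil !mulg1 => h.
  by rewrite /commute h.
have sub a b : a \in C -> w0 * val a * w0 = val b -> forall d,
    elements (Z :\ a)%SET d -> elements (Z :\ b)%SET (w0 * d * w0).
  move=> aC ab d [y /=]; rewrite in_setD1 => /andP[ya yZ] <-.
  have [yC|yC] := boolP (y \in C).
    have [c' c'C e'] := eC y yC; rewrite e'; exists c' => //=.
    rewrite in_setD1 (fintype.subsetP (component_sub CZ)) // andbT.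
    apply: contraNneq ya => c'b; apply/eqP/val_inj.
    have : w0 * val y * w0 = w0 * val a * w0 by rewrite e' c'b ab.
    by move/mulIg/mulgI.
  rewrite fixZ //; exists y => //=; rewrite in_setD1 yZ andbT.
  by apply: contraNneq yC => ->; have [c' c'C] := eC a aC;
    rewrite ab => /val_inj ->.
have tw' : w0 * val t' * w0 = val t.
  by rewrite tw !mulgA ww mul1g -mulgA ww mulg1.
exists w0; apply/funext => d; apply/propext; rewrite conjugate_byP w0V; split.
  move=> /(sub t t' tC (esym tw)); rewrite !mulgA ww mul1g.
  by rewrite -mulgA ww mulg1.
by move/(sub t' t t'C tw').
Qed.

Lemma same_component_conjugate Y Y' : same_component Gamma Y Y' ->
  exists a, conjugate_by a (elements Y) = elements Y'.
Proof.
move=> /connectP[p + ->]; elim: p Y => [|Z p IHp] Y /=.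
  by exists 1; exact: conjugate_by1.
move=> /andP[/asboolP[U [t [t' [ed YZ]]]] /IHp[b bE]].
have [a aE] := conj_edge_conjugate ed.
have [f fE] : exists f : D, conjugate_by f (elements Y) = elements Z.
  case: YZ => [[-> ->]|[-> ->]]; first by exists a.
  by exists a^-1; rewrite -aE conjugate_byM mulVg conjugate_by1.
by exists (b * f); rewrite -conjugate_byM fE.
Qed.

End DyerSystem.

(** * Restriction to a set of simple roots *)

Section Restriction.
Variables (R : realType) (I : finType) (m : coxeter_matrix I) (K : {set I}).
Local Notation T := {i : I | i \in K}.

(** Passing to a subtype turns a component into a connected Coxeter matrix, the form in which the
    classification is stated. *)
Definition restrict : coxeter_matrix T :=
  @CoxeterMatrix T (fun a b => m (val a) (val b))
    (fun a b => cox_label_sym m (val a) (val b))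
    (fun a b => cox_label_ge2 m (val a) (val b)).

Definition vec_restrict (v : {ffun I -> R}) : {ffun T -> R} :=
  [ffun a => v (val a)].

Lemma coroot_restrict (v : {ffun I -> R}) (a : T) : (forall i, i \notin K ->
  v i = 0) ->
  coroot m (val a) v = coroot restrict a (vec_restrict v).
Proof.
move=> vK; rewrite /coroot (bigID (mem K)) /= [X in _ + X]big1 => [|i /vK ->];
  last first.
  by rewrite mulr0.
by rewrite addr0 big_sub; apply: eq_bigr => b _; rewrite ffunE; congr (_ * _).
Qed.

Lemma act_restrict (s : seq T) (v : {ffun I ->
  R}) : (forall i, i \notin K -> v i = 0) ->
  vec_restrict (act m (map val s) v) = act restrict s (vec_restrict v) /\
  (forall i, i \notin K -> act m (map val s) v i = 0).
Proof.
move=> vK; elim: s => [|a s [IH1 IH2]] //=; split=> [|i iK].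
  by apply/ffunP => b; rewrite !ffunE coroot_restrict // -IH1 ffunE.
rewrite ffunE IH2 // sub0r.
have /negPf -> : i != val a by apply: contraNneq iK => ->; exact: valP.
by rewrite mul0r oppr0.
Qed.

Lemma vec_restrict_sroot (a : T) : vec_restrict (sroot R (val a)) = sroot R a.
Proof. by apply/ffunP => b; rewrite !ffunE val_eqE. Qed.

Variables (w0 : cox_group m) (e : I -> I) (x : I).
Hypothesis xK : x \in K.
Hypothesis connK : forall k, k \in K -> connect (cadj_in m K) x k.
Hypothesis ow0 : over (cox_gen m) K w0.
Hypothesis w0e : forall k, k \in K ->
  e k \in K /\ cox_act w0 (sroot R k) = - sroot R (e k).

Lemma restrict_opposite : exists (s : seq T) (e' : T -> T),
  (forall a, act restrict s (sroot R a) = - sroot R (e' a)) /\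
  (forall a, val (e' a) = e (val a)).
Proof.
have [_ [s [sK w0E _]]] := ow0.
have [s' s'E] : exists s' : seq T, map val s' = s.
  exists (pmap insub s); rewrite pmap_filter; last exact: insubK.
  by apply/all_filterP/allP => i /sK iK; rewrite isSome_insub.
have eK (a : T) : e (val a) \in K by have [] := w0e (valP a).
exists s', (fun a => Sub (e (val a)) (eK a)); split=> a; last by rewrite SubK.
have out i : i \notin K -> sroot R (val a) i = 0.
  move=> iK; rewrite ffunE; have /negPf -> // : i != val a.
  by apply: contraNneq iK => ->; exact: valP.
have [h _] := act_restrict s' out; move: h;
  rewrite s'E vec_restrict_sroot => <-.
have [_ wa] := w0e (valP a).
have -> : act m s (sroot R (val a)) = - sroot R (e (val a)).
  rewrite -wa w0E -[cox_act _ _]/(rho (fun y => y) _ _).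
  by rewrite (rho_word (cox_realizes m K)).
by apply/ffunP => b; rewrite !ffunE; congr (- (_%:R)).
Qed.

Lemma restrict_connected (a b : T) : connect (cadj restrict) a b.
Proof.
have lift (p : seq I) (c : T) : path (cadj_in m K) (val c) p ->
    exists2 d : T, val d = last (val c) p & connect (cadj restrict) c d.
  elim: p c => [|y p IHp] c /=; first by exists c.
  move=> /andP[/and3P[cK yK cy]] pp; have [d dE cd] := IHp (exist _ y yK) pp.
  by exists d => //; apply: connect_trans cd; apply: connect1; move: cy.
have fromx (c : T) : connect (cadj restrict) (exist _ x xK) c.
  have /connectP[p pp pc] := connK (valP c).
  have [d dE] := lift p (exist _ x xK) pp; rewrite (_ : d = c) //.
  by apply: val_inj; rewrite dE pc.
apply: connect_trans (fromx b).
by rewrite (sym_connect_sym (@cadj_sym _ restrict)); exact: fromx.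
Qed.

Lemma restrict_admissible : e x != x -> cox_admissible restrict.
Proof.
move=> ex; have [s [e' [se e'E]]] := restrict_opposite.
apply: (classification se restrict_connected (x0 := exist _ x xK)) => ee.
by move/eqP: ex; apply; have := e'E (exist _ x xK); rewrite ee.
Qed.

(** With an infinite label the sum of the two roots would have norm 1 + 1 - 2 = 0. *)
Lemma restrict_finite_label i j : i \in K -> j \in K -> i != j -> m i j <> None.
Proof.
move=> iK jK ij mij; have [s [e' [se _]]] := restrict_opposite.
pose a : T := exist _ i iK; pose b : T := exist _ j jK.
have ab : a != b by rewrite -val_eqE.
pose v := lin 1 (sroot R a) 1 (sroot R b).
have v0 : nneg v by move=> c; rewrite !ffunE !mul1r addr_ge0 ?ler0n.
have va : v a != 0 by rewrite !ffunE eqxx (negPf ab) mulr0 addr0 mulr1 oner_eq0.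
have := cform_gt0 se restrict_connected v0 va.
rewrite /v form_lin !form_linl !form_root1 !form_root !coroot_root gram_sym.
have -> : gram R restrict a b = -1 by rewrite /gram (negPf ab) /= mij.
lra.
Qed.

End Restriction.

(** * Conjugate parabolic subgroups *)

Section Normalization.
Variables (R : realType) (D : groupType) (X : {fset D}) (Gamma : dyer_graph X).
Local Notation m := (dyer_matrix Gamma).
Local Notation W := (cox_group m).
Local Notation gen := (cox_gen m).
Implicit Types (Y C : {set X}) (d : D) (c v : X) (z b : W).
Local Open Scope group_scope.

Variable F : D -> W.
Hypothesis FM : {morph F : x y / x * y}.
Hypothesis Fval : forall c, F (val c) = dyer_embed Gamma c.

(* The generators of the Coxeter group involved in the images of the elements of
   Y. *)
Definition hat Y : {set X * bool} :=
  [set i | (i.1 \in Y) && (~~ i.2 || (vlabel Gamma i.1 != Some 2))]%SET.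

Definition image Y z := exists2 d, parabolic Y d & z = F d.

Let r K := cox_realizes m K.
Let F1 := F1 FM.
Let FV := FV FM.

Lemma mem_hat_false Y c : ((c, false) \in hat Y) = (c \in Y).
Proof. by rewrite inE /= andbT. Qed.

Lemma image1 Y : image Y 1.
Proof. by exists 1; [exact: parabolic1|rewrite F1]. Qed.

Lemma image_div Y z z' : image Y z -> image Y z' -> image Y (z * z'^-1).
Proof.
move=> [d pd ->] [d' pd' ->]; exists (d * d'^-1); last by rewrite FM FV.
exact: parabolic_div.
Qed.

Lemma imageV Y z : image Y z -> image Y z^-1.
Proof. by move=> /(image_div (image1 Y)); rewrite mul1g. Qed.

Lemma imageM Y z z' : image Y z -> image Y z' -> image Y (z * z').
Proof. by move=> iz /imageV iz'; rewrite -[z']invgK; exact: image_div. Qed.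

Lemma image_val Y c : c \in Y -> image Y (dyer_embed Gamma c).
Proof. by move=> cY; exists (val c); [exact: parabolic_val|rewrite Fval]. Qed.

Lemma image_ind Y (P : W -> Prop) : P 1 -> (forall z z', P z -> P z' ->
  P (z * z'^-1)) ->
  (forall c, c \in Y -> P (dyer_embed Gamma c)) -> forall z, image Y z -> P z.
Proof.
move=> P1 PM Pv _ [d pd ->].
apply: (parabolic_ind (P := fun d => P (F d))) pd => [|x y px py|c cY].
- by rewrite F1.
- by rewrite FM FV; exact: PM.
- by rewrite Fval; exact: Pv.
Qed.

Lemma image_over Y z : image Y z -> over gen (hat Y) z.
Proof.
apply: image_ind => [|z1 z2 o1 o2|c cY]; first exact: over1.
  by apply: overM => //; exact: (overV (r _)).
have oc : over gen (hat Y) (gen (c, false)).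
  by apply: over_gen; rewrite mem_hat_false.
rewrite /dyer_embed; case: ifP => // c2.
by apply: overM => //; apply: over_gen; rewrite inE /= cY c2.
Qed.

Lemma genV i : (gen i)^-1 = gen i.
Proof. exact: mulg1_eq (gen_sqr Gamma i). Qed.

Lemma image_conj_ind Y i : (forall c, c \in Y ->
  image Y (gen i * dyer_embed Gamma c * gen i)) ->
  forall z, image Y z -> image Y (gen i * z * gen i).
Proof.
move=> h; apply: image_ind => // [|z z' iz iz'].
  by rewrite mulg1 gen_sqr; exact: image1.
have -> : gen i * (z * z'^-1) * gen i = (gen i * z * gen i) * (gen i * z' * gen
  i)^-1.
  by rewrite !invgM genV !mulgA -[gen i * z * gen i * gen i]mulgA gen_sqr mulg1.
exact: image_div.
Qed.

(** [(a, true)] inverts the image of a and commutes with the images of the other vertices;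
    [(a, false)] is the image of a, or that image times [(a, true)]. So these generators may be used
    freely to shorten a transporting element. *)
Lemma image_conj_gen Y i z : i \in hat Y -> image Y z ->
  image Y (gen i * z * gen i).
Proof.
case: i => a s; rewrite inE /= => /andP[aY].
have large : vlabel Gamma a != Some 2 -> forall z, image Y z ->
    image Y (gen (a, true) * z * gen (a, true)).
  move=> a2; apply: image_conj_ind => c cY.
  have [->|ca] := eqVneq c a.
    have -> : gen (a, true) * dyer_embed Gamma a * gen (a,
      true) = (dyer_embed Gamma a)^-1.
      by rewrite /dyer_embed (negPf a2) invgM !genV -!mulgA gen_sqr mulg1.
    exact/imageV/image_val.
  have comm s' : commute (gen (a, true)) (gen (c, s')).
    by apply: gen_commute; rewrite /dyer_label /= [a == c]eq_sym (negPf ca);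
      case: s'.
  have : commute (gen (a, true)) (dyer_embed Gamma c).
    by rewrite /dyer_embed; case: ifP => _; [|apply: commuteM].
  by move=> ->; rewrite -mulgA gen_sqr mulg1; exact: image_val.
case: s => /= [|_ iz]; first by move=> a2; exact: large.
have [a2|a2] := boolP (vlabel Gamma a == Some 2).
  have -> : gen (a, false) = dyer_embed Gamma a by rewrite /dyer_embed a2.
  by apply: imageM; [apply: imageM|] => //; exact: image_val.
have e1 : gen (a, false) = dyer_embed Gamma a * gen (a, true).
  by rewrite /dyer_embed (negPf a2) -mulgA gen_sqr mulg1.
have e2 : gen (a, false) = gen (a, true) * (dyer_embed Gamma a)^-1.
  by rewrite /dyer_embed (negPf a2) invgM !genV mulgA gen_sqr mul1g.
rewrite {1}e1 e2.
have -> : dyer_embed Gamma a * gen (a, true) * z * (gen (a,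
  true) * (dyer_embed Gamma a)^-1) =
    dyer_embed Gamma a * (gen (a, true) * z * gen (a,
      true)) * (dyer_embed Gamma a)^-1.
  by rewrite !mulgA.
apply: image_div; last exact: image_val.
by apply: imageM; [exact: image_val|exact: large].
Qed.

Definition transports Y Y' b :=
  (forall z, image Y z -> image Y' (b * z * b^-1)) /\
  (forall z, image Y' z -> image Y (b^-1 * z * b)).

Lemma transportsV Y Y' b : transports Y Y' b -> transports Y' Y b^-1.
Proof. by move=> [h1 h2]; split=> z; rewrite invgK; [exact: h2|exact: h1]. Qed.

Lemma transports_gen Y Y' b i : i \in hat Y -> transports Y Y' b ->
  transports Y Y' (b * gen i).
Proof.
move=> iY [h1 h2]; split=> z iz; rewrite invgM genV.
  have -> : b * gen i * z * (gen i * b^-1) = b * (gen i * z * gen i) * b^-1 by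
    rewrite !mulgA.
  exact/h1/image_conj_gen.
have -> : gen i * b^-1 * z * (b * gen i) = gen i * (b^-1 * z * b) * gen i by
  rewrite !mulgA.
exact/image_conj_gen/h2.
Qed.

Lemma parabolic_transports Y Y' d : conjugate_by d (parabolic Y) = parabolic Y'
  ->
  transports Y Y' (F d).
Proof.
move=> e; split=> _ [x px ->].
  exists (d * x * d^-1); last by rewrite !FM FV.
  by rewrite -e; exists x.
exists (d^-1 * x * d); last by rewrite !FM FV.
by apply/conjugate_byP; rewrite e.
Qed.

(* Elements of the image of [parabolic Y'] move vectors only along the
   coordinates in [hat Y']; applied to the conjugate of the image of a generator
   this bounds the support of the images of its roots, which are positive. *)
Lemma transports_simple Y Y' b : transports Y Y' b ->
  (forall i, i \in hat Y -> nneg (cox_act b (sroot R i))) ->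
  (forall j, j \in hat Y' -> nneg (cox_act b^-1 (sroot R j))) ->
  forall i, i \in hat Y ->
    exists2 j, j \in hat Y' & cox_act b (sroot R i) = sroot R j.
Proof.
move=> [h1 _] bpos bVpos i iY.
have out c : c \in Y -> forall u k, k \notin hat Y' ->
    cox_act b (cox_act (dyer_embed Gamma c) u) k = cox_act b u k :> R.
  move=> cY u k kY'; have /h1/image_over o := image_val cY.
  have := rho_out (R := R) (r _) (cox_act b u) o kY'.
  by rewrite /rho -!cox_actM mulgVK => ->.
have supp k : k \notin hat Y' -> cox_act b (sroot R i) k = 0.
  move=> kY'; have := iY; case: i iY => a s iY; rewrite inE /= => /andP[aY as2].
  have [a2|a2] := boolP (vlabel Gamma a == Some 2).
    move: as2; rewrite a2 orbF; case: s iY => // iY _.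
    have := out a aY (sroot R (a, false)) k kY'.
    rewrite /dyer_embed a2 cox_act_gen refl_root cox_act_lin ffunE; lra.
  have ne : (a, false) != (a, true) by apply/eqP => -[].
  (* The image of a moves the root of [(a, true)] by -2 c times the root of [(a, false)] minus twice
     itself, where c > 0. Two nonnegative coordinates thus have a vanishing positive combination, so
     both are 0. *)
  have := out a aY (sroot R (a, true)) k kY'.
  rewrite /dyer_embed (negPf a2) cox_actM !cox_act_gen refl_root refl_lin.
  rewrite refl_root_neq // !cox_act_lin !ffunE /= {1 2}/dyer_label /= eqxx.
  have c0 := vlabel_cosl_gt0 R a2; set c := cosl R _ in c0 *.
  have p1 : 0 <= cox_act b (sroot R (a, false)) k by apply: bpos;
    rewrite mem_hat_false.
  have p2 : 0 <= cox_act b (sroot R (a, true)) k by apply: bpos;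
    rewrite inE /= aY a2.
  by move=> h; case: s {iY as2}; nra.
have [||||j jY' hj] := @simple_image R _ m b i 1 (hat Y').
- by rewrite expr1n.
- exact: supp.
- by move=> j; rewrite mul1r; exact: bpos.
- by move=> j k jY'; rewrite mul1r; exact: bVpos.
by exists j => //; apply/ffunP => k; rewrite hj; exact: mul1r.
Qed.

Lemma minimal_transport Y Y' b : transports Y Y' b -> exists b', [/\
  transports Y Y' b',
  forall i, i \in hat Y -> nneg (cox_act b' (sroot R i)) &
  forall j, j \in hat Y' -> nneg (cox_act b'^-1 (sroot R j))].
Proof.
move=> tb; pose P n := `[< exists2 b', transports Y Y' b' & len gen [set: X *
  bool]%SET b' = n >].
have P0 : exists n, P n by exists (len gen [set: X * bool]%SET b);
  apply/asboolP; exists b.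
case: (ex_minnP P0) => n /asboolP[b' tb' <-] nmin {n}.
exists b'; split=> // [i iY|j jY'].
  apply: (len_nneg R (r [set: X * bool]%SET)); rewrite ?inE //;
    first exact: cox_over.
  by apply: nmin; apply/asboolP; exists (b' * gen i) => //;
    exact: transports_gen.
apply: (len_nneg R (r [set: X * bool]%SET)); rewrite ?inE //;
  first exact: cox_over.
rewrite (lenV (r _)); last exact: cox_over.
apply: nmin; apply/asboolP; exists (gen j * b').
  rewrite -[_ * _]invgK invgM genV; apply/transportsV/transports_gen => //.
  exact: transportsV.
by rewrite -[gen j * b']invgK invgM genV (lenV (r _)) //; exact: cox_over.
Qed.

Lemma hat_inj : injective hat.
Proof. by move=> Y Y' e; apply/setP => c; rewrite -!mem_hat_false e. Qed.

End Normalization.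

(** * Elementary steps as edges of the conjugacy graph *)

Section Step.
Variables (R : realType) (D : groupType) (X : {fset D}) (Gamma : dyer_graph X).
Local Notation m := (dyer_matrix Gamma).
Local Notation W := (cox_group m).
Local Notation gen := (cox_gen m).
Local Notation hat := (hat Gamma).
Implicit Types (Y C : {set X}) (d : D) (c v : X) (z b : W).
Local Open Scope group_scope.

Hypothesis rel : forall s t, dyer_rel Gamma s t ->
  eval_word val s = eval_word val t.
Variable F : D -> W.
Hypothesis FM : {morph F : x y / x * y}.
Hypothesis Fval : forall c, F (val c) = dyer_embed Gamma c.

(** The two generators attached to such a vertex have only the labels 2 and None to the others, so
    the parity of their letters is an invariant. *)
Lemma conj_gen_large z i j : z * gen i = gen j * z ->
  vlabel Gamma i.1 != Some 2 -> j.1 = i.1.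
Proof.
move=> zij i2; pose S := [set k : X * bool | k.1 == i.1]%SET.
suff : (i \in S) = (j \in S) by rewrite !inE eqxx => /esym/eqP.
apply: (@conj_gen_parity _ m S _ z) zij => k l n; rewrite !inE => /eqP ki li /=.
have kl : k.1 != l.1 by rewrite ki eq_sym.
rewrite /dyer_label (negPf kl); case: ifP => _; last by move=> [<-].
rewrite orbF; case: ifP => _; first by move=> [<-].
have k2 : vlabel Gamma k.1 != Some 2 by rewrite ki.
by case: (mlabel_large kl (or_introl k2)) => -> // [<-].
Qed.

(** At a vertex of order 2 the added involution commutes with every generator, so the parity of this
    single letter is an invariant. *)
Lemma conj_gen_small z i j : z * gen i = gen j * z ->
  vlabel Gamma i.1 = Some 2 -> i.2 -> j = i.
Proof.
move=> zij i2 it; pose S := [set i]%SET.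
suff : (i \in S) = (j \in S) by rewrite !inE eqxx => /esym/eqP.
apply: (@conj_gen_parity _ m S _ z) zij => k l n; rewrite !inE => /eqP -> li /=.
rewrite /dyer_label it; case: ifP => [_ [<-]|_] //.
by case: ifP => _; rewrite ?i2 => -[<-].
Qed.

Lemma chain_step Y A x t (K : {set X * bool}) (w0 : W) (e : X * bool ->
  X * bool) :
  (exists2 Y1, A = hat Y1 & same_component Gamma Y Y1) ->
  x \notin A -> t \in A -> K \subset x |: A -> x \in K -> t \in K ->
  (forall k, (k \in K) = connect (cadj_in m (x |: A)%SET) x k) ->
  over gen K w0 ->
  (forall k, k \in K -> e k \in K /\ cox_act w0 (sroot R k) = (- sroot R (e
    k))%R) ->
  e x = t ->
  exists2 Y1, ((x |: A) :\ t)%SET = hat Y1 & same_component Gamma Y Y1.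
Proof.
move=> [Y1 AE YY1] xA tA KxA xK tK KE ow0 he ext;
  rewrite {}AE in xA tA KxA KE *.
have r := cox_realizes m K.
have xt : x != t by apply: contraNneq xA => ->.
have zxt : w0 * gen x = gen t * w0.
  by rewrite -ext; exact: (opposite_conj r ow0 he).
have ztx : w0^-1 * gen t = gen x * w0^-1.
  by apply: (mulgI w0); apply: (mulIg w0);
    rewrite !mulgA mulgV mul1g -zxt -!mulgA mulVg mulg1.
(* Otherwise t belongs to the same vertex as x, and [hat Y1] contains both generators of such a
   vertex or none, whereas it contains t and not x. *)
have x2 : vlabel Gamma x.1 = Some 2.
  apply/eqP; apply: contraT => x2; have tx := conj_gen_large zxt x2.
  by move: tA xA; rewrite !inE tx => /andP[-> _]; rewrite x2 orbT.
have xf : x.2 = false.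
  by apply/negbTE/negP => xb; rewrite (conj_gen_small zxt x2 xb) eqxx in xt.
have t2 : vlabel Gamma t.1 = Some 2.
  apply/eqP; apply: contraT => t2; have := conj_gen_large ztx t2.
  by move=> xt1; rewrite -xt1 x2 in t2.
have tf : t.2 = false by move: tA; rewrite inE t2 eqxx orbF => /andP[_ /negbTE].
have [x0 x0E] : exists x0, x = (x0, false) by exists x.1; rewrite -xf;
  case: (x).
have [t0 t0E] : exists t0, t = (t0, false) by exists t.1; rewrite -tf;
  case: (t).
rewrite {}x0E {}t0E /= in xA tA KxA xK tK KE ext xt zxt ztx x2 t2 xf tf *.
have x0t0 : x0 != t0 by apply: contraNneq xt => ->.
have x0Y : x0 \notin Y1 by rewrite -(mem_hat_false Gamma).
have t0Y : t0 \in Y1 by rewrite -(mem_hat_false Gamma).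
have connK k : k \in K -> connect (cadj_in m K) (x0, false) k.
  rewrite KE => /connectP[p + ->]; elim/last_ind: p => [|p y IHp] //.
  rewrite rcons_path last_rcons => /andP[pp /and3P[lA yA ly]].
  apply: connect_trans (IHp pp) (connect1 _).
  have lK : last (x0, false) p \in K by rewrite KE; apply/connectP; exists p.
  rewrite /cadj_in /= lK ly andbT KE.
  apply: connect_trans (_ : connect _ (x0, false) (last (x0, false) p)) _.
    by rewrite -KE.
  by apply: connect1; rewrite /cadj_in /= lA yA.
have Kinv k : k \in K -> k.2 = false /\ vlabel Gamma k.1 = Some 2.
  move=> kK; have /connectP[p pp ->] := connK k kK.
  elim/last_ind: p pp => [|p y IHp] //; rewrite rcons_path last_rcons.
  move=> /andP[/IHp[]]; set l := last _ p => lf l2 /and3P[lK yK ly].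
  have ly' : l != y := cadj_neq ly.
  have y2 : vlabel Gamma y.1 = Some 2.
    apply/eqP; apply: contraT => y2.
    have l1y1 : l.1 != y.1 by apply: contraNneq y2 => <-; rewrite l2.
    have fin := restrict_finite_label xK connK ow0 he lK yK ly'.
    have /andP[_ /eqP] := ly; move: fin;
      rewrite /= /dyer_label (negPf l1y1) lf /=.
    by case: ifP => // _; case: (mlabel_large l1y1 (or_intror y2)) => ->.
  split=> //; have := fintype.subsetP KxA y yK; rewrite !inE y2 eqxx orbF.
  by case/orP => [/eqP -> //|/andP[_ /negbTE]].
pose C := [set c | (c, false) \in K]%SET.
have KC : K = lift_false C.
  apply/setP => -[c s]; rewrite !inE /=; case: s => /=;
    rewrite ?andbT ?andbF //.
  by apply/negP => /Kinv[].
have C2 c : c \in C -> vlabel Gamma c = Some 2 by rewrite inE => /Kinv[].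
pose Z := (x0 |: Y1)%SET.
have memZ c : ((c, false) \in (x0, false) |: hat Y1) = (c \in Z).
  by rewrite /Z !inE /= andbT xpair_eqE andbT.
have adjE c c' : c \in Z -> c' \in Z ->
    cadj_in m ((x0, false) |: hat Y1) (c, false) (c', false) = adj Gamma c c'.
  move=> cZ c'Z; rewrite /cadj_in /= !memZ cZ c'Z /= /cadj /= /dyer_label /=.
  have [->|cc'] := eqVneq c c'; first by rewrite adj_irr eqxx.
  have -> /= : (c, false) != (c', false) by apply: contraNneq cc' => -[->].
  rewrite /mlabel; case: ifP => // cc; have := elabel_gt2 cc.
  by case: (elabel _ _ _) => [[|[|[|]]]|].
have CZ c : c \in C -> c \in Z.
  by rewrite inE => /(fintype.subsetP KxA); rewrite memZ.
have CI c : c \in C -> c \in involutions Z.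
  move=> cC; rewrite inE CZ //= (order_two_label R rel FM Fval).
  exact/eqP/C2.
have x0C : x0 \in C by rewrite inE.
have t0C : t0 \in C by rewrite inE.
have conn_lift (Z' : {set X}) c : (forall c, c \in Z' -> c \in Z) ->
    connect (induced_adj Gamma Z') x0 c -> c \in C.
  move=> sub /connectP[p + ->]; elim/last_ind: p => [|p y IHp] //.
  rewrite rcons_path last_rcons => /andP[/IHp + /and3P[lZ yZ ly]].
  rewrite !inE !KE => h; apply: connect_trans h (connect1 _).
  by rewrite adjE ?sub.
have conn_drop c : c \in C -> connect (induced_adj Gamma (involutions Z)) x0 c.
  rewrite inE => /connK/connectP[p].
  have -> : connect (induced_adj Gamma (involutions Z)) x0 c =
            connect (induced_adj Gamma (involutions Z)) x0 (c, false).1 by [].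
  move=> + ->; elim/last_ind: p => [|p y IHp] //.
  rewrite rcons_path last_rcons => /andP[/IHp h /and3P[lK yK ly]].
  apply: connect_trans h (connect1 _).
  move: lK yK ly; rewrite KC => /lift_falseP[lE lC] /lift_falseP[yE yC].
  rewrite lE yE => ly; rewrite /induced_adj /= !CI //= -adjE ?CZ //.
  by rewrite /cadj_in /= !memZ !CZ.
(* Applied to Z and to its involutions, this gives the two component conditions of an edge. *)
have components_C (Z' : {set X}) : (forall c, c \in Z' -> c \in Z) ->
    (forall c, c \in C -> c \in Z') ->
    (forall c, c \in C -> connect (induced_adj Gamma Z') x0 c) ->
    C \in components Gamma Z'.
  move=> sub sub' cn; apply/imsetP; exists x0; first exact: sub'.
  apply/setP => c; rewrite [in RHS]inE; apply/idP/andP => [cC|[_ h]].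
    by split; [exact: sub'|exact: cn].
  exact: conn_lift h.
have rD := realizes_lift_false rel FM Fval C2.
(* The word of w0 is evaluated in D; its product acts on roots like w0, so it is a longest element
   of D_C. *)
have [wD [owD wDE]] : exists wD, over (fun i : X * bool =>
  val i.1) (lift_false C) wD /\
    forall u : {ffun X * bool -> R}, rho F wD u = cox_act w0 u.
  have [_ [s [sK -> _]]] := ow0; exists (\prod_(k <- s) val k.1).
  rewrite -KC in rD *; split=> [|u]; first exact: over_word.
  by rewrite (rho_word rD) // -[RHS]/(rho (fun y => y) _ u) (rho_word r).
have heD k : k \in lift_false C -> e k \in lift_false C /\
    rho F wD (sroot R k) = (- sroot R (e k))%R.
  by rewrite -KC => /he; rewrite wDE.
have ww := opposite_involution rD owD heD.
have edge : conj_edge Gamma Z x0 t0.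
  split=> //.
    by rewrite !(order_two_label R rel FM Fval) x2 t2 eqxx.
  exists C; split.
  - apply/andP; split; apply: components_C => //.
    + move=> c /conn_drop; apply: connect_sub => a b /and3P[aI bI ab].
      apply: connect1; rewrite /induced_adj /= ab andbT.
      by move: aI bI; rewrite !inE => /andP[-> _] /andP[-> _].
    + by move=> c; rewrite inE => /andP[].
  - by rewrite x0C.
  - have adm := restrict_admissible xK connK ow0 he.
    have {adm} : cox_admissible (restrict m K) by apply: adm;
      rewrite ext eq_sym.
    have type n M : cox_type (restrict m K) n M -> has_type Gamma C n M.
      move=> [h [hinj hcov hM]].
      have hE i : val (h i) = ((val (h i)).1, false).
        by have [+ _] := Kinv _ (valP (h i)); case: (val (h i)) => a s /= ->.
      exists (fun i => (val (h i)).1); split.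
      + by move=> i j hij; apply/hinj/val_inj; rewrite hE hij -hE.
      + apply/setP => c; apply/imsetP/idP => [[i _ ->]|cC].
          by rewrite inE -hE; exact: valP.
        have cK : (c, false) \in K by move: cC; rewrite inE.
        by have [i iE] := hcov (exist (fun i : X * bool => i \in K) (c,
          false) cK); exists i; rewrite // -iE.
      + move=> i j ij; rewrite -hM //= /dyer_label (hE i) (hE j) /=.
        case: eqVneq => // hij; case/eqP: ij; apply/hinj/val_inj.
        by rewrite hE hij -hE.
    case=> [[l l2 /type h]|[l l2 /type h]|/type h|[q q2 /type h]].
    + by constructor 1; exists l.
    + by constructor 2; exists l.
    + by constructor 3.
    + by constructor 4; exists q.
  - exists wD.
      apply/(longestP rel FM Fval C2); split=> // u ou.
      have wneg i : i \in lift_false C -> npos (rho F wD (sroot R i)).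
        by move=> /heD[_ ->] j; rewrite !ffunE oppr_le0 ler0n.
      apply: leq_trans (longest_len rD owD ou wneg); exact: leq_addl.
    have xL : (x0, false) \in lift_false C by rewrite -KC.
    by have := opposite_conj rD owD heD xL; rewrite ext /= => ->;
      rewrite -mulgA ww mulg1.
exists (Z :\ t0)%SET.
  apply/setP => -[c s]; rewrite !inE /= !xpair_eqE.
  case: s => /=; rewrite ?andbF ?andbT //=.
  have [c2|c2] := eqVneq (vlabel Gamma c) (Some 2); rewrite ?andbF ?andbT //.
  have -> : c != t0 by apply: contraNneq c2 => ->; apply/eqP.
  by have /negPf -> : c != x0 by apply: contraNneq c2 => ->; apply/eqP.
have Y1E : Y1 = (Z :\ x0)%SET by rewrite /Z setU1K.
apply: connect_trans YY1 (connect1 _); apply/asboolP.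
by exists Z, x0, t0; split=> //; left.
Qed.

End Step.

Theorem theorem3p6 (D : groupType) (X : {fset D}) (Gamma : dyer_graph X)
    (sysDX : dyer_system Gamma) (Y Y' : {set X}) :
  [<-> exists alpha : D, conjugate_by alpha (elements Y) = elements Y';
       exists beta : D, conjugate_by beta (parabolic Y) = parabolic Y';
       same_component Gamma Y Y'].
Proof.
have rel := dyer_system_rel sysDX.
have [F [FM Fval]] := dyer_system_morphism sysDX.
pose R : realType := Rdefinitions.R.
split; first by move=> [a aE]; exists a; exact: conjugate_parabolic.
split; last first.
  by move=> YY'; exact: (same_component_conjugate R rel FM Fval YY').
move=> [d dE]; have t0 := parabolic_transports FM dE.
have [b [tb bY bY']] := minimal_transport R FM Fval t0.
have s1 := transports_simple FM Fval tb bY bY'.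
have s2 : forall i, i \in hat Gamma Y' ->
    exists2 j, j \in hat Gamma Y & cox_act b^-1%g (sroot R i) = sroot R j.
  apply: (transports_simple FM Fval (transportsV tb)) => //.
  by move=> j; rewrite invgK; exact: bY.
(* The action of z is injective on roots; used for b and for its inverse, this gives the equality of
   cardinals that the chain argument requires. *)
have card_le (A B : {set X * bool}) (z : cox_group (dyer_matrix Gamma)) :
    (forall i, i \in A -> exists2 j, j \in B & cox_act z (sroot R i) = sroot R
      j) ->
    (#|A| <= #|B|)%N.
  move=> h; have /choice[f fP] : forall i, exists j, i \in A ->
      j \in B /\ cox_act z (sroot R i) = sroot R j.
    move=> i; have [/h[j jB ij]|iA] := boolP (i \in A); first by exists j.
    by exists i.
  have finj : {in A &, injective f}.
    move=> i j iA jA fij; have [_ hi] := fP i iA; have [_ hj] := fP j jA.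
    by apply: (@sroot_inj R); rewrite -[LHS](cox_actK z) -[RHS](cox_actK z) hi
      hj fij.
  rewrite -(card_in_imset finj) subset_leq_card //.
  by apply/fintype.subsetP => _ /imsetP[i iA ->]; have [] := fP i iA.
have card_eq : #|hat Gamma Y| = #|hat Gamma Y'|.
  by apply/eqP; rewrite eqn_leq (card_le _ _ _ s1) (card_le _ _ _ s2).
have [||Y1 /hat_inj -> //] := simple_sets_chain
  (P := fun A => exists2 Y1, A = hat Gamma Y1 & same_component Gamma Y Y1)
  _ _ card_eq s1; last by exists Y => //; exact: connect0.
by move=> A x t K w0 e; exact: (chain_step rel FM Fval).
Qed.
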